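(* Let $C$ be a simple closed contour with bounded interior $\mathcal{D}^+$ and exterior $\mathcal{D}^-$, let $n\ge 0$ be an integer, let $f$ be a generalized Cauchy function of order $n$ with respect to $C$, and let $F$ be a complement function of order $n$ with respect to $C$. For $z\in C$ put $$K_n[f(z)]=\frac{1}{\pi i}\,\mathcal{P}\oint_C\frac{f^{(n)}(t)}{t-z}\,dt,\qquad K_n^-[F(z)]=\frac{-1}{\pi i}\,\mathcal{P}\oint_C\frac{F^{(n)}(t)}{t-z}\,dt.$$ Then $$\oint_C K_n[f(z)]\,dz=\oint_C f^{(n)}(z)\,dz=0,\qquad \oint_C K_n^-[F(z)]\,dz=\oint_C F^{(n)}(z)\,dz=0.$$
   Context: $C$ is a simple closed regular (smooth) curve in the complex plane, traversed counterclockwise; $\mathcal{D}^+$ is the simply connected open domain bounded by $C$, and $\mathcal{D}^-$ is the open domain outside $C$. A generalized Cauchy function of order $n$ with respect to $C$ is a single-valued holomorphic function that is $n$ times continuously (complex) differentiable in $\mathcal{D}^+$ and in a neighborhood of $C$. A complement function of order $n$ with respect to $C$ is a single-valued holomorphic function $F$ that is $n$ times continuously (complex) differentiable in $\mathcal{D}^-$ and in a neighborhood of $C$, with $F(z)=O(|z|^{-m})$ for some $m\ge2$ as $|z|\to\infty$. The symbol $\mathcal{P}$ denotes the Cauchy principal value at $t=z$: the limit as $\epsilon\to0^+$ of the integral over the part of $C$ with $|t-z|\ge\epsilon$. $f^{(0)}=f$ and $F^{(0)}=F$. *)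

(* Defs.v *)
From Stdlib Require Import Reals.
From Coquelicot Require Import Coquelicot.

Open Scope R_scope.

(* A simple closed regular C^1 curve, given by a periodic parametrization of the
   whole line, so that the tangent also matches where the curve closes up. *)
Record closed_curve := ClosedCurve {
  param :> R -> C;
  velocity : R -> C;
  period : R;
  period_pos : 0 < period;
  param_periodic : forall s, param (s + period) = param s;
  param_derive : forall s,
    is_derive (K := R_AbsRing) (V := C_R_NormedModule) param s (velocity s);
  velocity_continuous : forall s,
    continuous (T := R_UniformSpace) (U := C_UniformSpace) velocity s;
  velocity_neq0 : forall s, velocity s <> RtoC 0;
  param_simple : forall s t,
    0 <= s < period -> 0 <= t < period -> param s = param t -> s = t
}.

Definition on_curve (c : closed_curve) (z : C) : Prop := exists s, c s = z.

Definition joined_off (c : closed_curve) (z w : C) : Prop :=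
  exists p : R -> C,
    (forall t, continuous (T := R_UniformSpace) (U := C_UniformSpace) p t) /\
    p 0 = z /\ p 1 = w /\
    (forall t, 0 <= t <= 1 -> ~ on_curve c (p t)).

Definition bounded_set (A : C -> Prop) : Prop :=
  exists M : R, forall z, A z -> Cmod z <= M.

(* The complement of the curve is open, so its components are its path
   components; the interior and exterior are its bounded and unbounded ones. *)
Definition interior_domain (c : closed_curve) (z : C) : Prop :=
  ~ on_curve c z /\ bounded_set (joined_off c z).

Definition exterior_domain (c : closed_curve) (z : C) : Prop :=
  ~ on_curve c z /\ ~ bounded_set (joined_off c z).

(* The interior lies to the left of the direction of travel. *)
Definition counterclockwise (c : closed_curve) : Prop :=
  forall s, at_right 0 (fun d : R =>
    interior_domain c (c s + RtoC d * (Ci * velocity c s))%C).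

Fixpoint C_derive_n (f : C -> C) (n : nat) : C -> C :=
  match n with
  | O => f
  | S k => C_derive (C_derive_n f k)
  end.

Definition C_differentiable (f : C -> C) (z : C) : Prop :=
  ex_derive (K := C_AbsRing) (V := C_NormedModule) f z.

Definition holomorphic_on (U : C -> Prop) (f : C -> C) : Prop :=
  forall z, U z -> C_differentiable f z.

Definition n_times_cont_diff_on (n : nat) (U : C -> Prop) (f : C -> C) : Prop :=
  (forall k, (k < n)%nat -> holomorphic_on U (C_derive_n f k)) /\
  (forall k, (k <= n)%nat -> forall z, U z ->
     continuous (T := C_UniformSpace) (U := C_UniformSpace) (C_derive_n f k) z).

Definition neighborhood_of_curve (c : closed_curve) (V : C -> Prop) : Prop :=
  open (T := C_UniformSpace) V /\ (forall z, on_curve c z -> V z).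

Definition holomorphic_of_order (n : nat) (c : closed_curve) (D : C -> Prop)
    (f : C -> C) : Prop :=
  exists V : C -> Prop, neighborhood_of_curve c V /\
    holomorphic_on (fun z => D z \/ V z) f /\
    n_times_cont_diff_on n (fun z => D z \/ V z) f.

Definition generalized_Cauchy_function (n : nat) (c : closed_curve) (f : C -> C)
    : Prop :=
  holomorphic_of_order n c (interior_domain c) f.

Definition complement_function (n : nat) (c : closed_curve) (F : C -> C) : Prop :=
  holomorphic_of_order n c (exterior_domain c) F /\
  exists m : nat, (2 <= m)%nat /\
    exists M r : R, 0 < r /\
      forall z, r <= Cmod z -> Cmod (F z) <= M / Cmod z ^ m.

Definition ex_contour_int (c : closed_curve) (h : C -> C) : Prop :=
  ex_RInt (V := C_R_NormedModule)
    (fun s => (h (c s) * velocity c s)%C) 0 (period c).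

Definition contour_int (c : closed_curve) (h : C -> C) : C :=
  RInt (V := C_R_CompleteNormedModule)
    (fun s => (h (c s) * velocity c s)%C) 0 (period c).

(* [filterlimi] asks for the integral over |t - z| >= eps to exist only for all
   sufficiently small eps > 0. *)
Definition is_PV (c : closed_curve) (h : C -> C) (z v : C) : Prop :=
  filterlimi
    (fun eps : R => is_RInt (V := C_R_NormedModule)
       (fun s => if Rle_dec eps (Cmod (c s - z)) then (h (c s) * velocity c s)%C
                 else RtoC 0)
       0 (period c))
    (at_right 0) (locally (T := C_UniformSpace) v).

Definition ex_PV (c : closed_curve) (h : C -> C) (z : C) : Prop :=
  exists v, is_PV c h z v.

Definition PV (c : closed_curve) (h : C -> C) (z : C) : C :=
  iota (T := C_R_CompleteNormedModule) (is_PV c h z).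

Lemma is_PV_unique (c : closed_curve) (h : C -> C) (z v : C) :
  is_PV c h z v -> PV c h z = v.
Proof.
intros Hv.
apply (iota_filterlimi_locally (V := C_R_CompleteNormedModule)
  (F := at_right 0)); [ | exact Hv].
apply filter_forall; intros eps y1 y2 H1 H2.
rewrite <- (is_RInt_unique (V := C_R_CompleteNormedModule) _ _ _ _ H1).
exact (is_RInt_unique (V := C_R_CompleteNormedModule) _ _ _ _ H2).
Qed.

Definition Cauchy_kernel (g : C -> C) (z t : C) : C := (g t / (t - z))%C.

Definition K_op (n : nat) (c : closed_curve) (f : C -> C) (z : C) : C :=
  (1 / (PI * Ci) * PV c (Cauchy_kernel (C_derive_n f n) z) z)%C.

Definition Kminus_op (n : nat) (c : closed_curve) (F : C -> C) (z : C) : C :=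
  (-1 / (PI * Ci) * PV c (Cauchy_kernel (C_derive_n F n) z) z)%C.

(* Main.v *)
Require Import Defs.
From Stdlib Require Import Reals ZArith Lra Lia Psatz ClassicalEpsilon.
From Coquelicot Require Import Coquelicot.

(** Write g for the n-th derivative, which is holomorphic on an open set U made of
    the interior (for f) or the exterior (for F) and a neighborhood of the curve. Let
    wind z be the integral of dt/(t-z) along the curve.

    Geometry. A point w off the curve is joined to a nearest point of the curve by a
    segment that is normal there ([nearest_normal]), and all the points at one small
    fixed distance on the same side of the curve are joined to each other, because the
    pushed-off curve misses the curve ([normal_off_uniform]). Since the left side is
    interior and some point is exterior, the right side is exterior and the interior is
    the component of the left side ([two_sides]). On the exterior, wind is 0, by its
    decay at infinity.

    Jump. Near z on the curve, the short arc seen from a point of the normal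
    is integrated exactly by a logarithm. Letting that point tend to z gives, for the
    integral of dt/(t-z) over the part of the curve outside the arc, the value of wind
    on the left minus i times an angle that tends to pi, and also its value on the right
    plus i times an angle that tends to pi ([outer_limit]). Hence wind is 2 pi i on the interior, and
    the principal value of the integral of dt/(t-z) is pi i.

    Cauchy theorem. Let kappa be the value of wind off U: it is 0 in the first case and
    2 pi i in the second. Following Dixon, the function equal to the integral of
    (g t - g z)/(t - z), plus kappa g z, on U, and to the integral of g t/(t - z) off U,
    is entire and vanishes at infinity, so it is 0 ([dixon]). At a point z of the curve
    this says that the integral of (g t - g z)/(t - z) is - kappa g z. Adding g z times
    pi i, the principal value of the integral of g t/(t - z) is (pi i - kappa) g z, that
    is, pi i g z for f and - pi i g z for F ([boundary_PV]): the operators reproduce g on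
    the curve. The same theorem for g z (z - c 0), at z = c 0, shows that the integral of
    g is 0 ([boundary_integral_zero]); for F this uses the decay of g like the inverse
    square of z, which Cauchy estimates carry from F to its derivatives
    ([derivative_decay]).

    The function theory behind this is local: Goursat's theorem, by bisection of
    rectangles, gives primitives on squares; for a function with a continuous derivative
    the Cauchy formula on circles follows from Fubini's theorem, and it makes derivatives
    holomorphic. *)

Open Scope R_scope.

(** * Continuity, derivatives and integrals of complex-valued functions *)

Notation RU := R_UniformSpace.
Notation CU := C_UniformSpace.

(** The target carries one fixed uniform structure, while the domain may be the line,
    the plane or a product: one set of rules then serves paths, functions and kernels. *)
Definition ccont {T : UniformSpace} (f : T -> C) (x : T) : Prop :=
  continuous (T := T) (U := CU) f x.
Notation ccontR := (ccont (T := RU)).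
Notation ccontC := (ccont (T := CU)).

Lemma Cmod_Rabs_le (z : C) : Cmod z <= Rabs (fst z) + Rabs (snd z).
Proof.
destruct z as [x y]; simpl.
replace (x, y) with (RtoC x + RtoC y * Ci)%C by (apply injective_projections; simpl; ring).
eapply Rle_trans; [apply Cmod_triangle|].
rewrite Cmod_mult, !Cmod_R, Cmod_Ci; lra.
Qed.

Lemma fst_le_Cmod (z : C) : Rabs (fst z) <= Cmod z.
Proof. exact (re_le_Cmod z). Qed.

Lemma snd_le_Cmod (z : C) : Rabs (snd z) <= Cmod z.
Proof.
unfold Cmod; rewrite <- sqrt_Rsqr_abs; apply sqrt_le_1_alt; unfold Rsqr.
pose proof (pow2_ge_0 (fst z)); lra.
Qed.

Lemma locally_Cmod (z : C) (P : C -> Prop) :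
  locally (T := CU) z P <->
  exists d, 0 < d /\ forall w, Cmod (w - z) < d -> P w.
Proof.
split.
- intros [d Hd]; exists d; split; [apply cond_pos|].
  intros w Hw; apply Hd; split.
  + change (Rabs (fst (w - z)%C) < d); pose proof (fst_le_Cmod (w - z)); lra.
  + change (Rabs (snd (w - z)%C) < d); pose proof (snd_le_Cmod (w - z)); lra.
- intros [d [Hd HP]].
  assert (Hd2 : 0 < d / 2) by lra.
  exists (mkposreal _ Hd2); intros w [H1 H2]; apply HP.
  change (Rabs (fst (w - z)%C) < d / 2) in H1.
  change (Rabs (snd (w - z)%C) < d / 2) in H2.
  pose proof (Cmod_Rabs_le (w - z)); lra.
Qed.

Lemma locally_Rabs (x : R) (P : R -> Prop) :
  locally (T := RU) x P <->
  exists d, 0 < d /\ forall y, Rabs (y - x) < d -> P y.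
Proof.
split.
- intros [d Hd]; exists d; split; [apply cond_pos|]. intros y Hy; apply Hd, Hy.
- intros [d [Hd H]]. exists (mkposreal d Hd); intros y Hy; apply H, Hy.
Qed.

Lemma Rabs_between_le x x' u : Rmin x x' <= u <= Rmax x x' -> Rabs (u - x) <= Rabs (x' - x).
Proof.
unfold Rmin, Rmax; destruct (Rle_dec x x'); intros;
  [rewrite !Rabs_right by lra|rewrite !Rabs_left1 by lra]; lra.
Qed.

Lemma Rabs_between_lt x x' u y r : Rabs (x - y) < r -> Rabs (x' - y) < r ->
  Rmin x x' <= u <= Rmax x x' -> Rabs (u - y) < r.
Proof.
intros H1 H2 Hu. apply Rabs_def2 in H1; apply Rabs_def2 in H2. apply Rabs_def1;
revert Hu; unfold Rmin, Rmax; destruct Rle_dec; lra.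
Qed.

Lemma between_le a b s : a <= b -> Rmin a b <= s <= Rmax a b -> a <= s <= b.
Proof. intros H; rewrite Rmin_left, Rmax_right by assumption; auto. Qed.

Lemma sign_cases e : e * e = 1 -> e = 1 \/ e = - (1).
Proof.
intros He. assert (Z : (e - 1) * (e + 1) = 0) by lra.
apply Rmult_integral in Z as [Z|Z]; [left|right]; lra.
Qed.

Lemma Rabs_sign e : e * e = 1 -> Rabs e = 1.
Proof. intros He; destruct (sign_cases e He) as [->| ->]; [|rewrite Rabs_Ropp]; apply Rabs_R1. Qed.

Section Continuity.
Context {T : UniformSpace}.
Implicit Types f g : T -> C.

Lemma ccont_eps f x :
  ccont f x <-> forall e, 0 < e -> locally x (fun y => Cmod (f y - f x) < e).
Proof.
split.
- intros Hf e He. apply (Hf (fun w => Cmod (w - f x) < e)).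
  apply locally_Cmod; exists e; auto.
- intros H P HP. apply locally_Cmod in HP as [d [Hd HP]].
  unfold filtermap. generalize (H d Hd). apply filter_imp. auto.
Qed.

Lemma ccont_fst f x : ccont f x -> continuous (fun y => fst (f y)) x.
Proof. intros H. apply (continuous_comp f fst); [exact H|]. destruct (f x); apply continuous_fst. Qed.

Lemma ccont_snd f x : ccont f x -> continuous (fun y => snd (f y)) x.
Proof. intros H. apply (continuous_comp f snd); [exact H|]. destruct (f x); apply continuous_snd. Qed.

Lemma ccont_pair f x :
  continuous (fun y => fst (f y)) x -> continuous (fun y => snd (f y)) x -> ccont f x.
Proof.
intros H1 H2. apply ccont_eps; intros e He.
assert (He2 : 0 < e / 2) by lra.
assert (L1 := proj1 (filterlim_locally _ _) H1 (mkposreal _ He2)).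
assert (L2 := proj1 (filterlim_locally _ _) H2 (mkposreal _ He2)).
generalize (filter_and _ _ L1 L2); apply filter_imp; intros y [B1 B2].
change (Rabs (fst (f y - f x)%C) < e / 2) in B1.
change (Rabs (snd (f y - f x)%C) < e / 2) in B2.
pose proof (Cmod_Rabs_le (f y - f x)); lra.
Qed.

Lemma ccont_const (a : C) x : ccont (fun _ : T => a) x.
Proof. apply continuous_const. Qed.

Lemma ccont_plus f g x : ccont f x -> ccont g x -> ccont (fun y => f y + g y)%C x.
Proof.
intros Hf Hg; apply ccont_pair; simpl.
- apply (continuous_plus (V := R_NormedModule)); apply ccont_fst; assumption.
- apply (continuous_plus (V := R_NormedModule)); apply ccont_snd; assumption.
Qed.

Lemma ccont_opp f x : ccont f x -> ccont (fun y => - f y)%C x.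
Proof.
intros Hf; apply ccont_pair; simpl.
- apply (continuous_opp (V := R_NormedModule)); apply ccont_fst; assumption.
- apply (continuous_opp (V := R_NormedModule)); apply ccont_snd; assumption.
Qed.

Lemma ccont_minus f g x : ccont f x -> ccont g x -> ccont (fun y => f y - g y)%C x.
Proof. intros Hf Hg; apply ccont_plus; [exact Hf|apply ccont_opp, Hg]. Qed.

Lemma ccont_mult f g x : ccont f x -> ccont g x -> ccont (fun y => f y * g y)%C x.
Proof.
intros Hf Hg; pose proof (ccont_fst _ _ Hf); pose proof (ccont_snd _ _ Hf);
pose proof (ccont_fst _ _ Hg); pose proof (ccont_snd _ _ Hg); apply ccont_pair; simpl.
- apply (continuous_minus (V := R_NormedModule)); apply (continuous_mult (K := R_AbsRing)); assumption.
- apply (continuous_plus (V := R_NormedModule)); apply (continuous_mult (K := R_AbsRing)); assumption.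
Qed.

Lemma ccont_Cmod f x : ccont f x -> continuous (fun y => Cmod (f y)) x.
Proof.
intros Hf. apply filterlim_locally; intros e.
generalize (proj1 (ccont_eps f x) Hf e (cond_pos e)); apply filter_imp; intros y Hy.
change (Rabs (Cmod (f y) - Cmod (f x)) < e).
eapply Rle_lt_trans; [|exact Hy].
apply Rabs_le; split.
- assert (H := Cmod_triangle (f y) (f x - f y)).
  replace (f y + (f x - f y))%C with (f x) in H by ring.
  replace (f x - f y)%C with (- (f y - f x))%C in H by ring. rewrite Cmod_opp in H. lra.
- assert (H := Cmod_triangle (f x) (f y - f x)).
  replace (f x + (f y - f x))%C with (f y) in H by ring. lra.
Qed.

Lemma ccont_inv f x : f x <> RtoC 0 -> ccont f x -> ccont (fun y => / f y)%C x.
Proof.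
intros Hn Hf. pose proof (ccont_fst _ _ Hf) as H1; pose proof (ccont_snd _ _ Hf) as H2.
set (d := fun y => fst (f y) * fst (f y) + snd (f y) * snd (f y)).
assert (Hd : d x <> 0).
{ unfold d; intros E. apply Hn. apply injective_projections; simpl; nra. }
assert (Hc : continuous d x).
{ apply (continuous_plus (V := R_NormedModule)); apply (continuous_mult (K := R_AbsRing)); assumption. }
assert (Hi : continuous (fun y => / d y) x)
  by (apply (continuous_comp (V := RU) d Rinv); [exact Hc|apply continuous_Rinv, Hd]).
apply (continuous_ext (fun y => (fst (f y) * / d y, - snd (f y) * / d y) : C)).
{ intros y. unfold Cinv, d, Rdiv.
  replace (fst (f y) ^ 2 + snd (f y) ^ 2) with (fst (f y) * fst (f y) + snd (f y) * snd (f y)) by ring.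
  reflexivity. }
apply (ccont_pair (fun y => (fst (f y) * / d y, - snd (f y) * / d y) : C)); cbn [fst snd].
- apply (continuous_mult (K := R_AbsRing)); assumption.
- apply (continuous_mult (K := R_AbsRing)); [|assumption].
  apply (continuous_opp (V := R_NormedModule)); assumption.
Qed.

Lemma ccont_div f g x : g x <> RtoC 0 -> ccont f x -> ccont g x -> ccont (fun y => f y / g y)%C x.
Proof. intros; apply ccont_mult; [|apply ccont_inv]; assumption. Qed.

Lemma ccont_RtoC (r : T -> R) x : continuous r x -> ccont (fun y => RtoC (r y)) x.
Proof. intros H; apply ccont_pair; simpl; [exact H|apply continuous_const]. Qed.

Lemma ccont_comp (h : C -> C) f x :
  ccont f x -> ccontC h (f x) -> ccont (fun y => h (f y)) x.
Proof. intros Hf Hh; apply (continuous_comp (V := CU) f h); assumption. Qed.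

Lemma ccont_ext_loc f g x :
  locally x (fun y => f y = g y) -> ccont f x -> ccont g x.
Proof. intros H Hf. apply continuous_ext_loc with f; [|exact Hf]. exact H. Qed.

End Continuity.

Lemma ccont_id (z : C) : ccontC (fun w => w) z.
Proof. apply continuous_id. Qed.

Definition Cderiv (f : C -> C) (z l : C) : Prop :=
  is_derive (K := C_AbsRing) (V := C_NormedModule) f z l.
Definition Rderiv (f : R -> C) (s : R) (l : C) : Prop :=
  is_derive (K := R_AbsRing) (V := C_R_NormedModule) f s l.

Lemma Cderiv_eps f z l : Cderiv f z l <->
  forall e, 0 < e -> locally (T := CU) z
    (fun w => Cmod (f w - f z - (w - z) * l) <= e * Cmod (w - z)).
Proof.
split.
- intros [_ H] e He.
  specialize (H z (fun P HP => HP) (mkposreal e He)).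
  apply (proj2 (locally_C z _)). exact H.
- intros H. split; [apply is_linear_scal_l|].
  intros z' Hz'.
  apply (is_filter_lim_locally_unique (K := C_AbsRing) (V := AbsRing_NormedModule C_AbsRing)) in Hz'; subst z'.
  intros e. apply (proj1 (locally_C z _)). apply (H e (cond_pos e)).
Qed.

Lemma Rderiv_eps f s l : Rderiv f s l <->
  forall e, 0 < e -> locally (T := RU) s
    (fun t => Cmod (f t - f s - (RtoC t - RtoC s) * l) <= e * Rabs (t - s)).
Proof.
assert (E : forall t, Cmod (f t - f s - (RtoC t - RtoC s) * l) =
  norm (V := C_R_NormedModule) (minus (minus (f t) (f s)) (scal (minus t s : R) (l : C_R_NormedModule)))).
{ intros t. rewrite scal_R_Cmult, <- Cmod_norm.
  change (minus t s) with (t - s)%R. rewrite RtoC_minus. reflexivity. }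
split.
- intros [_ H] e He.
  specialize (H s (fun P HP => HP) (mkposreal e He)).
  revert H; apply filter_imp; intros t Ht. rewrite E. exact Ht.
- intros H. split; [apply is_linear_scal_l|].
  intros z' Hz'.
  apply (is_filter_lim_locally_unique (K := R_AbsRing) (V := AbsRing_NormedModule R_AbsRing)) in Hz'; subst z'.
  intros e. generalize (H e (cond_pos e)); apply filter_imp; intros t Ht.
  rewrite E in Ht. exact Ht.
Qed.

Lemma Cmod_sub_sym (z w : C) : Cmod (z - w) = Cmod (w - z).
Proof. replace (z - w)%C with (- (w - z))%C by ring. apply Cmod_opp. Qed.

Lemma Cmod_sub_diag (z : C) : Cmod (z - z) = 0.
Proof. replace (z - z)%C with (RtoC 0) by ring. apply Cmod_0. Qed.

Lemma PI_C_neq0 : RtoC PI <> RtoC 0.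
Proof. pose proof PI_RGT_0. intros E; apply RtoC_inj in E; lra. Qed.

Lemma Cmod_pos (z : C) : z <> RtoC 0 -> 0 < Cmod z.
Proof. apply Cmod_gt_0. Qed.

Lemma Cminus_neq0 (z w : C) : z <> w -> (z - w)%C <> RtoC 0.
Proof. apply Cminus_eq_contra. Qed.

(** Differentiability in the form of Caratheodory: the difference quotient extends
    continuously. The product, chain and quotient rules become algebra on quotients. The
    increment d is y - x, read in C for a real or a complex variable. *)
Lemma slope_iff {T : UniformSpace} (f d : T -> C) x l :
  d x = RtoC 0 -> (forall y, d y = RtoC 0 -> y = x) ->
  (forall e, 0 < e -> locally x (fun y => Cmod (f y - f x - d y * l) <= e * Cmod (d y))) <->
  exists q : T -> C, ccont q x /\ q x = l /\ forall y, f y = (f x + d y * q y)%C.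
Proof.
intros D0 D1; split.
- intros H.
  exists (fun y => if Ceq_dec (d y) (RtoC 0) then l else ((f y - f x) / d y)%C).
  assert (E : (if Ceq_dec (d x) (RtoC 0) then l else ((f x - f x) / d x)%C) = l)
    by (destruct (Ceq_dec (d x) (RtoC 0)); congruence).
  split; [|split; [exact E|]].
  + apply ccont_eps; intros e He; rewrite E.
    assert (He2 : 0 < e / 2) by lra.
    generalize (H _ He2); apply filter_imp; intros y Hy.
    destruct (Ceq_dec (d y) (RtoC 0)) as [_|Hn].
    * replace (l - l)%C with (RtoC 0) by ring. rewrite Cmod_0; lra.
    * pose proof (Cmod_pos _ Hn).
      replace ((f y - f x) / d y - l)%C with ((f y - f x - d y * l) / d y)%C by (field; exact Hn).
      rewrite Cmod_div by exact Hn.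
      apply Rle_lt_trans with (e / 2); [|lra].
      apply Rle_div_l; [lra|]. exact Hy.
  + intros y; destruct (Ceq_dec (d y) (RtoC 0)) as [E0|Hn]; [rewrite (D1 y E0), D0; ring|].
    field. exact Hn.
- intros [q [Hq [E Hf]]] e He.
  generalize (proj1 (ccont_eps q x) Hq e He); apply filter_imp; intros y Hy.
  rewrite (Hf y), <- E.
  replace (f x + d y * q y - f x - d y * q x)%C with ((q y - q x) * d y)%C by ring.
  rewrite Cmod_mult. apply Rmult_le_compat_r; [apply Cmod_ge_0|lra].
Qed.

Lemma Cderiv_slope f z l : Cderiv f z l <->
  exists q : C -> C, ccontC q z /\ q z = l /\
    forall w, f w = (f z + (w - z) * q w)%C.
Proof.
rewrite Cderiv_eps. apply (slope_iff (T := CU) f (fun w => w - z)%C); [ring|].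
intros w E. apply Ceq_minus, E.
Qed.

Lemma RtoC_sub_Cmod (t s : R) : Cmod (RtoC t - RtoC s) = Rabs (t - s).
Proof. rewrite <- RtoC_minus; apply Cmod_R. Qed.

Lemma Rderiv_slope f s l : Rderiv f s l <->
  exists q : R -> C, ccontR q s /\ q s = l /\
    forall t, f t = (f s + (RtoC t - RtoC s) * q t)%C.
Proof.
rewrite Rderiv_eps, <- (slope_iff (T := RU) f (fun t => RtoC t - RtoC s)%C s l).
- split; intros H e He; generalize (H e He); apply filter_imp; intros t; rewrite RtoC_sub_Cmod; auto.
- ring.
- intros t E. apply RtoC_inj, Ceq_minus, E.
Qed.

Lemma ccont_RtoC_id (s : R) : ccontR RtoC s.
Proof. apply (ccont_RtoC (T := RU) (fun t => t)), continuous_id. Qed.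

Lemma Cderiv_cont f z l : Cderiv f z l -> ccontC f z.
Proof.
intros H; apply Cderiv_slope in H as [q [Hq [_ Hf]]].
apply (ccont_ext_loc (T := CU) (fun w => f z + (w - z) * q w)%C).
- apply filter_forall; intros w; symmetry; apply Hf.
- apply ccont_plus; [apply ccont_const|]. apply ccont_mult; [|exact Hq].
  apply ccont_minus; [apply ccont_id|apply ccont_const].
Qed.

Lemma Rderiv_cont f z l : Rderiv f z l -> ccontR f z.
Proof.
intros H; apply Rderiv_slope in H as [q [Hq [_ Hf]]].
apply (ccont_ext_loc (T := RU) (fun w => f z + (RtoC w - RtoC z) * q w)%C).
- apply filter_forall; intros w; symmetry; apply Hf.
- apply ccont_plus; [apply ccont_const|]. apply ccont_mult; [|exact Hq].
  apply ccont_minus; [apply ccont_RtoC_id|apply ccont_const].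
Qed.

Lemma Cderiv_ext_loc f g z l : locally (T := CU) z (fun w => f w = g w) ->
  Cderiv f z l -> Cderiv g z l.
Proof.
rewrite !Cderiv_eps; intros He H e Hpos.
pose proof (locally_singleton (T := CU) _ _ He) as E0.
generalize (filter_and _ _ He (H e Hpos)); apply filter_imp; intros w [E1 E2].
cbv beta in E0; rewrite <- E1, <- E0. exact E2.
Qed.

Lemma Cderiv_unique f z l l' : Cderiv f z l -> Cderiv f z l' -> l = l'.
Proof.
intros H1 H2; rewrite <- (is_C_derive_unique _ _ _ H1); apply is_C_derive_unique, H2.
Qed.

Lemma Cderiv_const (a z : C) : Cderiv (fun _ => a) z (RtoC 0).
Proof.
apply Cderiv_slope; exists (fun _ => RtoC 0); split; [apply ccont_const|].
split; [reflexivity|intros; ring].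
Qed.

Lemma Cderiv_id (z : C) : Cderiv (fun w => w) z (RtoC 1).
Proof.
apply Cderiv_slope; exists (fun _ => RtoC 1); split; [apply ccont_const|].
split; [reflexivity|intros; ring].
Qed.

Lemma Cderiv_plus f g z l m : Cderiv f z l -> Cderiv g z m -> Cderiv (fun w => f w + g w)%C z (l + m)%C.
Proof.
rewrite !Cderiv_slope; intros [p [Hp [Ep Hf]]] [q [Hq [Eq Hg]]].
exists (fun w => p w + q w)%C; split; [apply ccont_plus; assumption|].
split; [congruence|]. intros w; rewrite (Hf w), (Hg w); ring.
Qed.

Lemma Cderiv_mult f g z l m : Cderiv f z l -> Cderiv g z m ->
  Cderiv (fun w => f w * g w)%C z (l * g z + f z * m)%C.
Proof.
intros Hf0 Hg0. pose proof (Cderiv_cont _ _ _ Hg0) as Cg. revert Hf0 Hg0.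
rewrite !Cderiv_slope; intros [p [Hp [Ep Hf]]] [q [Hq [Eq Hg]]].
exists (fun w => p w * g w + f z * q w)%C; split.
{ apply ccont_plus; apply ccont_mult; try assumption; apply ccont_const. }
split; [congruence|]. intros w; rewrite (Hf w), (Hg w); ring.
Qed.

Lemma Cderiv_scal (k : C) f z l : Cderiv f z l -> Cderiv (fun w => k * f w)%C z (k * l)%C.
Proof.
intros H. replace (k * l)%C with (RtoC 0 * f z + k * l)%C by ring.
apply (Cderiv_mult (fun _ => k)); [apply Cderiv_const|exact H].
Qed.

Lemma Cderiv_minus f g z l m : Cderiv f z l -> Cderiv g z m -> Cderiv (fun w => f w - g w)%C z (l - m)%C.
Proof.
intros Hf Hg. apply Cderiv_plus; [exact Hf|].
apply (Cderiv_ext_loc (fun w => - (1) * g w)%C).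
- apply filter_forall; intros; ring.
- replace (- m)%C with (- (1) * m)%C by ring. apply Cderiv_scal, Hg.
Qed.

Lemma Cderiv_inv f z l : f z <> RtoC 0 -> Cderiv f z l ->
  Cderiv (fun w => / f w)%C z (- l / (f z * f z))%C.
Proof.
intros Hn Hf. pose proof (Cderiv_cont _ _ _ Hf) as Cf.
apply (Cderiv_slope f) in Hf as [p [Hp [Ep Hf]]].
(* the slope of 1/f is -p/(f z * f), wherever f does not vanish *)
assert (L : locally (T := CU) z (fun w => f w <> RtoC 0)).
{ generalize (proj1 (ccont_eps f z) Cf _ (Cmod_pos _ Hn)); apply filter_imp.
  intros w Hw E; rewrite E in Hw.
  replace (RtoC 0 - f z)%C with (- f z)%C in Hw by ring. rewrite Cmod_opp in Hw; lra. }
apply Cderiv_eps. intros e He.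
assert (Cs : ccontC (fun w => - p w / (f z * f w))%C z).
{ apply ccont_div.
  - apply Cmult_neq_0; assumption.
  - apply ccont_opp, Hp.
  - apply ccont_mult; [apply ccont_const|exact Cf]. }
generalize (filter_and _ _ L (proj1 (ccont_eps _ z) Cs e He)); apply filter_imp.
intros w [Hw Hs]. rewrite Ep in Hs.
replace (/ f w - / f z - (w - z) * (- l / (f z * f z)))%C
  with ((- p w / (f z * f w) - - l / (f z * f z)) * (w - z))%C.
- rewrite Cmod_mult; apply Rmult_le_compat_r; [apply Cmod_ge_0|lra].
- assert (Ew : ((w - z) * p w)%C = (f w - f z)%C) by (rewrite (Hf w); ring).
  transitivity (- ((w - z) * p w) / (f z * f w) - (w - z) * (- l / (f z * f z)))%C.
  + field; auto.
  + rewrite Ew. field; auto.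
Qed.

Lemma Rderiv_comp (f : C -> C) (p : R -> C) s l m :
  Rderiv p s m -> Cderiv f (p s) l -> Rderiv (fun t => f (p t)) s (l * m)%C.
Proof.
intros Hp0. pose proof (Rderiv_cont _ _ _ Hp0) as Cp. revert Hp0.
rewrite Cderiv_slope, !Rderiv_slope; intros [q [Hq [Eq Hp]]] [r [Hr [Er Hf]]].
exists (fun t => r (p t) * q t)%C; split.
{ apply ccont_mult; [|exact Hq]. apply ccont_comp; assumption. }
split; [congruence|]. intros t. rewrite (Hf (p t)), (Hp t) at 1. ring.
Qed.

Lemma Rderiv_affine (a b : C) s : Rderiv (fun t => a + RtoC t * b)%C s b.
Proof.
apply Rderiv_slope; exists (fun _ => b); split; [apply ccont_const|].
split; [reflexivity|intros; ring].
Qed.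

Lemma Rderiv_pair (f : R -> C) s l :
  is_derive (fun t => fst (f t)) s (fst l) ->
  is_derive (fun t => snd (f t)) s (snd l) -> Rderiv f s l.
Proof.
intros [_ H1] [_ H2]. apply Rderiv_eps; intros e He.
assert (He2 : 0 < e / 2) by lra.
specialize (H1 s (fun P HP => HP) (mkposreal _ He2)).
specialize (H2 s (fun P HP => HP) (mkposreal _ He2)).
generalize (filter_and _ _ H1 H2); apply filter_imp; intros t [B1 B2].
eapply Rle_trans; [apply Cmod_Rabs_le|].
change (Rabs (fst (f t) - fst (f s) - (t - s) * fst l) <= e / 2 * Rabs (t - s)) in B1.
change (Rabs (snd (f t) - snd (f s) - (t - s) * snd l) <= e / 2 * Rabs (t - s)) in B2.
replace (fst (f t - f s - (RtoC t - RtoC s) * l)%C)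
  with (fst (f t) - fst (f s) - (t - s) * fst l) by (simpl; ring).
replace (snd (f t - f s - (RtoC t - RtoC s) * l)%C)
  with (snd (f t) - snd (f s) - (t - s) * snd l) by (simpl; ring).
lra.
Qed.

Lemma Rderiv_fst f s l : Rderiv f s l -> is_derive (fun t => fst (f t)) s (fst l).
Proof.
rewrite Rderiv_eps; intros H. split; [apply is_linear_scal_l|].
intros z' Hz'.
apply (is_filter_lim_locally_unique (K := R_AbsRing) (V := AbsRing_NormedModule R_AbsRing)) in Hz'; subst z'.
intros e. generalize (H e (cond_pos e)); apply filter_imp; intros t Ht.
eapply Rle_trans; [|exact Ht]. eapply Rle_trans; [|apply fst_le_Cmod].
right. simpl. unfold norm, minus, plus, opp, scal; simpl. unfold abs, mult; simpl.
f_equal; ring.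
Qed.

Lemma Rderiv_snd f s l : Rderiv f s l -> is_derive (fun t => snd (f t)) s (snd l).
Proof.
intros H. apply (is_derive_ext (fun t => fst (- Ci * f t)%C)); [intros; simpl; ring|].
replace (snd l) with (fst (- Ci * l)%C) by (simpl; ring).
apply Rderiv_fst. revert H; rewrite !Rderiv_slope; intros [q [Hq [E Hf]]].
exists (fun t => - Ci * q t)%C; split; [apply ccont_mult; [apply ccont_const|exact Hq]|].
split; [congruence|]. intros t; rewrite (Hf t); ring.
Qed.

Lemma Rderiv_unique f s l m : Rderiv f s l -> Rderiv f s m -> l = m.
Proof.
intros H1 H2. apply injective_projections.
- rewrite <- (is_derive_unique _ _ _ (Rderiv_fst _ _ _ H1)). apply is_derive_unique, Rderiv_fst, H2.
- rewrite <- (is_derive_unique _ _ _ (Rderiv_snd _ _ _ H1)). apply is_derive_unique, Rderiv_snd, H2.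
Qed.

Lemma Rderiv_scal (k : C) f s l : Rderiv f s l -> Rderiv (fun t => k * f t)%C s (k * l)%C.
Proof.
rewrite !Rderiv_slope; intros [q [Hq [E Hf]]].
exists (fun t => k * q t)%C; split; [apply ccont_mult; [apply ccont_const|exact Hq]|].
split; [congruence|]. intros t; rewrite (Hf t); ring.
Qed.

Lemma Rderiv_plus f g s l m : Rderiv f s l -> Rderiv g s m -> Rderiv (fun t => f t + g t)%C s (l + m)%C.
Proof.
rewrite !Rderiv_slope; intros [p [Hp [Ep Hf]]] [q [Hq [Eq Hg]]].
exists (fun t => p t + q t)%C; split; [apply ccont_plus; assumption|].
split; [congruence|]. intros t; rewrite (Hf t), (Hg t); ring.
Qed.

Lemma Rderiv_const k s : Rderiv (fun _ => k) s (RtoC 0).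
Proof.
apply Rderiv_slope; exists (fun _ => RtoC 0); split; [apply ccont_const|].
split; [reflexivity|intros; ring].
Qed.

Lemma Rderiv_shift f s T l : Rderiv f (s + T) l -> Rderiv (fun t => f (t + T)) s l.
Proof.
rewrite !Rderiv_eps; intros H e He. destruct (proj1 (locally_Rabs _ _) (H e He)) as [d [Hd H']].
apply locally_Rabs; exists d; split; [exact Hd|]. intros y Hy.
pose proof (H' (y + T)) as H1. replace (y + T - (s + T)) with (y - s) in H1 by ring.
replace (RtoC (y + T) - RtoC (s + T))%C with (RtoC y - RtoC s)%C in H1 by (rewrite !RtoC_plus; ring).
auto.
Qed.

Lemma is_derive_dist2 (x y : R -> R) s dx dy a b : is_derive x s dx -> is_derive y s dy ->
  is_derive (fun t => (x t - a) * (x t - a) + (y t - b) * (y t - b)) s (2 * (x s - a) * dx + 2 * (y s - b) * dy).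
Proof.
intros Hx Hy. auto_derive.
- repeat split; eexists; eassumption.
- apply is_derive_unique in Hx, Hy. change (Derive (fun t => x t) s) with (Derive x s).  change (Derive (fun t => y t) s) with (Derive y s). rewrite Hx, Hy. ring.
Qed.

Definition CInt (f : R -> C) (a b : R) : C := RInt (V := C_R_CompleteNormedModule) f a b.
Definition is_CInt (f : R -> C) (a b : R) (l : C) : Prop :=
  is_RInt (V := C_R_NormedModule) f a b l.
Definition ex_CInt (f : R -> C) (a b : R) : Prop := exists l, is_CInt f a b l.
Definition ccont_on (f : R -> C) (a b : R) : Prop :=
  forall s, Rmin a b <= s <= Rmax a b -> ccontR f s.

Lemma CInt_correct f a b : ex_CInt f a b -> is_CInt f a b (CInt f a b).
Proof. apply (RInt_correct (V := C_R_CompleteNormedModule)). Qed.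

Lemma is_CInt_unique f a b l : is_CInt f a b l -> CInt f a b = l.
Proof. apply (is_RInt_unique (V := C_R_CompleteNormedModule)). Qed.

Lemma ex_CInt_cont f a b : ccont_on f a b -> ex_CInt f a b.
Proof. apply (ex_RInt_continuous (V := C_R_CompleteNormedModule)). Qed.

Lemma is_CInt_cont f a b : ccont_on f a b -> is_CInt f a b (CInt f a b).
Proof. intros; apply CInt_correct, ex_CInt_cont; assumption. Qed.

Lemma is_CInt_FTC (f df : R -> C) a b :
  (forall s, Rmin a b <= s <= Rmax a b -> Rderiv f s (df s)) -> ccont_on df a b ->
  is_CInt df a b (f b - f a)%C.
Proof. intros H1 H2. exact (is_RInt_derive (V := C_R_CompleteNormedModule) f df a b H1 H2). Qed.

Lemma is_CInt_ext f g a b l :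
  (forall s, Rmin a b < s < Rmax a b -> f s = g s) -> is_CInt f a b l -> is_CInt g a b l.
Proof. apply (is_RInt_ext (V := C_R_NormedModule)). Qed.

Lemma CInt_ext f g a b :
  (forall s, Rmin a b < s < Rmax a b -> f s = g s) -> CInt f a b = CInt g a b.
Proof. apply (RInt_ext (V := C_R_CompleteNormedModule)). Qed.

Lemma is_CInt_plus f g a b l m :
  is_CInt f a b l -> is_CInt g a b m -> is_CInt (fun s => f s + g s)%C a b (l + m)%C.
Proof. apply (is_RInt_plus (V := C_R_NormedModule)). Qed.

Lemma is_CInt_minus f g a b l m :
  is_CInt f a b l -> is_CInt g a b m -> is_CInt (fun s => f s - g s)%C a b (l - m)%C.
Proof. apply (is_RInt_minus (V := C_R_NormedModule)). Qed.

Lemma is_CInt_fst f a b l : is_CInt f a b l -> is_RInt (fun s => fst (f s)) a b (fst l).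
Proof. apply (is_RInt_fct_extend_fst (U := R_NormedModule) (V := R_NormedModule)). Qed.

Lemma is_CInt_snd f a b l : is_CInt f a b l -> is_RInt (fun s => snd (f s)) a b (snd l).
Proof. apply (is_RInt_fct_extend_snd (U := R_NormedModule) (V := R_NormedModule)). Qed.

Lemma is_CInt_pair f a b l : is_RInt (fun s => fst (f s)) a b (fst l) ->
  is_RInt (fun s => snd (f s)) a b (snd l) -> is_CInt f a b l.
Proof.
intros H1 H2. rewrite (surjective_pairing l).
apply (is_RInt_fct_extend_pair (U := R_NormedModule) (V := R_NormedModule)); assumption.
Qed.

Lemma is_CInt_scal (k : C) f a b l :
  is_CInt f a b l -> is_CInt (fun s => k * f s)%C a b (k * l)%C.
Proof.
intros H. pose proof (is_CInt_fst _ _ _ _ H) as H1. pose proof (is_CInt_snd _ _ _ _ H) as H2.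
apply is_CInt_pair; simpl.
- apply (is_RInt_minus (V := R_NormedModule));
  apply (is_RInt_scal (V := R_NormedModule)); assumption.
- apply (is_RInt_plus (V := R_NormedModule));
  apply (is_RInt_scal (V := R_NormedModule)); assumption.
Qed.

Lemma is_CInt_const (k : C) a b : is_CInt (fun _ => k) a b ((RtoC b - RtoC a) * k)%C.
Proof.
rewrite <- RtoC_minus, <- scal_R_Cmult. apply (is_RInt_const (V := C_R_NormedModule)).
Qed.

Lemma is_CInt_Chasles f a b c l m :
  is_CInt f a b l -> is_CInt f b c m -> is_CInt f a c (l + m)%C.
Proof. apply (is_RInt_Chasles (V := C_R_NormedModule)). Qed.

Lemma is_CInt_swap f a b l : is_CInt f b a l -> is_CInt f a b (- l)%C.
Proof. apply (is_RInt_swap (V := C_R_NormedModule)). Qed.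

Lemma is_CInt_bound f a b l M :
  (forall s, Rmin a b <= s <= Rmax a b -> Cmod (f s) <= M) ->
  is_CInt f a b l -> Cmod l <= Rabs (b - a) * M.
Proof.
intros H Hl. rewrite Cmod_norm.
apply (norm_RInt_le_const_abs (V := C_R_NormedModule)) with f; [|exact Hl].
intros s Hs; rewrite <- Cmod_norm; apply H, Hs.
Qed.

Lemma CInt_zero f a b : (forall s, Rmin a b < s < Rmax a b -> f s = RtoC 0) -> CInt f a b = RtoC 0.
Proof.
intros H. rewrite (CInt_ext f (fun _ => RtoC 0)) by exact H.
apply is_CInt_unique. pose proof (is_CInt_const (RtoC 0) a b) as H0.
rewrite Cmult_0_r in H0. exact H0.
Qed.

(** * Integrals depending on a parameter and the Fubini theorem *)

(** Compactness of [a, b], in the form of a positive lower bound for the radii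
    of neighborhoods attached to its points. *)
Lemma tube_lemma {T : UniformSpace} (P : R -> T -> Prop) a b z0 :
  (forall s, a <= s <= b -> locally (T := prod_UniformSpace RU T) (s, z0)
     (fun p => P (fst p) (snd p))) ->
  locally z0 (fun z => forall s, a <= s <= b -> P s z).
Proof.
intros H.
assert (Hd : forall s, exists d : posreal, a <= s <= b ->
  forall s' z, Rabs (s' - s) < d -> ball z0 d z -> P s' z).
{ intros s. destruct (excluded_middle_informative (a <= s <= b)) as [Hs|Hs].
  - destruct (H s Hs) as [d Hd]; exists d; intros _ s' z H1 H2.
    apply (Hd (s', z)); split; [exact H1|exact H2].
  - exists (mkposreal 1 Rlt_0_1); intros H'; contradiction. }
pose (delta := fun s => proj1_sig (constructive_indefinite_description _ (Hd s))).
destruct (compactness_value_1d a b delta) as [d Hdd].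
exists d; intros z Hz s Hs. apply NNPP; intros Hn.
apply (Hdd s Hs); intros [t [Ht [Hst Hdt]]]. apply Hn.
refine (proj2_sig (constructive_indefinite_description _ (Hd t)) Ht s z _ _).
- exact Hst.
- exact (ball_le z0 d (delta t) Hdt z Hz).
Qed.

(** Joint continuity of a kernel at one point of its domain. *)
Definition ccont2 {T : UniformSpace} (k : R -> T -> C) (s : R) (z : T) : Prop :=
  ccont (T := prod_UniformSpace RU T) (fun p => k (fst p) (snd p)) (s, z).

Lemma ccont2_l {T : UniformSpace} (k : R -> T -> C) s z :
  ccont2 k s z -> ccontR (fun s => k s z) s.
Proof.
intros H. apply ccont_eps; intros e He.
destruct (proj1 (ccont_eps _ _) H e He) as [d Hd]. exists d; intros s' Hs'.
apply (Hd (s', z)); split; [exact Hs'|apply ball_center].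
Qed.

Lemma ccont2_r {T : UniformSpace} (k : R -> T -> C) s z :
  ccont2 k s z -> ccont (fun z => k s z) z.
Proof.
intros H. apply ccont_eps; intros e He.
destruct (proj1 (ccont_eps _ _) H e He) as [d Hd]. exists d; intros z' Hs'.
apply (Hd (s, z')); split; [apply ball_center|exact Hs'].
Qed.

Lemma ccont2_uniform {T : UniformSpace} (k : R -> T -> C) a b z0 :
  (forall s, a <= s <= b -> ccont2 k s z0) ->
  forall e, 0 < e -> locally z0 (fun z => forall s, a <= s <= b -> Cmod (k s z - k s z0) < e).
Proof.
intros H e He. apply (tube_lemma (fun s z => Cmod (k s z - k s z0) < e)).
intros s Hs. assert (He2 : 0 < e / 2) by lra.
destruct (proj1 (ccont_eps _ _) (H s Hs) _ He2) as [d Hd]. exists d; intros [s' z] [B1 B2]; simpl.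
pose proof (Hd (s', z) (conj B1 B2)) as H1.
pose proof (Hd (s', z0) (conj B1 (ball_center z0 d))) as H2. simpl in H1, H2.
replace (k s' z - k s' z0)%C with ((k s' z - k s z0) + - (k s' z0 - k s z0))%C by ring.
eapply Rle_lt_trans; [apply Cmod_triangle|]. rewrite Cmod_opp. lra.
Qed.

Lemma ccont_CInt_param {T : UniformSpace} (k : R -> T -> C) a b z0 :
  (forall s, Rmin a b <= s <= Rmax a b -> ccont2 k s z0) ->
  locally z0 (fun z => ex_CInt (fun s => k s z) a b) ->
  ccont (fun z => CInt (fun s => k s z) a b) z0.
Proof.
intros H Hex. apply ccont_eps; intros e He.
assert (Hp : 0 < Rabs (b - a) + 1) by (pose proof (Rabs_pos (b - a)); lra).
assert (He' : 0 < e / (Rabs (b - a) + 1)) by (apply Rdiv_lt_0_compat; assumption).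
pose proof (locally_singleton _ _ Hex) as E0.
generalize (filter_and _ _ Hex (ccont2_uniform k _ _ z0 H _ He')); apply filter_imp.
intros z [Ez Hz].
apply Rle_lt_trans with (Rabs (b - a) * (e / (Rabs (b - a) + 1))).
- apply is_CInt_bound with (fun s => k s z - k s z0)%C.
  + intros s Hs; left; apply Hz, Hs.
  + apply is_CInt_minus; apply CInt_correct; assumption.
- apply Rlt_le_trans with ((Rabs (b - a) + 1) * (e / (Rabs (b - a) + 1))).
  + apply Rmult_lt_compat_r; lra.
  + right; field; lra.
Qed.

(** As functions of the upper limit x of the outer integral, both sides have the
    derivative CInt (k x) c d, and both vanish at x = a. *)
Lemma fubini_global (k : R -> R -> C) a b c d :
  a <= b -> c <= d -> (forall x y, ccont2 (T := RU) k x y) ->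
  is_CInt (fun x => CInt (k x) c d) a b (CInt (fun y => CInt (fun x => k x y) a b) c d).
Proof.
intros Hab Hcd H.
assert (H' : forall x y, ccont2 (T := RU) (fun y x => k x y) y x).
{ intros x y. apply ccont_eps; intros e He.
  destruct (proj1 (ccont_eps _ _) (H x y) e He) as [r Hr].
  exists r; intros [y' x'] [B1 B2]. exact (Hr (x', y') (conj B2 B1)). }
assert (Ex : forall y a b, ex_CInt (fun x => k x y) a b).
{ intros; apply ex_CInt_cont; intros s _. exact (ccont2_l (T := RU) k s y (H s y)). }
assert (Ey : forall x a b, ex_CInt (fun y => k x y) a b).
{ intros; apply ex_CInt_cont; intros s _. exact (ccont2_r (T := RU) k x s (H x s)). }
assert (Cx : forall x y, ccontR (fun y => CInt (fun x => k x y) a x) y).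
{ intros x y. apply (ccont_CInt_param (T := RU)); [intros; apply H|].
  apply filter_forall; intros; apply Ex. }
set (Phi := fun x => CInt (fun y => CInt (fun x => k x y) a x) c d).
assert (E0 : Phi a = RtoC 0).
{ apply CInt_zero; intros. apply CInt_zero; intros u Hu.
  rewrite Rmin_left, Rmax_left in Hu by lra. lra. }
replace (CInt _ c d) with (Phi b - Phi a)%C by (rewrite E0; unfold Phi; ring).
apply is_CInt_FTC.
- intros x _. apply Rderiv_eps; intros e He.
  assert (Hp : 0 < Rabs (d - c) + 1) by (pose proof (Rabs_pos (d - c)); lra).
  assert (He' : 0 < e / (Rabs (d - c) + 1)) by (apply Rdiv_lt_0_compat; assumption).
  pose proof (ccont2_uniform (T := RU) (fun y x => k x y) c d x
    (fun y _ => H' x y) _ He') as U.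
  apply locally_Rabs in U as [r [Hr U]]. apply locally_Rabs; exists r; split; [exact Hr|].
  intros x' Hx'. simpl in U.
  assert (B : is_CInt (fun y => (CInt (fun u => k u y) a x' - CInt (fun u => k u y) a x)
      - (RtoC x' - RtoC x) * k x y)%C c d
      (Phi x' - Phi x - (RtoC x' - RtoC x) * CInt (k x) c d)%C).
  { apply is_CInt_minus.
    - apply is_CInt_minus; apply is_CInt_cont; intros y _; apply Cx.
    - apply is_CInt_scal, CInt_correct, Ey. }
  apply Rle_trans with (Rabs (d - c) * (e / (Rabs (d - c) + 1) * Rabs (x' - x))).
  + eapply is_CInt_bound; [|exact B].
    intros y Hy. cbv beta. rewrite Rmin_left, Rmax_right in Hy by assumption.
    rewrite Rmult_comm. apply is_CInt_bound with (fun u => k u y - k x y)%C.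
    * intros u Hu. left. apply U; [|exact Hy].
      apply Rle_lt_trans with (1 := Rabs_between_le _ _ _ Hu), Hx'.
    * apply is_CInt_minus; [|apply is_CInt_const].
      replace (CInt (fun u => k u y) a x' - CInt (fun u => k u y) a x)%C
        with (- CInt (fun u => k u y) a x + CInt (fun u => k u y) a x')%C by ring.
      apply is_CInt_Chasles with a; [apply is_CInt_swap|]; apply CInt_correct, Ex.
  + apply Rle_trans with ((Rabs (d - c) + 1) * (e / (Rabs (d - c) + 1) * Rabs (x' - x))).
    * apply Rmult_le_compat_r; [|lra].
      apply Rmult_le_pos; [lra|apply Rabs_pos].
    * right; field; lra.
- intros x _. apply (ccont_CInt_param (T := RU) (fun y x => k x y)); [intros; apply H'|].
  apply filter_forall; intros; apply Ey.
Qed.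

(** Retraction of the line onto [a, b]: it extends a kernel continuous on a closed
    rectangle to the whole plane. *)
Definition clamp (a b x : R) : R := Rmax a (Rmin b x).

Lemma clamp_in a b x : a <= b -> a <= clamp a b x <= b.
Proof. unfold clamp, Rmax, Rmin; intros; repeat destruct Rle_dec; lra. Qed.

Lemma clamp_id a b x : a <= x <= b -> clamp a b x = x.
Proof. unfold clamp, Rmax, Rmin; intros; repeat destruct Rle_dec; lra. Qed.

Lemma clamp_low a b x : a <= b -> x <= a -> clamp a b x = a.
Proof. unfold clamp, Rmax, Rmin; intros; repeat destruct Rle_dec; lra. Qed.

Lemma clamp_high a b x : a <= b -> b <= x -> clamp a b x = b.
Proof. unfold clamp, Rmax, Rmin; intros; repeat destruct Rle_dec; lra. Qed.

Lemma clamp_lip a b x y : Rabs (clamp a b y - clamp a b x) <= Rabs (y - x).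
Proof. unfold clamp, Rmax, Rmin, Rabs; repeat (destruct Rle_dec || destruct Rcase_abs); lra. Qed.

Lemma fubini (k : R -> R -> C) a b c d :
  a <= b -> c <= d ->
  (forall x y, a <= x <= b -> c <= y <= d -> ccont2 (T := RU) k x y) ->
  is_CInt (fun x => CInt (k x) c d) a b (CInt (fun y => CInt (fun x => k x y) a b) c d).
Proof.
intros Hab Hcd H.
pose proof (fubini_global (fun x y => k (clamp a b x) (clamp c d y)) a b c d Hab Hcd) as G.
replace (CInt (fun y => CInt (fun x => k x y) a b) c d)
  with (CInt (fun y => CInt (fun x => k (clamp a b x) (clamp c d y)) a b) c d).
- eapply is_CInt_ext; [|apply G].
  + intros x Hx. rewrite Rmin_left, Rmax_right in Hx by assumption.
    apply CInt_ext; intros y Hy. rewrite Rmin_left, Rmax_right in Hy by assumption.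
    rewrite !clamp_id by lra. reflexivity.
  + intros x y. apply ccont_eps; intros e He.
    destruct (proj1 (ccont_eps _ _) (H _ _ (clamp_in a b x Hab) (clamp_in c d y Hcd)) e He) as [r Hr].
    exists r; intros [x' y'] [B1 B2]. apply (Hr (clamp a b x', clamp c d y')); split.
    * eapply Rle_lt_trans; [apply clamp_lip|exact B1].
    * eapply Rle_lt_trans; [apply clamp_lip|exact B2].
- apply CInt_ext; intros y Hy. rewrite Rmin_left, Rmax_right in Hy by assumption.
  apply CInt_ext; intros x Hx. rewrite Rmin_left, Rmax_right in Hx by assumption.
  rewrite !clamp_id by lra. reflexivity.
Qed.

(** * The Cauchy-Goursat theorem on rectangles *)

(** Squares rather than discs: they contain the rectangles spanned by their points,
    along whose sides primitives are defined. *)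
Definition square (z0 : C) (r : R) (w : C) : Prop :=
  Rabs (fst w - fst z0) < r /\ Rabs (snd w - snd z0) < r.

Definition hor (f : C -> C) (x x' y : R) : C := CInt (fun u => f (u, y)) x x'.
Definition ver (f : C -> C) (x y y' : R) : C := (Ci * CInt (fun v => f (x, v)) y y')%C.
(** The integral along the boundary of a rectangle; x, x' and y, y' may come in any
    order. *)
Definition rect (f : C -> C) (x x' y y' : R) : C :=
  (hor f x x' y + ver f x' y y' - hor f x x' y' - ver f x y y')%C.

Definition Ccont_on (S : C -> Prop) (f : C -> C) : Prop :=
  forall w, S w -> ccontC f w.

Lemma square_hor z0 r x x' y u :
  square z0 r (x, y) -> square z0 r (x', y) -> Rmin x x' <= u <= Rmax x x' -> square z0 r (u, y).
Proof. intros [H1 H2] [H3 _] Hu; split; [exact (Rabs_between_lt _ _ _ _ _ H1 H3 Hu)|exact H2]. Qed.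

Lemma square_ver z0 r x y y' v :
  square z0 r (x, y) -> square z0 r (x, y') -> Rmin y y' <= v <= Rmax y y' -> square z0 r (x, v).
Proof. intros [H1 H2] [_ H3] Hv; split; [exact H1|exact (Rabs_between_lt _ _ _ _ _ H2 H3 Hv)]. Qed.

Lemma square_corner z0 r x x' y y' :
  square z0 r (x, y) -> square z0 r (x', y') -> square z0 r (x, y') /\ square z0 r (x', y).
Proof. unfold square; simpl; tauto. Qed.

Lemma Rderiv_hor (y u : R) : Rderiv (fun u => (u, y)) u (RtoC 1).
Proof.
replace (fun u => (u, y)) with (fun u => ((0, y) + RtoC u * RtoC 1)%C); [apply Rderiv_affine|].
apply FunctionalExtensionality.functional_extensionality; intros t.
apply injective_projections; simpl; ring.
Qed.

Lemma Rderiv_ver (x v : R) : Rderiv (fun v => (x, v)) v Ci.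
Proof.
replace (fun v => (x, v)) with (fun v => ((x, 0) + RtoC v * Ci)%C); [apply Rderiv_affine|].
apply FunctionalExtensionality.functional_extensionality; intros t.
apply injective_projections; simpl; ring.
Qed.

Section Rectangles.
Variables (z0 : C) (r : R).
Notation S := (square z0 r).

Lemma is_CInt_hor f x x' y : Ccont_on S f -> S (x, y) -> S (x', y) ->
  is_CInt (fun u => f (u, y)) x x' (hor f x x' y).
Proof.
intros Hf H1 H2. apply is_CInt_cont; intros u Hu.
apply (ccont_comp (T := RU) f (fun u => (u, y))).
- exact (Rderiv_cont _ _ _ (Rderiv_hor y u)).
- apply Hf, (square_hor _ _ x x'); assumption.
Qed.

Lemma is_CInt_ver f x y y' : Ccont_on S f -> S (x, y) -> S (x, y') ->
  is_CInt (fun v => Ci * f (x, v))%C y y' (ver f x y y').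
Proof.
intros Hf H1 H2. apply is_CInt_scal, is_CInt_cont; intros u Hu.
apply (ccont_comp (T := RU) f (fun v => (x, v))).
- exact (Rderiv_cont _ _ _ (Rderiv_ver x u)).
- apply Hf, (square_ver _ _ x y y'); assumption.
Qed.

Lemma hor_Chasles f x x1 x' y : Ccont_on S f -> S (x, y) -> S (x1, y) -> S (x', y) ->
  hor f x x' y = (hor f x x1 y + hor f x1 x' y)%C.
Proof.
intros. apply is_CInt_unique, is_CInt_Chasles with x1; apply is_CInt_hor; assumption.
Qed.

Lemma ver_Chasles f x y y1 y' : Ccont_on S f -> S (x, y) -> S (x, y1) -> S (x, y') ->
  ver f x y y' = (ver f x y y1 + ver f x y1 y')%C.
Proof.
intros Hf H1 H2 H3. unfold ver at 1.
assert (E : is_CInt (fun v => Ci * f (x, v))%C y y' (ver f x y y1 + ver f x y1 y')%C).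
{ apply is_CInt_Chasles with y1; apply is_CInt_ver; assumption. }
rewrite <- (is_CInt_unique _ _ _ _ E).
symmetry; apply is_CInt_unique, is_CInt_ver; assumption.
Qed.

Lemma rect_minus f g x x' y y' : Ccont_on S f -> Ccont_on S g -> S (x, y) -> S (x', y') ->
  rect (fun w => f w - g w)%C x x' y y' = (rect f x x' y y' - rect g x x' y y')%C.
Proof.
intros Hf Hg H1 H2. destruct (square_corner _ _ _ _ _ _ H1 H2) as [H3 H4].
assert (Eh : forall y, S (x, y) -> S (x', y) ->
  hor (fun w => f w - g w)%C x x' y = (hor f x x' y - hor g x x' y)%C).
{ intros; apply is_CInt_unique, is_CInt_minus; apply is_CInt_hor; assumption. }
assert (Ev : forall x, S (x, y) -> S (x, y') ->
  ver (fun w => f w - g w)%C x y y' = (ver f x y y' - ver g x y y')%C).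
{ intros. assert (B := is_CInt_minus _ _ _ _ _ _ (is_CInt_ver f x0 y y' Hf H H0) (is_CInt_ver g x0 y y' Hg H H0)).
  rewrite <- (is_CInt_unique _ _ _ _ B). symmetry; apply is_CInt_unique.
  apply is_CInt_ext with (fun v => Ci * (f (x0, v) - g (x0, v)))%C; [intros; ring|].
  apply (is_CInt_ver (fun w => f w - g w)%C); [|assumption|assumption].
  intros w Hw; apply ccont_minus; auto. }
unfold rect; rewrite !Eh, !Ev by assumption. ring.
Qed.

(** The four sides telescope. *)
Lemma rect_primitive F f x x' y y' : Ccont_on S f -> (forall w, S w -> Cderiv F w (f w)) ->
  S (x, y) -> S (x', y') -> rect f x x' y y' = RtoC 0.
Proof.
intros Hf HF H1 H2. destruct (square_corner _ _ _ _ _ _ H1 H2) as [H3 H4].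
assert (Eh : forall y, S (x, y) -> S (x', y) -> hor f x x' y = (F (x', y) - F (x, y))%C).
{ intros y1 A1 A2. apply is_CInt_unique. apply (is_CInt_FTC (fun u => F (u, y1))).
  - intros u Hu. replace (f (u, y1)) with (f (u, y1) * RtoC 1)%C by ring.
    apply (Rderiv_comp F (fun u => (u, y1))); [apply Rderiv_hor|].
    apply HF, (square_hor _ _ x x'); assumption.
  - intros u Hu. apply (ccont_comp (T := RU) f (fun u => (u, y1))).
    + exact (Rderiv_cont _ _ _ (Rderiv_hor y1 u)).
    + apply Hf, (square_hor _ _ x x'); assumption. }
assert (Ev : forall x, S (x, y) -> S (x, y') -> ver f x y y' = (F (x, y') - F (x, y))%C).
{ intros x1 A1 A2.
  rewrite <- (is_CInt_unique _ _ _ _ (is_CInt_ver f x1 y y' Hf A1 A2)).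
  apply is_CInt_unique. apply (is_CInt_FTC (fun v => F (x1, v))).
  - intros u Hu. rewrite Cmult_comm.
    apply (Rderiv_comp F (fun v => (x1, v))); [apply Rderiv_ver|].
    apply HF, (square_ver _ _ x1 y y'); assumption.
  - intros u Hu. apply ccont_mult; [apply ccont_const|].
    apply (ccont_comp (T := RU) f (fun v => (x1, v))).
    + exact (Rderiv_cont _ _ _ (Rderiv_ver x1 u)).
    + apply Hf, (square_ver _ _ x1 y y'); assumption. }
unfold rect; rewrite !Eh, !Ev by assumption. ring.
Qed.

Lemma rect_split f x x1 x' y y1 y' : Ccont_on S f ->
  S (x, y) -> S (x1, y1) -> S (x', y') ->
  rect f x x' y y' = (rect f x x1 y y1 + rect f x1 x' y y1
                      + rect f x x1 y1 y' + rect f x1 x' y1 y')%C.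
Proof.
intros Hf H1 H2 H3.
assert (A : forall a b, a = x \/ a = x1 \/ a = x' -> b = y \/ b = y1 \/ b = y' -> S (a, b)).
{ unfold square in *; simpl in *. intros a b Ha Hb.
  destruct Ha as [->|[->| ->]], Hb as [->|[->| ->]]; simpl in *; tauto. }
unfold rect.
rewrite (hor_Chasles f x x1 x' y), (hor_Chasles f x x1 x' y'),
  (ver_Chasles f x y y1 y'), (ver_Chasles f x' y y1 y') by (auto; apply A; tauto).
ring.
Qed.

Lemma rect_bound f x x' y y' M : Ccont_on S f -> S (x, y) -> S (x', y') ->
  (forall u v, Rmin x x' <= u <= Rmax x x' -> Rmin y y' <= v <= Rmax y y' -> Cmod (f (u, v)) <= M) ->
  Cmod (rect f x x' y y') <= 2 * (Rabs (x' - x) + Rabs (y' - y)) * M.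
Proof.
intros Hf H1 H2 HM. destruct (square_corner _ _ _ _ _ _ H1 H2) as [H3 H4].
assert (Mx : Rmin x x' <= x <= Rmax x x' /\ Rmin x x' <= x' <= Rmax x x')
  by (unfold Rmin, Rmax; destruct Rle_dec; lra).
assert (My : Rmin y y' <= y <= Rmax y y' /\ Rmin y y' <= y' <= Rmax y y')
  by (unfold Rmin, Rmax; destruct Rle_dec; lra).
assert (Bh : forall y1, Rmin y y' <= y1 <= Rmax y y' -> S (x, y1) -> S (x', y1) ->
  Cmod (hor f x x' y1) <= Rabs (x' - x) * M).
{ intros y1 Hy A1 A2. eapply is_CInt_bound; [|apply is_CInt_hor; assumption].
  intros u Hu; apply HM; assumption. }
assert (Bv : forall x1, Rmin x x' <= x1 <= Rmax x x' -> S (x1, y) -> S (x1, y') ->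
  Cmod (ver f x1 y y') <= Rabs (y' - y) * M).
{ intros x1 Hx A1 A2. eapply is_CInt_bound; [|apply is_CInt_ver; assumption].
  intros u Hu; cbv beta. rewrite Cmod_mult, Cmod_Ci, Rmult_1_l. apply HM; assumption. }
pose proof (Bh y (proj1 My) H1 H4). pose proof (Bh y' (proj2 My) H3 H2).
pose proof (Bv x (proj1 Mx) H1 H3). pose proof (Bv x' (proj2 Mx) H4 H2).
unfold rect, Cminus.
eapply Rle_trans; [apply Cmod_triangle|]. rewrite Cmod_opp.
eapply Rle_trans; [apply Rplus_le_compat_r, Cmod_triangle|]. rewrite Cmod_opp.
eapply Rle_trans; [apply Rplus_le_compat_r, Rplus_le_compat_r, Cmod_triangle|].
lra.
Qed.
End Rectangles.

(** Nested quarters of the unit square: P p q h speaks of the square of side h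
    with lower left corner (p, q). If P passes to one of the four quarters, then squares
    satisfying P shrink to a point. *)
Lemma bisection (P : R -> R -> R -> Prop) :
  (forall p q h, P p q h -> P p q (h / 2) \/ P (p + h / 2) q (h / 2)
     \/ P p (q + h / 2) (h / 2) \/ P (p + h / 2) (q + h / 2) (h / 2)) ->
  P 0 0 1 ->
  exists X Y, forall d, 0 < d ->
    exists p q h, P p q h /\ 0 < h < d /\ p <= X <= p + h /\ q <= Y <= q + h.
Proof.
intros step P0.
pose (St := {s : R * R * R | P (fst (fst s)) (snd (fst s)) (snd s)}).
assert (Hs : forall s : St, exists s' : St,
  snd (proj1_sig s') = snd (proj1_sig s) / 2 /\
  (fst (fst (proj1_sig s')) = fst (fst (proj1_sig s)) \/
   fst (fst (proj1_sig s')) = fst (fst (proj1_sig s)) + snd (proj1_sig s) / 2) /\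
  (snd (fst (proj1_sig s')) = snd (fst (proj1_sig s)) \/
   snd (fst (proj1_sig s')) = snd (fst (proj1_sig s)) + snd (proj1_sig s) / 2)).
{ intros [[[p q] h] H]; simpl in *.
  destruct (step p q h H) as [H'|[H'|[H'|H']]].
  - exists (exist _ (p, q, h / 2) H'); simpl; tauto.
  - exists (exist _ (p + h / 2, q, h / 2) H'); simpl; tauto.
  - exists (exist _ (p, q + h / 2, h / 2) H'); simpl; tauto.
  - exists (exist _ (p + h / 2, q + h / 2, h / 2) H'); simpl; tauto. }
pose (next := fun s => proj1_sig (constructive_indefinite_description _ (Hs s))).
pose (u := fix u (n : nat) : St :=
  match n with O => exist _ (0, 0, 1) P0 | S k => next (u k) end).
pose (p := fun n => fst (fst (proj1_sig (u n)))).
pose (q := fun n => snd (fst (proj1_sig (u n)))).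
pose (h := fun n => snd (proj1_sig (u n))).
assert (Hn : forall n, h (S n) = h n / 2 /\ (p (S n) = p n \/ p (S n) = p n + h n / 2) /\
  (q (S n) = q n \/ q (S n) = q n + h n / 2)).
{ intros n. exact (proj2_sig (constructive_indefinite_description _ (Hs (u n)))). }
assert (Eh : forall n, h n = (/ 2) ^ n).
{ induction n as [|n IH]; [reflexivity|]. rewrite (proj1 (Hn n)), IH; simpl; field. }
assert (Ph : forall n, 0 < h n) by (intros; rewrite Eh; apply pow_lt; lra).
assert (lim : forall a : nat -> R, (forall n, a (S n) = a n \/ a (S n) = a n + h n / 2) ->
  exists X, forall n, a n <= X <= a n + h n).
{ intros a Ha.
  assert (mono : forall n k, a n <= a (n + k)%nat /\ a (n + k)%nat + h (n + k)%nat <= a n + h n).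
  { induction k as [|k IH]; [rewrite Nat.add_0_r; lra|].
    rewrite Nat.add_succ_r. pose proof (Ph (n + k)%nat).
    destruct (Hn (n + k)%nat) as [E _]. destruct (Ha (n + k)%nat) as [E'|E']; lra. }
  assert (cross : forall m n, a m <= a n + h n).
  { intros m n. destruct (Nat.le_gt_cases m n) as [L|L].
    - pose proof (proj1 (mono m (n - m)%nat)) as A. rewrite Nat.add_comm, Nat.sub_add in A by exact L.
      pose proof (Ph n); lra.
    - pose proof (proj2 (mono n (m - n)%nat)) as A. rewrite Nat.add_comm, Nat.sub_add in A by lia.
      pose proof (Ph m); lra. }
  destruct (completeness (fun x => exists n, x = a n)) as [X [HX1 HX2]].
  - exists (a 0%nat + h 0%nat). intros x [n ->]; apply cross.
  - exists (a 0%nat); exists 0%nat; reflexivity.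
  - exists X; intros n; split; [apply HX1; exists n; reflexivity|].
    apply HX2. intros x [m ->]; apply cross. }
destruct (lim p (fun n => proj1 (proj2 (Hn n)))) as [X HX].
destruct (lim q (fun n => proj2 (proj2 (Hn n)))) as [Y HY].
exists X, Y; intros d Hd.
destruct (pow_lt_1_zero (/ 2) (ltac:(rewrite Rabs_right; lra)) d Hd) as [N HN].
specialize (HN N (le_n N)). rewrite <- Eh, Rabs_right in HN by (left; apply Ph).
exists (p N), (q N), (h N). split; [exact (proj2_sig (u N))|]. auto.
Qed.

Lemma Rabs_convex a b c r p : 0 <= p <= 1 -> Rabs (a - c) < r -> Rabs (b - c) < r ->
  Rabs (a + p * (b - a) - c) < r.
Proof.
intros Hp Ha Hb.
replace (a + p * (b - a) - c) with ((1 - p) * (a - c) + p * (b - c)) by ring.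
eapply Rle_lt_trans; [apply Rabs_triang|].
rewrite !Rabs_mult, (Rabs_right p), (Rabs_right (1 - p)) by lra.
destruct (Req_dec p 0) as [->|Hn]; [lra|].
assert (p * Rabs (b - c) < p * r) by (apply Rmult_lt_compat_l; lra).
assert ((1 - p) * Rabs (a - c) <= (1 - p) * r) by (apply Rmult_le_compat_l; lra).
lra.
Qed.

Lemma Rabs_in_side p t t0 s h u : 0 < h -> p <= s <= p + h ->
  Rmin (t0 + p * t) (t0 + (p + h) * t) <= u <= Rmax (t0 + p * t) (t0 + (p + h) * t) ->
  Rabs (u - (t0 + s * t)) <= Rabs t * h.
Proof.
intros Hh Hs Hu. replace (Rabs t * h) with (Rabs (h * t)) by (rewrite Rabs_mult, (Rabs_right h) by lra; ring).
revert Hu; unfold Rmin, Rmax; destruct Rle_dec; intros Hu;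
  [rewrite (Rabs_right (h * t)) by lra|rewrite (Rabs_left (h * t)) by lra]; apply Rabs_le; nra.
Qed.

(** Otherwise some quarter keeps a quarter of the integral at each bisection, so that
    near the limit point the integral is at least eps h^2; but f is affine there up to
    o(h), and an affine function has a primitive. *)
Theorem goursat (f : C -> C) z0 r x x' y y' :
  (forall w, square z0 r w -> exists l, Cderiv f w l) ->
  square z0 r (x, y) -> square z0 r (x', y') -> rect f x x' y y' = RtoC 0.
Proof.
intros Hf H1 H2. apply NNPP; intros Hne.
pose proof (Cmod_pos _ Hne) as Heps. set (eps := Cmod (rect f x x' y y')) in *.
assert (Cf : Ccont_on (square z0 r) f).
{ intros w Hw; destruct (Hf w Hw) as [l Hl]; exact (Cderiv_cont _ _ _ Hl). }
set (a := x' - x). set (b := y' - y).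
assert (inS : forall p q, 0 <= p <= 1 -> 0 <= q <= 1 -> square z0 r (x + p * a, y + q * b)).
{ intros p q Hp Hq; destruct H1, H2; split; simpl in *; apply Rabs_convex; assumption. }
set (L := fun p q h => rect f (x + p * a) (x + (p + h) * a) (y + q * b) (y + (q + h) * b)).
set (P := fun p q h => 0 < h /\ 0 <= p /\ p + h <= 1 /\ 0 <= q /\ q + h <= 1 /\
   eps * (h * h) <= Cmod (L p q h)).
destruct (bisection P) as [X [Y HXY]].
- intros p q h (Hh & Hp & Hp' & Hq & Hq' & HL).
  assert (E : L p q h = (L p q (h/2)%R + L (p + h/2)%R q (h/2)%R + L p (q + h/2)%R (h/2)%R
     + L (p + h/2)%R (q+h/2)%R (h/2)%R)%C).
  { unfold L. rewrite (rect_split z0 r f (x + p * a) (x + (p + h / 2) * a) (x + (p + h) * a)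
     (y + q * b) (y + (q + h / 2) * b) (y + (q + h) * b) Cf) by (apply inS; lra).
    replace (p + h / 2 + h / 2) with (p + h) by lra.
    replace (q + h / 2 + h / 2) with (q + h) by lra. reflexivity. }
  assert (T : Cmod (L p q h) <= Cmod (L p q (h/2)%R) + Cmod (L (p + h/2)%R q (h/2)%R)
     + Cmod (L p (q + h/2)%R (h/2)%R) + Cmod (L (p + h/2)%R (q+h/2)%R (h/2)%R)).
  { rewrite E. eapply Rle_trans; [apply Cmod_triangle|]. apply Rplus_le_compat_r.
    eapply Rle_trans; [apply Cmod_triangle|]. apply Rplus_le_compat_r. apply Cmod_triangle. }
  unfold P.
  destruct (Rle_dec (eps * (h / 2 * (h / 2))) (Cmod (L p q (h/2)%R))); [left; repeat split; lra|].
  destruct (Rle_dec (eps * (h / 2 * (h / 2))) (Cmod (L (p + h/2)%R q (h/2)%R))); [right; left; repeat split; lra|].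
  destruct (Rle_dec (eps * (h / 2 * (h / 2))) (Cmod (L p (q + h/2)%R (h/2)%R))); [right; right; left; repeat split; lra|].
  destruct (Rle_dec (eps * (h / 2 * (h / 2))) (Cmod (L (p + h/2)%R (q+h/2)%R (h/2)%R))); [right; right; right; repeat split; lra|].
  exfalso. nra.
- unfold P; repeat split; try lra. unfold L, eps.
  replace (x + 0 * a) with x by ring. replace (x + (0 + 1) * a) with x' by (unfold a; ring).
  replace (y + 0 * b) with y by ring. replace (y + (0 + 1) * b) with y' by (unfold b; ring). lra.
- assert (HX : 0 <= X <= 1 /\ 0 <= Y <= 1).
  { destruct (HXY 1 Rlt_0_1) as (p & q & h & (Hh & Hp & Hp' & Hq & Hq' & _) & _ & B1 & B2). lra. }
  set (w0 := (x + X * a, y + Y * b) : C).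
  destruct (Hf w0) as [l Hl]; [apply inS; tauto|].
  set (m := Rabs a + Rabs b).
  assert (Hm : 0 <= m) by (unfold m; pose proof (Rabs_pos a); pose proof (Rabs_pos b); lra).
  (* a local error of eta times the diameter m h makes the integral at most 2 eta m^2 h^2,
     which is less than eps h^2 *)
  set (eta := eps / (2 * (m + 1) * (m + 1))).
  assert (Heta : 0 < eta) by (apply Rdiv_lt_0_compat; [exact Heps|nra]).
  destruct (proj1 (locally_Cmod _ _) (proj1 (Cderiv_eps f w0 l) Hl eta Heta)) as [d [Hd HE]].
  assert (Hd' : 0 < d / (m + 1)) by (apply Rdiv_lt_0_compat; lra).
  destruct (HXY _ Hd') as (p & q & h & (Hh & Hp & Hp' & Hq & Hq' & HL) & [_ Hhd] & B1 & B2).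
  set (A := fun w : C => (f w0 + (w - w0) * l)%C).
  assert (CA : Ccont_on (square z0 r) A).
  { intros w _. apply ccont_plus; [apply ccont_const|]. apply ccont_mult; [|apply ccont_const].
    apply ccont_minus; [apply ccont_id|apply ccont_const]. }
  assert (S1 : square z0 r (x + p * a, y + q * b)) by (apply inS; lra).
  assert (S2 : square z0 r (x + (p + h) * a, y + (q + h) * b)) by (apply inS; lra).
  assert (RA : rect A (x + p * a) (x + (p + h) * a) (y + q * b) (y + (q + h) * b) = RtoC 0).
  { apply rect_primitive with (z0 := z0) (r := r)
      (F := fun w => (f w0 * w + l * / 2 * ((w - w0) * (w - w0)))%C); try assumption.
    intros w _. unfold A.
    replace (f w0 + (w - w0) * l)%C
      with (f w0 * RtoC 1 + l * / 2 * ((RtoC 1 - RtoC 0) * (w - w0) + (w - w0) * (RtoC 1 - RtoC 0)))%C.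
    - apply Cderiv_plus; apply Cderiv_scal; [apply Cderiv_id|].
      apply (Cderiv_mult (fun w => w - w0)%C (fun w => w - w0)%C);
      apply Cderiv_minus; (apply Cderiv_id || apply Cderiv_const).
    - field. }
  pose proof (rect_minus z0 r f A _ _ _ _ Cf CA S1 S2) as RE. rewrite RA in RE.
  assert (BE : Cmod (rect (fun w => f w - A w)%C (x + p * a) (x + (p + h) * a) (y + q * b) (y + (q + h) * b))
     <= 2 * (Rabs (x + (p + h) * a - (x + p * a)) + Rabs (y + (q + h) * b - (y + q * b))) * (eta * (m * h))).
  { apply (rect_bound z0 r); try assumption.
    - intros w Hw; apply ccont_minus; auto.
    - intros u v Hu Hv.
      assert (B : Cmod ((u, v) - w0) <= m * h).
      { eapply Rle_trans; [apply Cmod_Rabs_le|]. simpl.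
        pose proof (Rabs_in_side p a x X h u Hh B1 Hu). pose proof (Rabs_in_side q b y Y h v Hh B2 Hv).
        unfold m, Rminus in *; lra. }
      replace (f (u, v) - A (u, v))%C with (f (u, v) - f w0 - ((u, v) - w0) * l)%C by (unfold A; ring).
      eapply Rle_trans; [apply HE|].
      + apply Rle_lt_trans with (1 := B).
        apply Rle_lt_trans with ((m + 1) * h); [nra|].
        replace d with ((m + 1) * (d / (m + 1))) by (field; lra).
        apply Rmult_lt_compat_l; lra.
      + apply Rmult_le_compat_l; lra. }
  unfold Cminus in RE; rewrite Copp_0, Cplus_0_r in RE. unfold Cminus in BE. rewrite RE in BE.
  assert (E1 : Rabs (x + (p + h) * a - (x + p * a)) = Rabs a * h).
  { replace (x + (p + h) * a - (x + p * a)) with (a * h) by ring.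
    rewrite Rabs_mult, (Rabs_right h) by lra. reflexivity. }
  assert (E2 : Rabs (y + (q + h) * b - (y + q * b)) = Rabs b * h).
  { replace (y + (q + h) * b - (y + q * b)) with (b * h) by ring.
    rewrite Rabs_mult, (Rabs_right h) by lra. reflexivity. }
  rewrite E1, E2 in BE. unfold L in HL.
  assert (F1 : eps * (h * h) <= 2 * eta * (m * m) * (h * h)).
  { eapply Rle_trans; [exact HL|]. eapply Rle_trans; [exact BE|]. right; unfold m; ring. }
  apply Rmult_le_reg_r in F1; [|nra].
  assert (E3 : eps = 2 * eta * ((m + 1) * (m + 1))) by (unfold eta; field; lra).
  nra.
Qed.

(** The primitive is the integral along a horizontal and then a vertical
    segment from the center. *)
Theorem square_primitive (f : C -> C) z0 r : 0 < r ->
  (forall w, square z0 r w -> exists l, Cderiv f w l) ->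
  exists F, forall w, square z0 r w -> Cderiv F w (f w).
Proof.
intros Hr Hf.
assert (Cf : Ccont_on (square z0 r) f).
{ intros w Hw; destruct (Hf w Hw) as [l Hl]; exact (Cderiv_cont _ _ _ Hl). }
destruct z0 as [x0 y0].
assert (S0 : square (x0, y0) r (x0, y0)) by (split; simpl; rewrite Rminus_diag, Rabs_R0; exact Hr).
exists (fun w => hor f x0 (fst w) y0 + ver f (fst w) y0 (snd w))%C.
intros [x y] Hw. apply Cderiv_eps; intros e He. simpl.
assert (He2 : 0 < e / 2) by lra.
destruct (proj1 (locally_Cmod _ _) (proj1 (ccont_eps f (x, y)) (Cf _ Hw) _ He2)) as [d [Hd HE]].
set (t := Rmin (r - Rabs (x - x0)) (r - Rabs (y - y0))).
assert (Ht : 0 < t) by (destruct Hw as [W1 W2]; simpl in W1, W2; unfold t; apply Rmin_glb_lt; lra).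
apply locally_Cmod; exists (Rmin (d / 2) t); split; [apply Rmin_glb_lt; lra|].
intros [x' y'] Hw'; simpl.
assert (D1 : Rabs (x' - x) <= Cmod ((x', y') - (x, y))) by exact (fst_le_Cmod ((x', y') - (x, y))).
assert (D2 : Rabs (y' - y) <= Cmod ((x', y') - (x, y))) by exact (snd_le_Cmod ((x', y') - (x, y))).
pose proof (Rlt_le_trans _ _ _ Hw' (Rmin_l _ _)) as W1.
pose proof (Rlt_le_trans _ _ _ Hw' (Rmin_r _ _)) as W2.
assert (W3 : t <= r - Rabs (x - x0)) by apply Rmin_l.
assert (W4 : t <= r - Rabs (y - y0)) by apply Rmin_r.
assert (Sq' : square (x0, y0) r (x', y')).
{ split; simpl.
  - replace (x' - x0) with ((x' - x) + (x - x0)) by ring. eapply Rle_lt_trans; [apply Rabs_triang|]. lra.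
  - replace (y' - y0) with ((y' - y) + (y - y0)) by ring. eapply Rle_lt_trans; [apply Rabs_triang|]. lra. }
destruct (square_corner _ _ _ _ _ _ Hw Sq') as [S1 S2].
destruct (square_corner _ _ _ _ _ _ S0 Hw) as [S3 S4].
destruct (square_corner _ _ _ _ _ _ S0 Sq') as [S5 S6].
(* go horizontally along the height y and then vertically; Goursat for the rectangle with
   corners (x,y0) and (x',y) compares this with the path through (x',y0) *)
assert (E : (hor f x0 x' y0 + ver f x' y0 y' - (hor f x0 x y0 + ver f x y0 y))%C
  = (hor f x x' y + ver f x' y y')%C).
{ pose proof (goursat f (x0, y0) r x x' y0 y Hf S4 S2) as G. unfold rect in G.
  rewrite (hor_Chasles (x0, y0) r f x0 x x' y0), (ver_Chasles (x0, y0) r f x' y0 y y') by assumption.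
  set (h1 := hor f x x' y0) in *. set (v1 := ver f x' y0 y) in *.
  set (h2 := hor f x x' y) in *. set (v2 := ver f x y0 y) in *.
  replace h1 with (h2 + v2 - v1 + (h1 + v1 - h2 - v2))%C by ring. rewrite G. ring. }
rewrite E.
replace (hor f x x' y + ver f x' y y' - ((x', y') - (x, y)) * f (x, y))%C
  with ((hor f x x' y - (RtoC x' - RtoC x) * f (x, y))
    + (ver f x' y y' - (RtoC y' - RtoC y) * (Ci * f (x, y))))%C
  by (apply injective_projections; simpl; ring).
eapply Rle_trans; [apply Cmod_triangle|].
assert (near : forall u v, Rmin x x' <= u <= Rmax x x' -> Rmin y y' <= v <= Rmax y y' ->
  Cmod (f (u, v) - f (x, y)) <= e / 2).
{ intros u v Hu Hv. left; apply HE. eapply Rle_lt_trans; [apply Cmod_Rabs_le|]. simpl.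
  pose proof (Rabs_between_le _ _ _ Hu). pose proof (Rabs_between_le _ _ _ Hv).
  fold (u - x) (v - y). lra. }
assert (B1 : Cmod (hor f x x' y - (RtoC x' - RtoC x) * f (x, y)) <= Rabs (x' - x) * (e / 2)).
{ apply is_CInt_bound with (fun u => f (u, y) - f (x, y))%C.
  - intros u Hu; apply near; [exact Hu|]. unfold Rmin, Rmax; destruct Rle_dec; lra.
  - apply is_CInt_minus; [apply (is_CInt_hor (x0, y0) r); assumption|apply is_CInt_const]. }
assert (B2 : Cmod (ver f x' y y' - (RtoC y' - RtoC y) * (Ci * f (x, y))) <= Rabs (y' - y) * (e / 2)).
{ apply is_CInt_bound with (fun v => Ci * f (x', v) - Ci * f (x, y))%C.
  - intros u Hu; cbv beta. replace (Ci * f (x', u) - Ci * f (x, y))%C with (Ci * (f (x', u) - f (x, y)))%C by ring.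
    rewrite Cmod_mult, Cmod_Ci, Rmult_1_l. apply near; [|exact Hu]. unfold Rmin, Rmax; destruct Rle_dec; lra.
  - apply is_CInt_minus; [apply (is_CInt_ver (x0, y0) r); assumption|apply is_CInt_const]. }
assert (Rabs (x' - x) * (e / 2) + Rabs (y' - y) * (e / 2) <= e * Cmod ((x', y') - (x, y))).
{ nra. }
lra.
Qed.

(** * The Cauchy formula, derivatives of holomorphic functions and the Liouville theorem *)

Lemma ccont_of_fst {T U : UniformSpace} (g : T -> C) (x : T) (y : U) :
  ccont g x -> ccont (T := prod_UniformSpace T U) (fun p => g (fst p)) (x, y).
Proof. intros H. apply (continuous_comp (U := prod_UniformSpace T U) fst g); [apply continuous_fst|exact H]. Qed.

Lemma ccont_of_snd {T U : UniformSpace} (g : U -> C) (x : T) (y : U) :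
  ccont g y -> ccont (T := prod_UniformSpace T U) (fun p => g (snd p)) (x, y).
Proof. intros H. apply (continuous_comp (U := prod_UniformSpace T U) snd g); [apply continuous_snd|exact H]. Qed.

Definition closed_path (g dg : R -> C) (a b : R) : Prop :=
  a <= b /\ (forall s, a <= s <= b -> Rderiv g s (dg s)) /\
  (forall s, a <= s <= b -> ccontR dg s) /\ g a = g b.

Lemma ccont2_segment (g : R -> C) (z : C) s u : ccontR g s ->
  ccont2 (T := RU) (fun s u => z + RtoC u * (g s - z))%C s u.
Proof.
intros Hg. apply ccont_plus; [apply ccont_const|]. apply ccont_mult.
- apply (ccont_of_snd), ccont_RtoC_id.
- apply ccont_minus; [|apply ccont_const].
  apply (ccont_of_fst), Hg.
Qed.

Lemma square_segment z0 r z w u : 0 <= u <= 1 -> square z0 r z -> square z0 r w ->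
  square z0 r (z + RtoC u * (w - z))%C.
Proof.
intros Hu [H1 H2] [H3 H4]; split; simpl.
- replace (fst z + (u * (fst w + - fst z) - 0 * (snd w + - snd z)) - fst z0)
    with (fst z + u * (fst w - fst z) - fst z0) by ring. apply Rabs_convex; assumption.
- replace (snd z + (u * (snd w + - snd z) + 0 * (fst w + - fst z)) - snd z0)
    with (snd z + u * (snd w - snd z) - snd z0) by ring. apply Rabs_convex; assumption.
Qed.

(** The quotient (F (g s) - F z) / (g s - z) is the mean of f over the segment from z
    to g s. After exchanging the two integrals, the inner one is that of an exact form,
    (1/u) d (F (z + u (g s - z))), along a closed path. *)
Lemma star_cauchy F f z0 r (g dg : R -> C) a b z :
  (forall w, square z0 r w -> Cderiv F w (f w)) -> Ccont_on (square z0 r) f ->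
  closed_path g dg a b -> (forall s, a <= s <= b -> square z0 r (g s)) ->
  square z0 r z -> (forall s, a <= s <= b -> g s <> z) ->
  is_CInt (fun s => (F (g s) - F z) / (g s - z) * dg s)%C a b (RtoC 0).
Proof.
intros HF Hf (Hab & Hg & Hdg & Ecl) Hsq Hz Hne.
set (k := fun s u => (f (z + RtoC u * (g s - z)) * dg s)%C).
assert (Hk : forall s u, a <= s <= b -> 0 <= u <= 1 -> ccont2 (T := RU) k s u).
{ intros s u Hs Hu. apply ccont_mult.
  - apply (ccont_comp (T := prod_UniformSpace RU RU) f
      (fun p => z + RtoC (snd p) * (g (fst p) - z))%C).
    + apply (ccont2_segment g z s u), (Rderiv_cont _ _ _ (Hg s Hs)).
    + apply Hf, square_segment; auto.
  - apply (ccont_of_fst), Hdg, Hs. }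
pose proof (fubini k a b 0 1 Hab Rle_0_1 Hk) as Fu.
rewrite (CInt_zero (fun y => CInt (fun x => k x y) a b)) in Fu.
- eapply is_CInt_ext; [|exact Fu].
  intros s Hs. assert (Hs' : a <= s <= b) by (apply between_le; [exact Hab|lra]).
  pose proof (Cminus_neq0 _ _ (Hne s Hs')) as Hn.
  refine (is_CInt_unique _ _ _ _ _). unfold k.
  replace ((F (g s) - F z) / (g s - z) * dg s)%C
    with (dg s / (g s - z) * (F (z + RtoC 1 * (g s - z)) - F (z + RtoC 0 * (g s - z))))%C.
  2: { replace (z + RtoC 1 * (g s - z))%C with (g s) by ring.
       replace (z + RtoC 0 * (g s - z))%C with z by ring. field. exact Hn. }
  apply is_CInt_ext with (fun u => dg s / (g s - z) * (f (z + RtoC u * (g s - z)) * (g s - z)))%C.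
  { intros u _. field. exact Hn. }
  apply is_CInt_scal.
  apply (is_CInt_FTC (fun u => F (z + RtoC u * (g s - z)))%C).
  + intros u Hu. apply between_le in Hu; [|lra].
    apply (Rderiv_comp F (fun u => z + RtoC u * (g s - z))%C); [apply Rderiv_affine|].
    apply HF, square_segment; auto.
  + intros u Hu. apply between_le in Hu; [|lra]. apply ccont_mult; [|apply ccont_const].
    apply (ccont_comp (T := RU) f (fun u => z + RtoC u * (g s - z))%C).
    * exact (Rderiv_cont _ _ _ (Rderiv_affine _ _ _)).
    * apply Hf, square_segment; auto.
- intros u Hu. rewrite Rmin_left, Rmax_right in Hu by lra.
  assert (Hu0 : RtoC u <> RtoC 0) by (intros E; apply RtoC_inj in E; lra).
  apply is_CInt_unique.
  replace (RtoC 0) with (/ RtoC u * (F (z + RtoC u * (g b - z)) - F (z + RtoC u * (g a - z))))%C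
    by (rewrite Ecl; ring).
  apply is_CInt_ext with (fun s => / RtoC u * (f (z + RtoC u * (g s - z)) * (RtoC u * dg s)))%C.
  { intros s _. unfold k. field. exact Hu0. }
  apply is_CInt_scal.
  assert (Hd : forall s, a <= s <= b -> Rderiv (fun s => z + RtoC u * (g s - z))%C s (RtoC u * dg s)%C).
  { intros s Hs. apply (Rderiv_comp (fun w => z + RtoC u * (w - z))%C g); [apply Hg, Hs|].
    apply Cderiv_slope; exists (fun _ => RtoC u); split; [apply ccont_const|].
    split; [reflexivity|]. intros; ring. }
  apply (is_CInt_FTC (fun s => F (z + RtoC u * (g s - z)))%C).
  + intros s Hs. apply between_le in Hs; [|lra].
    apply (Rderiv_comp F (fun s => z + RtoC u * (g s - z))%C); [apply Hd, Hs|].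
    apply HF, square_segment; auto; lra.
  + intros s Hs. apply between_le in Hs; [|lra]. apply ccont_mult.
    * apply (ccont_comp (T := RU) f (fun s => z + RtoC u * (g s - z))%C).
      -- exact (Rderiv_cont _ _ _ (Hd s Hs)).
      -- apply Hf, square_segment; auto; lra.
    * apply ccont_mult; [apply ccont_const|apply Hdg, Hs].
Qed.

(** The difference of the two kernels is the integral over u of
    (w - z) dg / (g - z - u (w - z))^2, which is exact in s for each u. *)
Lemma winding_segment (g dg : R -> C) a b z w :
  closed_path g dg a b ->
  (forall s u, a <= s <= b -> 0 <= u <= 1 -> g s <> (z + RtoC u * (w - z))%C) ->
  CInt (fun s => dg s / (g s - z))%C a b = CInt (fun s => dg s / (g s - w))%C a b.
Proof.
intros (Hab & Hg & Hdg & Ecl) Hne.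
set (p := fun s u => (g s - (z + RtoC u * (w - z)))%C).
assert (Hp : forall s u, a <= s <= b -> 0 <= u <= 1 -> p s u <> RtoC 0).
{ intros; apply Cminus_neq0; auto. }
assert (Cp : forall s u, a <= s <= b -> ccont2 (T := RU) p s u).
{ intros s u Hs. apply ccont_minus.
  - apply (ccont_of_fst), (Rderiv_cont _ _ _ (Hg s Hs)).
  - apply (ccont_of_snd (fun u => z + RtoC u * (w - z))%C).
    exact (Rderiv_cont _ _ _ (Rderiv_affine _ _ _)). }
set (k := fun s u => ((w - z) * dg s / (p s u * p s u))%C).
assert (Hk : forall s u, a <= s <= b -> 0 <= u <= 1 -> ccont2 (T := RU) k s u).
{ intros s u Hs Hu. apply ccont_div.
  - apply Cmult_neq_0; apply Hp; assumption.
  - apply ccont_mult; [apply ccont_const|].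
    apply (ccont_of_fst), Hdg, Hs.
  - apply ccont_mult; apply Cp; exact Hs. }
pose proof (fubini k a b 0 1 Hab Rle_0_1 Hk) as Fu.
rewrite (CInt_zero (fun y => CInt (fun x => k x y) a b)) in Fu.
- assert (cont : forall u, 0 <= u <= 1 -> is_CInt (fun s => dg s / p s u)%C a b (CInt (fun s => dg s / p s u)%C a b)).
  { intros u Hu. apply is_CInt_cont; intros s Hs; apply between_le in Hs; [|exact Hab].
    apply ccont_div; [apply Hp; assumption|apply Hdg, Hs|].
    apply (ccont2_l (T := RU) p), Cp, Hs. }
  assert (E : is_CInt (fun s => dg s / p s 1 - dg s / p s 0)%C a b (RtoC 0)).
  { eapply is_CInt_ext; [|exact Fu]. intros s Hs.
    assert (Hs' : a <= s <= b) by (apply between_le; [exact Hab|lra]).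
    refine (is_CInt_unique _ _ _ _ _).
    replace (dg s / p s 1 - dg s / p s 0)%C with (dg s * / p s 1 - dg s * / p s 0)%C by reflexivity.
    apply (is_CInt_FTC (fun u => dg s * / p s u)%C).
    - intros u Hu. apply between_le in Hu; [|lra]. pose proof (Hp s u Hs' Hu) as Hn.
      replace (k s u) with (dg s * (- RtoC 1 / (p s u * p s u)) * (- (w - z)))%C
        by (unfold k; field; exact Hn).
      apply (Rderiv_comp (fun q => dg s * / q)%C (p s)).
      + apply Rderiv_slope; exists (fun _ => - (w - z))%C; split; [apply ccont_const|].
        split; [reflexivity|]. intros; unfold p; ring.
      + apply Cderiv_scal, (Cderiv_inv (fun w => w)); [exact Hn|apply Cderiv_id].
    - intros u Hu. apply between_le in Hu; [|lra].
      apply (ccont2_r (T := RU) k), Hk; assumption. }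
  pose proof (is_CInt_minus _ _ _ _ _ _ (cont 1 ltac:(lra)) (cont 0 ltac:(lra))) as E'.
  pose proof (is_CInt_unique _ _ _ _ E) as U1. rewrite (is_CInt_unique _ _ _ _ E') in U1.
  rewrite (CInt_ext (fun s => dg s / (g s - z))%C (fun s => dg s / p s 0)%C),
    (CInt_ext (fun s => dg s / (g s - w))%C (fun s => dg s / p s 1)%C).
  + symmetry; apply Ceq_minus, U1.
  + intros; f_equal; f_equal; unfold p; ring.
  + intros; f_equal; f_equal; unfold p; ring.
- intros u Hu. rewrite Rmin_left, Rmax_right in Hu by lra.
  assert (Hu' : 0 <= u <= 1) by lra.
  apply is_CInt_unique.
  replace (RtoC 0) with (- (w - z) * / p b u - - (w - z) * / p a u)%C by (unfold p; rewrite Ecl; ring).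
  apply (is_CInt_FTC (fun s => - (w - z) * / p s u)%C).
  + intros s Hs. apply between_le in Hs; [|exact Hab]. pose proof (Hp s u Hs Hu') as Hn.
    replace (k s u) with (- (w - z) * (- RtoC 1 / (p s u * p s u)) * dg s)%C by (unfold k; field; exact Hn).
    apply (Rderiv_comp (fun x => - (w - z) * / (x - (z + RtoC u * (w - z))))%C g); [apply Hg, Hs|].
    apply Cderiv_scal, (Cderiv_inv (fun x => x - (z + RtoC u * (w - z)))%C); [exact Hn|].
    replace (RtoC 1) with (RtoC 1 - RtoC 0)%C by ring.
    apply Cderiv_minus; [apply Cderiv_id|apply Cderiv_const].
  + intros s Hs. apply between_le in Hs; [|exact Hab].
    apply (ccont2_l (T := RU) k), Hk; assumption.
Qed.

Definition circ (z0 : C) (r t : R) : C := Cplus z0 (r * cos t, r * sin t).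
Definition dcirc (r t : R) : C := (- (r * sin t), r * cos t).

Lemma Rderiv_circ z0 r t : Rderiv (circ z0 r) t (dcirc r t).
Proof. apply Rderiv_pair; simpl; auto_derive; auto; ring. Qed.

Lemma ccont_dcirc r t : ccontR (dcirc r) t.
Proof.
apply (Rderiv_cont _ _ (- (r * cos t), - (r * sin t))).
apply Rderiv_pair; simpl; auto_derive; auto; ring.
Qed.

Lemma circ_closed z0 r : closed_path (circ z0 r) (dcirc r) 0 (2 * PI).
Proof.
pose proof PI_RGT_0. split; [|split; [|split]].
- lra.
- intros; apply Rderiv_circ.
- intros; apply ccont_dcirc.
- unfold circ. rewrite cos_0, sin_0, cos_2PI, sin_2PI. reflexivity.
Qed.

Lemma Cmod_circ z0 r t : 0 <= r -> Cmod (circ z0 r t - z0) = r.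
Proof.
intros Hr. unfold circ.
replace (Cminus (Cplus z0 (r * cos t, r * sin t)) z0) with ((r * cos t, r * sin t) : C) by (apply injective_projections; simpl; ring).
unfold Cmod; simpl.
replace (_ + _) with (r * r * ((sin t)² + (cos t)²)) by (unfold Rsqr; ring).
rewrite sin2_cos2, Rmult_1_r. apply sqrt_square, Hr.
Qed.

Lemma Cmod_dcirc r t : 0 <= r -> Cmod (dcirc r t) = r.
Proof.
intros Hr. unfold dcirc, Cmod; simpl.
replace (_ + _) with (r * r * ((sin t)² + (cos t)²)) by (unfold Rsqr; ring).
rewrite sin2_cos2, Rmult_1_r. apply sqrt_square, Hr.
Qed.

(** The velocity is i times the radius, so dt/(t - z0) is constant on the circle. *)
Lemma dcirc_circ z0 r t : dcirc r t = (Ci * (circ z0 r t - z0))%C.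
Proof. apply injective_projections; simpl; ring. Qed.

(** Off-center points reduce to the center by moving along a radius. *)
Lemma circle_winding z0 r z : 0 < r -> Cmod (z - z0) < r ->
  CInt (fun t => dcirc r t / (circ z0 r t - z))%C 0 (2 * PI) = (2 * PI * Ci)%C.
Proof.
intros Hr Hz. rewrite <- (winding_segment (circ z0 r) (dcirc r) 0 (2 * PI) z0 z).
- rewrite (CInt_ext _ (fun _ => Ci)).
  + rewrite (is_CInt_unique _ _ _ _ (is_CInt_const Ci 0 (2 * PI))).
    rewrite RtoC_mult. ring.
  + intros t _. rewrite (dcirc_circ z0). field.
    intros E. pose proof (Cmod_circ z0 r t (Rlt_le _ _ Hr)) as E1. rewrite E, Cmod_0 in E1. lra.
- apply circ_closed.
- intros t u _ Hu E. pose proof (Cmod_circ z0 r t (Rlt_le _ _ Hr)) as E1. rewrite E in E1.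
  replace (z0 + RtoC u * (z - z0) - z0)%C with (RtoC u * (z - z0))%C in E1 by ring.
  rewrite Cmod_mult, Cmod_R, Rabs_right in E1 by lra. pose proof (Cmod_ge_0 (z - z0)). nra.
Qed.

Lemma square_Cmod z0 r w : Cmod (w - z0) < r -> square z0 r w.
Proof.
intros H; split; [pose proof (fst_le_Cmod (w - z0)) as A|pose proof (snd_le_Cmod (w - z0)) as A];
  simpl in A; unfold Rminus; lra.
Qed.

Lemma circ_neq z0 r z t : 0 < r -> Cmod (z - z0) < r -> (circ z0 r t - z)%C <> RtoC 0.
Proof.
intros Hr Hz. apply Cminus_neq0; intros E. pose proof (Cmod_circ z0 r t (Rlt_le _ _ Hr)) as E1.
rewrite E in E1. lra.
Qed.

Lemma cauchy_formula_C1 F f z0 R0 r z :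
  (forall w, square z0 R0 w -> Cderiv F w (f w)) -> Ccont_on (square z0 R0) f ->
  0 < r < R0 -> Cmod (z - z0) < r ->
  is_CInt (fun t => F (circ z0 r t) * dcirc r t / (circ z0 r t - z))%C 0 (2 * PI) (2 * PI * Ci * F z)%C.
Proof.
intros HF Hf Hr Hz.
pose proof PI_RGT_0.
assert (S1 : is_CInt (fun t => (F (circ z0 r t) - F z) / (circ z0 r t - z) * dcirc r t)%C 0 (2 * PI) (RtoC 0)).
{ apply (star_cauchy F f z0 R0); try assumption.
  - apply circ_closed.
  - intros s _. apply square_Cmod. rewrite Cmod_circ; lra.
  - apply square_Cmod. lra.
  - intros s _ E. apply (circ_neq z0 r z s); try lra. rewrite E; ring. }
assert (S2 : is_CInt (fun t => F z * (dcirc r t / (circ z0 r t - z)))%C 0 (2 * PI) (F z * (2 * PI * Ci))%C).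
{ apply is_CInt_scal. rewrite <- (circle_winding z0 r z) by lra. apply is_CInt_cont.
  intros s _. apply ccont_div; [apply circ_neq; lra|apply ccont_dcirc|].
  apply ccont_minus; [|apply ccont_const]. exact (Rderiv_cont _ _ _ (Rderiv_circ z0 r s)). }
pose proof (is_CInt_plus _ _ _ _ _ _ S1 S2) as S3.
replace (2 * PI * Ci * F z)%C with (RtoC 0 + F z * (2 * PI * Ci))%C by ring.
eapply is_CInt_ext; [|exact S3]. intros t _; cbv beta. field. apply circ_neq; lra.
Qed.

Lemma Cderiv_slope_loc f q z l : locally (T := CU) z (fun w => f w = f z + (w - z) * q w)%C ->
  ccontC q z -> q z = l -> Cderiv f z l.
Proof.
intros L Hq E. apply (Cderiv_ext_loc (fun w => f z + (w - z) * q w)%C).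
- generalize L; apply filter_imp; auto.
- apply Cderiv_slope; exists q; split; [exact Hq|]. split; [exact E|]. intros; ring.
Qed.

(** Differentiation under the integral sign, for a kernel whose difference
    quotient q is given explicitly and is continuous. *)
Lemma Cderiv_CInt_param (k q : R -> C -> C) a b z0 : a <= b ->
  (forall s, a <= s <= b -> ccont2 (T := CU) q s z0) ->
  locally (T := CU) z0 (fun z => forall s, a <= s <= b ->
    k s z = (k s z0 + (z - z0) * q s z)%C /\ ccontR (fun s => q s z) s) ->
  ex_CInt (fun s => k s z0) a b ->
  Cderiv (fun z => CInt (fun s => k s z) a b) z0 (CInt (fun s => q s z0) a b).
Proof.
intros Hab Cq L Ex.
assert (Lq : locally (T := CU) z0 (fun z => ex_CInt (fun s => q s z) a b)).
{ generalize L; apply filter_imp; intros z Hz. apply ex_CInt_cont; intros s Hs.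
  apply Hz, between_le, Hs; exact Hab. }
apply (Cderiv_slope_loc _ (fun z => CInt (fun s => q s z) a b)); [| |reflexivity].
- generalize (filter_and _ _ L Lq); apply filter_imp; intros z [Hz Eq].
  apply is_CInt_unique. apply is_CInt_ext with (fun s => k s z0 + (z - z0) * q s z)%C.
  + intros s Hs. symmetry; apply Hz, between_le; [exact Hab|lra].
  + apply is_CInt_plus; [apply CInt_correct, Ex|]. apply is_CInt_scal, CInt_correct, Eq.
- apply (ccont_CInt_param (T := CU)); [|exact Lq].
  intros s Hs; apply Cq, between_le, Hs; exact Hab.
Qed.

Lemma Cmult3_neq0 (x y z : C) : x <> RtoC 0 -> y <> RtoC 0 -> z <> RtoC 0 -> (x * y * z)%C <> RtoC 0.
Proof. intros; apply Cmult_neq_0; [apply Cmult_neq_0|]; assumption. Qed.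

Lemma ccont_mult3 {T : UniformSpace} (f g h : T -> C) x : ccont f x -> ccont g x -> ccont h x ->
  ccont (fun y => f y * g y * h y)%C x.
Proof. intros; apply ccont_mult; [apply ccont_mult|]; assumption. Qed.

Section CauchyType.
Variables (g psi : R -> C) (a b : R) (z0 : C).
Hypothesis (Hab : a <= b).
Hypothesis (Cg : forall s, a <= s <= b -> ccontR g s).
Hypothesis (Cpsi : forall s, a <= s <= b -> ccontR psi s).
Hypothesis (Hoff : forall s, a <= s <= b -> g s <> z0).

Lemma ccont2_sub s z : a <= s <= b -> ccont2 (T := CU) (fun s z => g s - z)%C s z.
Proof.
intros Hs. apply ccont_minus.
- apply (ccont_of_fst), Cg, Hs.
- apply (ccont_of_snd (fun w => w)), ccont_id.
Qed.

Lemma off_path_open :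
  locally (T := CU) z0 (fun z => forall s, a <= s <= b -> (g s - z)%C <> RtoC 0).
Proof.
apply (tube_lemma (T := CU) (fun s z => (g s - z)%C <> RtoC 0)). intros s Hs.
pose proof (Cmod_pos _ (Cminus_neq0 _ _ (Hoff s Hs))) as Hp.
generalize (proj1 (ccont_eps _ _) (ccont2_sub s z0 Hs) _ Hp); apply filter_imp.
intros [s' z] H E; simpl in H, E. rewrite E in H.
replace (RtoC 0 - (g s - z0))%C with (- (g s - z0))%C in H by ring. rewrite Cmod_opp in H. lra.
Qed.

Lemma off_path s : a <= s <= b -> (g s - z0)%C <> RtoC 0.
Proof. intros Hs. apply Cminus_neq0, Hoff, Hs. Qed.

Lemma is_CInt_cauchy_type : is_CInt (fun s => psi s / (g s - z0))%C a b (CInt (fun s => psi s / (g s - z0))%C a b).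
Proof.
apply is_CInt_cont; intros s Hs; apply between_le in Hs; [|exact Hab].
apply ccont_div; [apply off_path, Hs|apply Cpsi, Hs|].
apply ccont_minus; [apply Cg, Hs|apply ccont_const].
Qed.

Lemma ccont_const_psi s : a <= s <= b ->
  ccont2 (T := CU) (fun s _ => psi s) s z0.
Proof. intros Hs. apply (ccont_of_fst), Cpsi, Hs. Qed.

Lemma ccont_const_g0 s : a <= s <= b ->
  ccont2 (T := CU) (fun s _ => g s - z0)%C s z0.
Proof.
intros Hs. apply (ccont_of_fst (fun s => g s - z0)%C).
apply ccont_minus; [apply Cg, Hs|apply ccont_const].
Qed.

(** The quotient of 1/(t - z) between z and z0 is 1/((t - z)(t - z0)). *)
Lemma cauchy_type_derive :
  Cderiv (fun z => CInt (fun s => psi s / (g s - z))%C a b) z0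
     (CInt (fun s => psi s / ((g s - z0) * (g s - z0)))%C a b).
Proof.
apply (Cderiv_CInt_param (fun s z => psi s / (g s - z))%C (fun s z => psi s / ((g s - z) * (g s - z0)))%C).
- exact Hab.
- intros s Hs. pose proof (off_path s Hs). apply ccont_div; [apply Cmult_neq_0; assumption| |].
  + apply ccont_const_psi, Hs.
  + apply ccont_mult; [apply ccont2_sub, Hs|apply ccont_const_g0, Hs].
- generalize off_path_open; apply filter_imp; intros z Hz s Hs.
  pose proof (Hz s Hs). pose proof (off_path s Hs). split; [field; auto|].
  apply ccont_div; [apply Cmult_neq_0; assumption|apply Cpsi, Hs|].
  apply ccont_mult; (apply ccont_minus; [apply Cg, Hs|apply ccont_const]).
- eexists; apply is_CInt_cauchy_type.
Qed.

Lemma cauchy_type_derive2 :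
  Cderiv (fun z => CInt (fun s => psi s / ((g s - z) * (g s - z)))%C a b) z0
     (CInt (fun s => (RtoC 1 + RtoC 1) * psi s / ((g s - z0) * (g s - z0) * (g s - z0)))%C a b).
Proof.
rewrite (CInt_ext _ (fun s => psi s / ((g s - z0) * (g s - z0) * (g s - z0))
   + psi s / ((g s - z0) * (g s - z0) * (g s - z0)))%C).
2: { intros s Hs. field. apply off_path, between_le; [exact Hab|lra]. }
apply (Cderiv_CInt_param (fun s z => psi s / ((g s - z) * (g s - z)))%C
  (fun s z => psi s / ((g s - z) * (g s - z0) * (g s - z0)) + psi s / ((g s - z) * (g s - z) * (g s - z0)))%C).
- exact Hab.
- intros s Hs. pose proof (off_path s Hs).
  apply ccont_plus; (apply ccont_div; [apply Cmult3_neq0; assumption|apply ccont_const_psi, Hs|]);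
  apply ccont_mult3; (apply ccont2_sub, Hs || apply ccont_const_g0, Hs).
- generalize off_path_open; apply filter_imp; intros z Hz s Hs.
  pose proof (Hz s Hs). pose proof (off_path s Hs). split; [field; auto|].
  apply ccont_plus; (apply ccont_div; [apply Cmult3_neq0; assumption|apply Cpsi, Hs|]);
  apply ccont_mult3; (apply ccont_minus; [apply Cg, Hs|apply ccont_const]).
- apply ex_CInt_cont; intros s Hs; apply between_le in Hs; [|exact Hab]. pose proof (off_path s Hs).
  apply ccont_div; [apply Cmult_neq_0; assumption|apply Cpsi, Hs|].
  apply ccont_mult; (apply ccont_minus; [apply Cg, Hs|apply ccont_const]).
Qed.

Lemma cauchy_type_cont3 :
  ccontC
    (fun z => CInt (fun s => (RtoC 1 + RtoC 1) * psi s / ((g s - z) * (g s - z) * (g s - z)))%C a b) z0.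
Proof.
apply (ccont_CInt_param (T := CU)
  (fun s z => (RtoC 1 + RtoC 1) * psi s / ((g s - z) * (g s - z) * (g s - z)))%C).
- intros s Hs; apply between_le in Hs; [|exact Hab]. pose proof (off_path s Hs).
  apply ccont_div; [apply Cmult3_neq0; assumption| |].
  + apply ccont_mult; [apply ccont_const|apply ccont_const_psi, Hs].
  + apply ccont_mult3; apply ccont2_sub, Hs.
- generalize off_path_open; apply filter_imp; intros z Hz. apply ex_CInt_cont; intros s Hs; apply between_le in Hs; [|exact Hab].
  pose proof (Hz s Hs).
  apply ccont_div; [apply Cmult3_neq0; assumption| |].
  + apply ccont_mult; [apply ccont_const|apply Cpsi, Hs].
  + apply ccont_mult3; (apply ccont_minus; [apply Cg, Hs|apply ccont_const]).
Qed.
End CauchyType.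

Lemma two_pi_i_neq : (2 * PI * Ci)%C <> RtoC 0.
Proof.
apply Cmult3_neq0; [|apply PI_C_neq0|apply Ci_nz]. intros E; apply RtoC_inj in E; lra.
Qed.

(** By the Cauchy formula F is a Cauchy integral over a circle, so f is one with the
    square of the kernel, and it can be differentiated once more under the integral. *)
Lemma C1_derive_again F f z0 R0 : 0 < R0 ->
  (forall w, square z0 R0 w -> Cderiv F w (f w)) -> Ccont_on (square z0 R0) f ->
  exists r f1, 0 < r /\ forall w, square z0 r w -> Cderiv f w (f1 w) /\ ccontC f1 w.
Proof.
intros HR HF Hf. pose proof PI_RGT_0.
set (r := R0 / 2). assert (Hr : 0 < r < R0) by (unfold r; lra).
set (g := circ z0 r). set (psi := fun t => (F (g t) * dcirc r t)%C).
assert (Hab : 0 <= 2 * PI) by lra.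
assert (Cg : forall s, 0 <= s <= 2 * PI -> ccontR g s)
  by (intros; exact (Rderiv_cont _ _ _ (Rderiv_circ _ _ _))).
assert (Cpsi : forall s, 0 <= s <= 2 * PI -> ccontR psi s).
{ intros s Hs. apply ccont_mult; [|apply ccont_dcirc].
  apply ccont_comp; [apply Cg, Hs|]. apply (Cderiv_cont _ _ (f (g s))), HF, square_Cmod.
  unfold g; rewrite Cmod_circ; lra. }
assert (Hoff : forall z, Cmod (z - z0) < r -> forall s, 0 <= s <= 2 * PI -> g s <> z).
{ intros z Hz s _ E. apply (circ_neq z0 r z s); try lra. fold g. rewrite E; ring. }
assert (Ef : forall z, Cmod (z - z0) < r ->
  f z = (/ (2 * PI * Ci) * CInt (fun s => psi s / ((g s - z) * (g s - z)))%C 0 (2 * PI))%C).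
{ intros z Hz.
  apply (Cderiv_unique F z).
  - apply HF, square_Cmod; lra.
  - apply (Cderiv_ext_loc (fun z => / (2 * PI * Ci) * CInt (fun s => psi s / (g s - z))%C 0 (2 * PI))%C).
    + apply locally_Cmod; exists (r - Cmod (z - z0)); split; [lra|]. intros w Hw.
      assert (Hw' : Cmod (w - z0) < r).
      { replace (w - z0)%C with ((w - z) + (z - z0))%C by ring.
        eapply Rle_lt_trans; [apply Cmod_triangle|]. lra. }
      pose proof (is_CInt_unique _ _ _ _ (cauchy_formula_C1 F f z0 R0 r w HF Hf Hr Hw')) as E.
      unfold psi, g; rewrite E. field. split; [apply Ci_nz|apply PI_C_neq0].
    + apply Cderiv_scal, cauchy_type_derive; auto. }
exists (r / 2), (fun z => / (2 * PI * Ci) * CInt (fun s => (RtoC 1 + RtoC 1) * psi s / ((g s - z) * (g s - z) * (g s - z)))%C 0 (2 * PI))%C.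
split; [lra|]. intros w [W1 W2].
assert (Hw : Cmod (w - z0) < r).
{ eapply Rle_lt_trans; [apply Cmod_Rabs_le|]. simpl. unfold Rminus in *; lra. }
split.
- apply (Cderiv_ext_loc (fun z => / (2 * PI * Ci) * CInt (fun s => psi s / ((g s - z) * (g s - z)))%C 0 (2 * PI))%C).
  + apply locally_Cmod; exists (r - Cmod (w - z0)); split; [lra|]. intros v Hv.
    symmetry; apply Ef. replace (v - z0)%C with ((v - w) + (w - z0))%C by ring.
    eapply Rle_lt_trans; [apply Cmod_triangle|]. lra.
  + apply Cderiv_scal, cauchy_type_derive2; auto.
- apply ccont_mult; [apply ccont_const|]. apply cauchy_type_cont3; auto.
Qed.

Definition hol (U : C -> Prop) (f : C -> C) : Prop := forall w, U w -> exists l, Cderiv f w l.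
Definition Copen (U : C -> Prop) : Prop := forall z, U z -> locally (T := CU) z U.

Lemma Copen_square U z : Copen U -> U z -> exists r, 0 < r /\ forall w, square z r w -> U w.
Proof.
intros HU Hz. destruct (HU z Hz) as [d Hd]. exists d; split; [apply cond_pos|].
intros w [W1 W2]; apply Hd; split; assumption.
Qed.

Lemma hol_derive U f : hol U f -> forall w, U w -> Cderiv f w (C_derive f w).
Proof.
intros Hf w Hw; destruct (Hf w Hw) as [l Hl].
rewrite (is_C_derive_unique _ _ _ Hl). exact Hl.
Qed.

(** Apply [C1_derive_again] to a local primitive of f, whose derivative f is continuous. *)
Lemma hol_C1 U f : Copen U -> hol U f -> Ccont_on U (C_derive f).
Proof.
intros HU Hf z Hz. destruct (Copen_square U z HU Hz) as [r [Hr Sq]].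
destruct (square_primitive f z r Hr) as [F HF]; [intros; apply Hf, Sq; assumption|].
destruct (C1_derive_again F f z r Hr HF) as [r1 [f1 [Hr1 H1]]].
{ intros w Hw; destruct (Hf w (Sq w Hw)) as [l Hl]; exact (Cderiv_cont _ _ _ Hl). }
apply (ccont_ext_loc (T := CU) f1).
- apply locally_Cmod; exists r1; split; [exact Hr1|]. intros w Hw.
  symmetry; apply is_C_derive_unique, H1, square_Cmod, Hw.
- apply H1. apply square_Cmod. rewrite Cmod_sub_diag; lra.
Qed.

Theorem hol_hol_derive U f : Copen U -> hol U f -> hol U (C_derive f).
Proof.
intros HU Hf z Hz. destruct (Copen_square U z HU Hz) as [r [Hr Sq]].
destruct (C1_derive_again f (C_derive f) z r Hr) as [r1 [f1 [Hr1 H1]]].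
- intros w Hw; apply (hol_derive U); [exact Hf|apply Sq, Hw].
- intros w Hw; apply (hol_C1 U); [exact HU|exact Hf|apply Sq, Hw].
- exists (f1 z); apply H1, square_Cmod. rewrite Cmod_sub_diag; lra.
Qed.

Lemma hol_derive_n U f n : Copen U -> hol U f -> hol U (C_derive_n f n).
Proof. intros HU Hf; induction n as [|n IH]; [exact Hf|apply hol_hol_derive; assumption]. Qed.

Lemma cauchy_formula U f z0 R0 r z : Copen U -> hol U f -> (forall w, square z0 R0 w -> U w) ->
  0 < r < R0 -> Cmod (z - z0) < r ->
  is_CInt (fun t => f (circ z0 r t) * dcirc r t / (circ z0 r t - z))%C 0 (2 * PI) (2 * PI * Ci * f z)%C.
Proof.
intros HU Hf Sq Hr Hz. apply (cauchy_formula_C1 f (C_derive f) z0 R0); try assumption.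
- intros w Hw; apply (hol_derive U); [exact Hf|apply Sq, Hw].
- intros w Hw; apply (hol_C1 U); [exact HU|exact Hf|apply Sq, Hw].
Qed.

(** The value at z is the mean over large circles centered at z. *)
Theorem liouville_vanish H : hol (fun _ => True) H ->
  (forall e, 0 < e -> exists r, forall z, r < Cmod z -> Cmod (H z) <= e) ->
  forall z, H z = RtoC 0.
Proof.
intros HH Hlim z. pose proof PI_RGT_0. apply Cmod_eq_0.
destruct (Rle_lt_or_eq_dec 0 _ (Cmod_ge_0 (H z))) as [Hp|E]; [exfalso|auto].
assert (He : 0 < Cmod (H z) / 2) by lra.
destruct (Hlim _ He) as [r0 Hr0].
set (r := Rmax r0 0 + Cmod z + 1).
assert (Hr : 0 < r /\ r0 + Cmod z < r).
{ unfold r; pose proof (Rmax_l r0 0); pose proof (Rmax_r r0 0); pose proof (Cmod_ge_0 z); lra. }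
assert (Hz : Cmod (z - z) < r) by (rewrite Cmod_sub_diag; lra).
pose proof (cauchy_formula (fun _ => True) H z (r + 1) r z (fun _ _ => filter_forall _ (fun _ => I)) HH
  (fun _ _ => I) ltac:(lra) Hz) as CF.
assert (B : Cmod (2 * PI * Ci * H z) <= Rabs (2 * PI - 0) * (Cmod (H z) / 2)).
{ eapply is_CInt_bound; [|exact CF]. intros t _; cbv beta.
  assert (Ec : Cmod (circ z r t - z) = r) by (apply Cmod_circ; lra).
  rewrite Cmod_div by (apply circ_neq; lra).
  rewrite Cmod_mult, Cmod_dcirc, Ec by lra.
  replace (Cmod (H (circ z r t)) * r / r) with (Cmod (H (circ z r t))) by (field; lra).
  apply Hr0. assert (T := Cmod_triangle (circ z r t) (- z)).
  fold (circ z r t - z)%C in T. rewrite Ec, Cmod_opp in T. lra. }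
rewrite !Cmod_mult, Cmod_Ci, !Cmod_R, Rminus_0_r, !Rabs_right in B by lra.
nra.
Qed.

(** * The Cauchy theorem for a closed path in an open set, after Dixon *)

Lemma ccont_bounded (f : R -> C) a b : a <= b ->
  (forall s, a <= s <= b -> ccontR f s) ->
  exists M, 0 <= M /\ forall s, a <= s <= b -> Cmod (f s) <= M.
Proof.
intros Hab Hf.
destruct (continuity_ab_maj (fun s => Cmod (f s)) a b Hab) as [m [Hm Hm']].
- intros s Hs. apply continuity_pt_filterlim. apply (ccont_Cmod (T := RU)), Hf, Hs.
- exists (Cmod (f m)); split; [apply Cmod_ge_0|exact Hm].
Qed.

(** The integral is at most a constant over the distance from z to the path. *)
Lemma cauchy_type_decay (g psi : R -> C) a b : a <= b ->
  (forall s, a <= s <= b -> ccontR g s) ->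
  (forall s, a <= s <= b -> ccontR psi s) ->
  forall e, 0 < e -> exists r, forall z, r < Cmod z ->
    (forall s, a <= s <= b -> g s <> z) /\ Cmod (CInt (fun s => psi s / (g s - z))%C a b) <= e.
Proof.
intros Hab Cg Cpsi e He.
destruct (ccont_bounded g a b Hab Cg) as [N [HN Bg]].
destruct (ccont_bounded psi a b Hab Cpsi) as [M [HM Bp]].
exists (N + (b - a) * M / e + 1). intros z Hz.
assert (P0 : 0 <= (b - a) * M / e).
{ apply Rdiv_le_0_compat; [apply Rmult_le_pos; lra|exact He]. }
assert (Low : forall s, a <= s <= b -> (b - a) * M / e + 1 <= Cmod (g s - z)).
{ intros s Hs. assert (T := Cmod_triangle (g s - z) (- g s)).
  replace (g s - z + - g s)%C with (- z)%C in T by ring. rewrite !Cmod_opp in T.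
  pose proof (Bg s Hs). lra. }
assert (Off : forall s, a <= s <= b -> (g s - z)%C <> RtoC 0).
{ intros s Hs E. pose proof (Low s Hs) as L. rewrite E, Cmod_0 in L. lra. }
split.
- intros s Hs E. apply (Off s Hs). rewrite E; ring.
- apply Rle_trans with (Rabs (b - a) * (M / ((b - a) * M / e + 1))).
  + eapply is_CInt_bound with (f := fun s => (psi s / (g s - z))%C).
    * intros s Hs; apply between_le in Hs; [|exact Hab]. rewrite Cmod_div by (apply Off, Hs).
      apply Rmult_le_compat; [apply Cmod_ge_0| |apply Bp, Hs|].
      -- left; apply Rinv_0_lt_compat. pose proof (Low s Hs); lra.
      -- apply Rinv_le_contravar; [lra|apply Low, Hs].
    * apply is_CInt_cauchy_type; auto. intros s Hs E. apply (Off s Hs). rewrite E; ring.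
  + rewrite Rabs_right by lra.
    replace ((b - a) * (M / ((b - a) * M / e + 1))) with ((b - a) * M / ((b - a) * M / e + 1)) by (unfold Rdiv; ring).
    apply Rle_div_l; [lra|].
    replace (e * ((b - a) * M / e + 1)) with ((b - a) * M + e) by (field; lra). lra.
Qed.

Definition winding (g dg : R -> C) a b (z : C) : C := CInt (fun s => dg s / (g s - z))%C a b.

Section Winding.
Variables (g dg : R -> C) (a b : R).
Hypothesis (Hcl : closed_path g dg a b).

Lemma closed_path_cont s : a <= s <= b -> ccontR g s.
Proof. intros Hs. exact (Rderiv_cont _ _ _ (proj1 (proj2 Hcl) s Hs)). Qed.

Lemma winding_locally_constant z : (forall s, a <= s <= b -> g s <> z) ->
  locally (T := CU) z (fun w => (forall s, a <= s <= b -> g s <> w) /\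
    winding g dg a b w = winding g dg a b z).
Proof.
intros Hz. pose proof (off_path_open g a b z closed_path_cont Hz) as L.
apply locally_Cmod in L as [d [Hd L]]. apply locally_Cmod; exists d; split; [exact Hd|].
intros w Hw. split.
- intros s Hs E. apply (L w Hw s Hs). rewrite E; ring.
- symmetry. apply winding_segment; [exact Hcl|]. intros s u Hs Hu E.
  apply (L (z + RtoC u * (w - z))%C) with s; [|exact Hs|rewrite E; ring].
  replace (z + RtoC u * (w - z) - z)%C with (RtoC u * (w - z))%C by ring.
  rewrite Cmod_mult, Cmod_R, Rabs_right by lra. pose proof (Cmod_ge_0 (w - z)). nra.
Qed.

(** The winding integral is constant along the outgoing ray of z, and tends to 0. *)
Lemma winding_far : exists r, forall z, r < Cmod z ->
  (forall s, a <= s <= b -> g s <> z) /\ winding g dg a b z = RtoC 0.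
Proof.
destruct Hcl as (Hab & _ & Cdg & _).
destruct (ccont_bounded g a b Hab closed_path_cont) as [N [HN Bg]].
exists N; intros z Hz. split.
{ intros s Hs E. pose proof (Bg s Hs). rewrite E in H. lra. }
apply Cmod_eq_0. destruct (Rle_lt_or_eq_dec 0 _ (Cmod_ge_0 (winding g dg a b z))) as [Hp|E]; [exfalso|auto].
destruct (cauchy_type_decay g dg a b Hab closed_path_cont Cdg (Cmod (winding g dg a b z) / 2)) as [r Hr]; [lra|].
(* the factor m moves z along its ray beyond the radius r *)
set (m := 1 + Rabs r / Cmod z).
assert (Hm : 1 <= m).
{ unfold m. pose proof (Rdiv_le_0_compat (Rabs r) (Cmod z) (Rabs_pos r)). lra. }
destruct (Hr (RtoC m * z)%C) as [_ B].
{ rewrite Cmod_mult, Cmod_R, Rabs_right by lra. unfold m.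
  replace ((1 + Rabs r / Cmod z) * Cmod z) with (Cmod z + Rabs r) by (field; lra).
  pose proof (Rle_abs r). lra. }
rewrite <- (winding_segment g dg a b z (RtoC m * z) Hcl) in B.
- fold (winding g dg a b z) in B. lra.
- intros s u Hs Hu E.
  pose proof (Bg s Hs) as B1. rewrite E in B1.
  replace (z + RtoC u * (RtoC m * z - z))%C with (RtoC (1 + u * (m - 1)) * z)%C in B1
    by (rewrite RtoC_plus, RtoC_mult, RtoC_minus; ring).
  assert (1 <= 1 + u * (m - 1)) by nra.
  rewrite Cmod_mult, Cmod_R, Rabs_right in B1 by lra. nra.
Qed.
End Winding.

(** The difference quotient of f, continued to the diagonal by the derivative; where
    f is holomorphic, it is continuous in both variables and holomorphic in z. *)
Definition slope (f : C -> C) (t z : C) : C :=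
  if Ceq_dec t z then C_derive f z else ((f t - f z) / (t - z))%C.

Lemma slope_neq f t z : t <> z -> slope f t z = ((f t - f z) / (t - z))%C.
Proof. unfold slope; destruct (Ceq_dec t z); congruence. Qed.

Lemma slope_eq f z : slope f z z = C_derive f z.
Proof. unfold slope; destruct (Ceq_dec z z); congruence. Qed.

Lemma slope_mult f t z : (f t - f z)%C = (slope f t z * (t - z))%C.
Proof.
unfold slope; destruct (Ceq_dec t z) as [->|Hn]; [ring|]. field. apply Cminus_neq0, Hn.
Qed.

Section Quotient.
Variables (U : C -> Prop) (f : C -> C).
Hypotheses (HU : Copen U) (Hf : hol U f).

Lemma segment_FTC z0 r z w : (forall x, square z0 r x -> U x) -> square z0 r z -> square z0 r w ->
  is_CInt (fun u => C_derive f (z + RtoC u * (w - z)) * (w - z))%C 0 1 (f w - f z)%C.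
Proof.
intros Sq Hz Hw.
replace (f w - f z)%C with (f (z + RtoC 1 * (w - z)) - f (z + RtoC 0 * (w - z)))%C
  by (f_equal; f_equal; f_equal; ring).
assert (In : forall u, Rmin 0 1 <= u <= Rmax 0 1 -> U (z + RtoC u * (w - z))%C).
{ intros u Hu. apply between_le in Hu; [|lra]. apply Sq, square_segment; assumption. }
apply (is_CInt_FTC (fun u => f (z + RtoC u * (w - z)))%C).
- intros u Hu. apply (Rderiv_comp f (fun u => z + RtoC u * (w - z))%C); [apply Rderiv_affine|].
  apply (hol_derive U); auto.
- intros u Hu. apply ccont_mult; [|apply ccont_const].
  apply (ccont_comp (T := RU) (C_derive f) (fun u => z + RtoC u * (w - z))%C).
  + exact (Rderiv_cont _ _ _ (Rderiv_affine _ _ _)).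
  + apply (hol_C1 U); auto.
Qed.

(** Near the diagonal the quotient is a mean of the derivative over a segment. *)
Lemma slope_cont t0 z0 : U t0 -> U z0 ->
  ccont (T := prod_UniformSpace CU CU)
    (fun p => slope f (fst p) (snd p)) (t0, z0).
Proof.
intros Ht Hz.
assert (Cf : forall z, U z -> ccontC f z)
  by (intros z Uz; exact (Cderiv_cont _ _ _ (hol_derive U f Hf z Uz))).
destruct (Ceq_dec t0 z0) as [->|Hn].
- apply ccont_eps; intros e He. cbn [fst snd]; rewrite slope_eq.
  assert (He2 : 0 < e / 2) by lra.
  destruct (filter_and _ _ (HU z0 Hz)
    (proj1 (ccont_eps _ _) (hol_C1 U f HU Hf z0 Hz) _ He2)) as [d Hd].
  assert (Sq : forall x, square z0 d x -> U x /\ Cmod (C_derive f x - C_derive f z0) < e / 2)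
    by (intros x [X1 X2]; apply Hd; split; assumption).
  exists d; intros [t z] [[B1 B2] [B3 B4]]; cbn [fst snd] in *.
  assert (St : square z0 d t) by (split; assumption).
  assert (Sz : square z0 d z) by (split; assumption).
  destruct (Ceq_dec t z) as [->|Hn].
  + rewrite slope_eq. destruct (Sq z Sz); lra.
  + pose proof (Cmod_pos _ (Cminus_neq0 _ _ Hn)) as Hp.
    apply Rle_lt_trans with (e / 2); [|lra].
    apply Rmult_le_reg_r with (1 := Hp).
    rewrite <- Cmod_mult.
    replace ((slope f t z - C_derive f z0) * (t - z))%C
      with (f t - f z - (RtoC 1 - RtoC 0) * (C_derive f z0 * (t - z)))%C
      by (rewrite slope_mult; ring).
    replace (e / 2 * Cmod (t - z)) with (Rabs (1 - 0) * (e / 2 * Cmod (t - z)))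
      by (rewrite Rabs_right by lra; ring).
    apply is_CInt_bound with (fun u => C_derive f (z + RtoC u * (t - z)) * (t - z) - C_derive f z0 * (t - z))%C.
    * intros u Hu; apply between_le in Hu; [|lra].
      match goal with |- Cmod ?x <= _ =>
        replace x with ((C_derive f (z + RtoC u * (t - z)) - C_derive f z0) * (t - z))%C by ring end.
      rewrite Cmod_mult. apply Rmult_le_compat_r; [lra|].
      left; apply Sq, square_segment; assumption.
    * apply is_CInt_minus; [|apply is_CInt_const].
      apply (segment_FTC z0 d); auto. intros x Hx; apply Sq, Hx.
- apply (ccont_ext_loc (T := prod_UniformSpace CU CU)
    (fun p => (f (fst p) - f (snd p)) / (fst p - snd p))%C).
  + assert (Cs : ccont (T := prod_UniformSpace CU CU)
      (fun p => fst p - snd p)%C (t0, z0)).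
    { apply ccont_minus; [apply (ccont_of_fst (fun w => w))
      |apply (ccont_of_snd (fun w => w))]; apply ccont_id. }
    generalize (proj1 (ccont_eps _ _) Cs _ (Cmod_pos _ (Cminus_neq0 _ _ Hn))); apply filter_imp.
    intros [t z] H; cbn [fst snd] in *. symmetry; apply slope_neq; intros ->.
    replace (z - z - (t0 - z0))%C with (- (t0 - z0))%C in H by ring. rewrite Cmod_opp in H. lra.
  + apply ccont_div; cbn [fst snd]; [apply Cminus_neq0, Hn| |]; apply ccont_minus.
    * apply (ccont_of_fst), Cf, Ht.
    * apply (ccont_of_snd), Cf, Hz.
    * apply (ccont_of_fst (fun w => w)), ccont_id.
    * apply (ccont_of_snd (fun w => w)), ccont_id.
Qed.

(** On the diagonal this is the second order expansion of f, obtained by integrating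
    the first order expansion of its derivative along a segment. *)
Lemma slope_hol t : U t -> hol U (slope f t).
Proof.
intros Ht z Hz. destruct (Ceq_dec t z) as [<-|Hn].
- destruct (hol_hol_derive U f HU Hf t Ht) as [l Hl].
  exists (l * / 2)%C. apply Cderiv_eps; intros e He. rewrite slope_eq.
  destruct (filter_and _ _ (HU t Ht) (proj1 (Cderiv_eps _ _ _) Hl e He)) as [d Hd].
  assert (Sq : forall x, square t d x -> U x /\
    Cmod (C_derive f x - C_derive f t - (x - t) * l) <= e * Cmod (x - t))
    by (intros x [X1 X2]; apply Hd; split; assumption).
  assert (St : square t d t).
  { apply square_Cmod. rewrite Cmod_sub_diag; apply cond_pos. }
  exists d; intros w [W1 W2]. assert (Sw : square t d w) by (split; assumption).
  destruct (Ceq_dec w t) as [->|Hn].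
  + rewrite slope_eq. match goal with |- Cmod ?x <= _ => replace x with (RtoC 0) by ring end.
    rewrite Cmod_0. apply Rmult_le_pos; [lra|apply Cmod_ge_0].
  + pose proof (Cmod_pos _ (Cminus_neq0 _ _ Hn)) as Hp.
    apply Rmult_le_reg_r with (1 := Hp).
    rewrite <- Cmod_mult.
    replace ((slope f t w - C_derive f t - (w - t) * (l * / 2)) * (w - t))%C
      with (f w - f t - ((RtoC 1 - RtoC 0) * (C_derive f t * (w - t))
         + (l * / 2 * (w - t) * (w - t)) * (RtoC 1 * RtoC 1 - RtoC 0 * RtoC 0)))%C.
    2: { replace (f w - f t)%C with (- (f t - f w))%C by ring. rewrite (slope_mult f t w). ring. }
    replace (e * Cmod (w - t) * Cmod (w - t)) with (Rabs (1 - 0) * (e * Cmod (w - t) * Cmod (w - t)))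
      by (rewrite Rabs_right by lra; ring).
    apply is_CInt_bound with (fun u => C_derive f (t + RtoC u * (w - t)) * (w - t)
       - (C_derive f t * (w - t) + (l * / 2 * (w - t) * (w - t)) * (RtoC u + RtoC u)))%C.
    * intros u Hu; apply between_le in Hu; [|lra].
      match goal with |- Cmod ?x <= _ =>
        replace x with ((C_derive f (t + RtoC u * (w - t)) - C_derive f t
          - (t + RtoC u * (w - t) - t) * l) * (w - t))%C end.
      2: { field. }
      rewrite Cmod_mult. apply Rmult_le_compat_r; [lra|].
      eapply Rle_trans; [apply Sq, square_segment; assumption|].
      apply Rmult_le_compat_l; [lra|].
      replace (t + RtoC u * (w - t) - t)%C with (RtoC u * (w - t))%C by ring.
      rewrite Cmod_mult, Cmod_R, Rabs_right by lra. nra.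
    * apply is_CInt_minus.
      -- apply (segment_FTC t d); auto. intros x Hx; apply Sq, Hx.
      -- apply is_CInt_plus; [apply is_CInt_const|]. apply is_CInt_scal.
         apply (is_CInt_FTC (fun u => RtoC u * RtoC u)%C).
         ++ intros u _. apply Rderiv_slope; exists (fun v => RtoC v + RtoC u)%C; split.
            { apply ccont_plus; [apply ccont_RtoC_id|apply ccont_const]. }
            split; [reflexivity|intros; ring].
         ++ intros u _. apply ccont_plus; apply ccont_RtoC_id.
- exists ((RtoC 0 - C_derive f z) * / (t - z) + (f t - f z) * (- (RtoC 0 - RtoC 1) / ((t - z) * (t - z))))%C.
  apply (Cderiv_ext_loc (fun z => (f t - f z) * / (t - z))%C).
  + pose proof (Cmod_pos _ (Cminus_neq0 _ _ Hn)) as Hp.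
    apply locally_Cmod; exists (Cmod (t - z)); split; [exact Hp|]. intros w Hw.
    symmetry; apply slope_neq; intros <-. lra.
  + apply (Cderiv_mult (fun z => f t - f z)%C (fun z => / (t - z))%C).
    * apply Cderiv_minus; [apply Cderiv_const|apply (hol_derive U); assumption].
    * apply (Cderiv_inv (fun z => t - z)%C); [apply Cminus_neq0, Hn|].
      apply Cderiv_minus; [apply Cderiv_const|apply Cderiv_id].
Qed.
End Quotient.

Lemma cauchy_estimate U f z R0 r M : Copen U -> hol U f -> (forall w, square z R0 w -> U w) ->
  0 < r < R0 -> (forall t, Cmod (f (circ z r t)) <= M) -> Cmod (C_derive f z) <= M / r.
Proof.
intros HU Hf Sq Hr HM. pose proof PI_RGT_0.
set (psi := fun t => (f (circ z r t) * dcirc r t)%C).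
assert (Cc : forall t, ccontR (circ z r) t) by (intros; exact (Rderiv_cont _ _ _ (Rderiv_circ _ _ _))).
assert (near : forall t, Cmod (circ z r t - z) < R0) by (intros; rewrite Cmod_circ; lra).
assert (Cpsi : forall t, ccontR psi t).
{ intros t. apply ccont_mult; [|apply ccont_dcirc]. apply ccont_comp; [apply Cc|].
  apply (Cderiv_cont _ _ _ (hol_derive U f Hf _ (Sq _ (square_Cmod _ _ _ (near t))))). }
assert (Hz : Cmod (z - z) < r) by (rewrite Cmod_sub_diag; lra).
assert (E : C_derive f z = (/ (2 * PI * Ci) * CInt (fun t => psi t / ((circ z r t - z) * (circ z r t - z)))%C 0 (2 * PI))%C).
{ apply is_C_derive_unique.
  apply (Cderiv_ext_loc (fun w => / (2 * PI * Ci) * CInt (fun t => psi t / (circ z r t - w))%C 0 (2 * PI))%C).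
  - apply locally_Cmod; exists r; split; [lra|]. intros w Hw.
    pose proof (is_CInt_unique _ _ _ _ (cauchy_formula U f z R0 r w HU Hf Sq Hr Hw)) as E.
    unfold psi; rewrite E. field. split; [apply Ci_nz|apply PI_C_neq0].
  - apply Cderiv_scal, cauchy_type_derive; auto; [lra|].
    intros s _ E. apply (circ_neq z r z s); try lra. rewrite E; ring. }
assert (B : Cmod (CInt (fun t => psi t / ((circ z r t - z) * (circ z r t - z)))%C 0 (2 * PI)) <= Rabs (2 * PI - 0) * (M / r)).
{ assert (Hn : forall t, (circ z r t - z)%C <> RtoC 0) by (intros; apply circ_neq; lra).
  eapply is_CInt_bound with (f := fun t => (psi t / ((circ z r t - z) * (circ z r t - z)))%C).
  - intros t _. rewrite Cmod_div by (apply Cmult_neq_0; apply Hn).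
    unfold psi; rewrite !Cmod_mult, Cmod_dcirc, Cmod_circ by lra.
    replace (Cmod (f (circ z r t)) * r / (r * r)) with (Cmod (f (circ z r t)) / r) by (field; lra).
    apply Rmult_le_compat_r; [left; apply Rinv_0_lt_compat; lra|apply HM].
  - apply is_CInt_cont; intros t _. apply ccont_div; [apply Cmult_neq_0; apply Hn|apply Cpsi|].
    apply ccont_mult; (apply ccont_minus; [apply Cc|apply ccont_const]). }
rewrite E, Cmod_mult, Cmod_inv by apply two_pi_i_neq.
rewrite !Cmod_mult, Cmod_Ci, !Cmod_R, !Rabs_right by lra.
rewrite Rminus_0_r, Rabs_right in B by lra.
apply Rmult_le_reg_l with (2 * PI * 1); [lra|]. rewrite <- Rmult_assoc, Rinv_r, Rmult_1_l by lra.
lra.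
Qed.

Section Dixon.
Variables (g dg : R -> C) (a b : R) (U : C -> Prop) (f : C -> C) (kappa : C).
Hypothesis (Hcl : closed_path g dg a b).
Hypotheses (HU : Copen U) (Hf : hol U f).
Hypothesis (HgU : forall s, a <= s <= b -> U (g s)).
Hypothesis (Hwind : forall z, ~ U z -> winding g dg a b z = kappa).
Hypothesis (Hdecay : forall e, 0 < e -> exists r, forall z, U z -> r < Cmod z -> Cmod (kappa * f z) <= e).

Let K (z : C) : C := CInt (fun s => slope f (g s) z * dg s)%C a b.
Let Cau (z : C) : C := CInt (fun s => f (g s) * dg s / (g s - z))%C a b.

Lemma path_ordered : a <= b. Proof. exact (proj1 Hcl). Qed.

Lemma ccont_density s : a <= s <= b -> ccontR (fun s => f (g s) * dg s)%C s.
Proof.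
intros Hs. apply ccont_mult; [|apply Hcl, Hs].
apply ccont_comp; [apply (closed_path_cont g dg a b Hcl), Hs|].
exact (Cderiv_cont _ _ _ (hol_derive U f Hf _ (HgU s Hs))).
Qed.

Lemma slope_integrand_cont2 {T : UniformSpace} (p : T -> C) s x : a <= s <= b ->
  ccont p x -> U (p x) -> ccont2 (fun s x => slope f (g s) (p x) * dg s)%C s x.
Proof.
intros Hs Hp Ux. apply ccont_mult; [|apply (ccont_of_fst (T := RU)), Hcl, Hs].
apply (continuous_comp_2 (U := prod_UniformSpace RU T) (V := CU)
  (W := CU) (X := CU) (fun q => g (fst q)) (fun q => p (snd q)) (slope f)).
- apply (ccont_of_fst (T := RU) g), (closed_path_cont g dg a b Hcl), Hs.
- apply (ccont_of_snd (T := RU) p), Hp.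
- cbn [fst snd]. apply (slope_cont U f HU Hf); [apply HgU, Hs|exact Ux].
Qed.

Lemma is_CInt_K z : U z -> is_CInt (fun s => slope f (g s) z * dg s)%C a b (K z).
Proof.
intros Hz. apply is_CInt_cont; intros s Hs; apply between_le in Hs; [|exact path_ordered].
apply (ccont2_l (T := CU) (fun s z => slope f (g s) z * dg s)%C s z).
apply (slope_integrand_cont2 (T := CU) (fun z => z)); [exact Hs|apply ccont_id|exact Hz].
Qed.

(** Away from the path both terms of the quotient are continuous, so its integral splits. *)
Lemma K_off_path z : U z -> (forall s, a <= s <= b -> g s <> z) ->
  K z = (Cau z - f z * winding g dg a b z)%C.
Proof.
intros Hz Hoff.
refine (is_CInt_unique _ _ _ _ _).
apply is_CInt_ext with (fun s => f (g s) * dg s / (g s - z) - f z * (dg s / (g s - z)))%C.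
- intros s Hs. assert (Hs' : a <= s <= b) by (apply between_le; [exact path_ordered|lra]).
  rewrite slope_neq by (apply Hoff, Hs'). field. apply Cminus_neq0, Hoff, Hs'.
- pose proof (closed_path_cont g dg a b Hcl). pose proof ccont_density.
  apply is_CInt_minus; [|apply is_CInt_scal]; apply (is_CInt_cauchy_type g); auto; apply Hcl.
Qed.

(** Represent each slope f (g s) by its Cauchy formula on a circle around z0 and
    exchange the integrals: K is then a Cauchy integral over that circle. *)
Lemma K_hol z0 : U z0 -> exists l, Cderiv K z0 l.
Proof.
intros Hz0. pose proof PI_RGT_0.
destruct (Copen_square U z0 HU Hz0) as [R0 [HR Sq]].
set (r := R0 / 2). assert (Hr : 0 < r < R0) by (unfold r; lra).
assert (Uc : forall t, U (circ z0 r t)).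
{ intros t. apply Sq, square_Cmod. rewrite Cmod_circ; lra. }
assert (Cc : forall t, ccontR (circ z0 r) t)
  by (intros; exact (Rderiv_cont _ _ _ (Rderiv_circ _ _ _))).
set (psi := fun t => (K (circ z0 r t) * dcirc r t)%C).
assert (Cpsi : forall t, ccontR psi t).
{ intros t. apply ccont_mult; [|apply ccont_dcirc].
  apply (ccont_CInt_param (T := RU) (fun s t => slope f (g s) (circ z0 r t) * dg s)%C).
  - intros s Hs; apply between_le in Hs; [|exact path_ordered].
    apply (slope_integrand_cont2 (T := RU)); auto.
  - apply filter_forall; intros t'. eexists; apply is_CInt_K, Uc. }
assert (Hoff : forall s, 0 <= s <= 2 * PI -> circ z0 r s <> z0).
{ intros s _ E. apply (circ_neq z0 r z0 s); [lra| |rewrite E; ring].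
  rewrite Cmod_sub_diag; lra. }
eexists.
apply (Cderiv_ext_loc (fun z => / (2 * PI * Ci) * CInt (fun t => psi t / (circ z0 r t - z))%C 0 (2 * PI))%C);
  [|apply Cderiv_scal, cauchy_type_derive; auto; lra].
apply locally_Cmod; exists r; split; [lra|]. intros z Hz.
assert (Uz : U z) by (apply Sq, square_Cmod; lra).
set (k := fun s t => (slope f (g s) (circ z0 r t) * dg s * dcirc r t / (circ z0 r t - z))%C).
assert (Fu : is_CInt (fun s => CInt (k s) 0 (2 * PI)) a b (CInt (fun t => CInt (fun s => k s t) a b) 0 (2 * PI))).
{ apply fubini; [exact path_ordered|lra|]. intros s t Hs Ht. apply ccont_div.
  - apply circ_neq; lra.
  - apply ccont_mult; [apply (slope_integrand_cont2 (T := RU)); auto|].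
    apply (ccont_of_snd), ccont_dcirc.
  - apply ccont_minus; [|apply ccont_const].
    apply (ccont_of_snd), Cc. }
assert (E2 : (2 * PI * Ci * K z)%C = CInt (fun t => psi t / (circ z0 r t - z))%C 0 (2 * PI)).
{ assert (E1 : is_CInt (fun s => CInt (k s) 0 (2 * PI)) a b (2 * PI * Ci * K z)%C).
  { apply is_CInt_ext with (fun s => 2 * PI * Ci * (slope f (g s) z * dg s))%C.
    - intros s Hs. assert (Hs' : a <= s <= b) by (apply between_le; [exact path_ordered|lra]).
      symmetry. refine (is_CInt_unique _ _ _ _ _).
      pose proof (cauchy_formula U (slope f (g s)) z0 R0 r z HU (slope_hol U f HU Hf _ (HgU s Hs')) Sq Hr Hz) as CF.
      apply (is_CInt_scal (dg s)) in CF.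
      replace (2 * PI * Ci * (slope f (g s) z * dg s))%C with (dg s * (2 * PI * Ci * slope f (g s) z))%C by ring.
      eapply is_CInt_ext; [|exact CF]. intros t _. unfold k; cbv beta. field. apply circ_neq; lra.
    - apply is_CInt_scal, is_CInt_K, Uz. }
  rewrite <- (is_CInt_unique _ _ _ _ E1), (is_CInt_unique _ _ _ _ Fu).
  apply CInt_ext; intros t _. unfold psi.
  replace (K (circ z0 r t) * dcirc r t / (circ z0 r t - z))%C
    with (dcirc r t / (circ z0 r t - z) * K (circ z0 r t))%C by (field; apply circ_neq; lra).
  apply is_CInt_unique.
  apply is_CInt_ext with (fun s => dcirc r t / (circ z0 r t - z) * (slope f (g s) (circ z0 r t) * dg s))%C.
  - intros s _. unfold k. field. apply circ_neq; lra.
  - apply is_CInt_scal, is_CInt_K, Uc. }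
rewrite <- E2. field. split; [apply Ci_nz|apply PI_C_neq0].
Qed.

Let glued (z : C) : C :=
  if excluded_middle_informative (U z) then (K z + kappa * f z)%C else Cau z.

Lemma glued_in z : U z -> glued z = (K z + kappa * f z)%C.
Proof. unfold glued; destruct (excluded_middle_informative (U z)); tauto. Qed.

Lemma glued_off z : (forall s, a <= s <= b -> g s <> z) -> winding g dg a b z = kappa -> glued z = Cau z.
Proof.
intros Hoff E. unfold glued; destruct (excluded_middle_informative (U z)) as [Uz|]; [|reflexivity].
rewrite K_off_path, E by assumption. ring.
Qed.

(** Near a point off U the winding integral is still kappa, so that both formulas agree
    where they meet. *)
Lemma glued_entire : hol (fun _ => True) glued.
Proof.
intros z _. destruct (classic (U z)) as [Uz|Uz].
- destruct (K_hol z Uz) as [l Hl]. exists (l + kappa * C_derive f z)%C.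
  apply (Cderiv_ext_loc (fun z => K z + kappa * f z)%C).
  + generalize (HU z Uz); apply filter_imp; intros w Uw; symmetry; apply glued_in, Uw.
  + apply Cderiv_plus; [exact Hl|]. apply Cderiv_scal, (hol_derive U); assumption.
- assert (Hoff : forall s, a <= s <= b -> g s <> z) by (intros s Hs E; apply Uz; rewrite <- E; auto).
  eexists. apply (Cderiv_ext_loc Cau).
  + generalize (winding_locally_constant g dg a b Hcl z Hoff); apply filter_imp.
    intros w [W1 W2]. symmetry; apply glued_off; [exact W1|]. rewrite W2; auto.
  + apply (cauchy_type_derive g (fun s => f (g s) * dg s)%C); auto.
    * exact path_ordered.
    * apply (closed_path_cont g dg a b Hcl).
    * apply ccont_density.
Qed.

Lemma glued_decay : forall e, 0 < e -> exists r, forall z, r < Cmod z -> Cmod (glued z) <= e.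
Proof.
intros e He. assert (He2 : 0 < e / 2) by lra.
destruct (Hdecay _ He2) as [r1 H1].
destruct (winding_far g dg a b Hcl) as [r2 H2].
destruct (cauchy_type_decay g (fun s => f (g s) * dg s)%C a b path_ordered (closed_path_cont g dg a b Hcl) ccont_density _ He2)
  as [r3 H3].
exists (Rmax r1 (Rmax r2 r3)). intros z Hz.
pose proof (Rmax_l r1 (Rmax r2 r3)). pose proof (Rmax_r r1 (Rmax r2 r3)).
pose proof (Rmax_l r2 r3). pose proof (Rmax_r r2 r3).
destruct (H2 z) as [Hoff W0]; [lra|]. destruct (H3 z) as [_ B3]; [lra|].
unfold glued; destruct (excluded_middle_informative (U z)) as [Uz|Uz].
- rewrite K_off_path, W0 by assumption.
  replace (Cau z - f z * RtoC 0 + kappa * f z)%C with (Cau z + kappa * f z)%C by ring.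
  eapply Rle_trans; [apply Cmod_triangle|]. pose proof (H1 z Uz ltac:(lra)). unfold Cau. lra.
- unfold Cau; lra.
Qed.

(** The glued function is entire and decays, hence it is 0. *)
Theorem dixon z : U z -> CInt (fun s => slope f (g s) z * dg s)%C a b = (- (kappa * f z))%C.
Proof.
intros Uz. fold (K z).
pose proof (liouville_vanish glued glued_entire glued_decay z) as E. rewrite glued_in in E by exact Uz.
replace (K z) with (K z + kappa * f z - kappa * f z)%C by ring. rewrite E. ring.
Qed.
End Dixon.

(** * Geometry of a simple closed curve *)

Section Curve.
Variable c : closed_curve.
Notation v := (velocity c).
Notation T := (period c).

Lemma curve_derive s : Rderiv c s (v s).
Proof. apply param_derive. Qed.

Lemma curve_cont s : ccontR c s.
Proof. exact (Rderiv_cont _ _ _ (curve_derive s)). Qed.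

Lemma velocity_cont s : ccontR v s.
Proof. apply velocity_continuous. Qed.

Lemma velocity_periodic s : v (s + T) = v s.
Proof.
apply (Rderiv_unique c s); [|apply curve_derive].
replace (param c) with (fun t => c (t + T)) by (apply FunctionalExtensionality.functional_extensionality; apply param_periodic).
apply Rderiv_shift, curve_derive.
Qed.

Lemma periodic_nat {A} (f : R -> A) : (forall s, f (s + T) = f s) -> forall n s, f (s + INR n * T) = f s.
Proof.
intros Hf; induction n as [|n IH]; intros s.
- simpl. replace (s + 0 * T) with s by ring. reflexivity.
- rewrite S_INR. replace (s + (INR n + 1) * T) with (s + INR n * T + T) by ring. rewrite Hf; apply IH.
Qed.

Lemma periodic_Z {A} (f : R -> A) : (forall s, f (s + T) = f s) -> forall k s, f (s + IZR k * T) = f s.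
Proof.
intros Hf k s. destruct (Z_le_gt_dec 0 k) as [Hk|Hk].
- rewrite <- (Z2Nat.id k) by exact Hk. rewrite <- INR_IZR_INZ. apply periodic_nat, Hf.
- rewrite <- (periodic_nat f Hf (Z.to_nat (- k)) (s + IZR k * T)).
  rewrite INR_IZR_INZ, Z2Nat.id by lia. rewrite opp_IZR. f_equal; ring.
Qed.

Lemma reduce_mod a s : exists k : Z, a <= s + IZR k * T < a + T.
Proof.
pose proof (period_pos c) as HT.
destruct (archimed ((s - a) / T)) as [A1 A2].
exists (- (up ((s - a) / T) - 1))%Z. rewrite opp_IZR, minus_IZR.
set (n := IZR (up ((s - a) / T))) in *.
assert (E : s = a + (s - a) / T * T) by (field; lra).
set (x := (s - a) / T) in *. rewrite E. split; nra.
Qed.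

Lemma curve_Z k s : c (s + IZR k * T) = c s.
Proof. apply periodic_Z, param_periodic. Qed.

Lemma velocity_Z k s : v (s + IZR k * T) = v s.
Proof. apply periodic_Z, velocity_periodic. Qed.

(** Two parameters of the same point differ by a multiple of the period. *)
Lemma curve_inj s t : Rabs (s - t) < T -> c s = c t -> s = t.
Proof.
intros Hst E. pose proof (period_pos c) as HT.
destruct (reduce_mod 0 s) as [k Hk]. destruct (reduce_mod 0 t) as [m Hm].
assert (E' : s + IZR k * T = t + IZR m * T).
{ apply param_simple with (c := c); try lra. rewrite !curve_Z; exact E. }
assert (Ez : s - t = IZR (m - k) * T) by (rewrite minus_IZR; lra).
assert (m - k = 0)%Z as Z0.
{ rewrite Ez, Rabs_mult, (Rabs_right T) in Hst by lra.
  assert (Rabs (IZR (m - k)) < 1) as H1 by nra.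
  rewrite <- abs_IZR in H1. apply lt_IZR in H1. lia. }
rewrite Z0 in Ez. lra.
Qed.

Lemma curve_closed s : closed_path c v s (s + T).
Proof.
pose proof (period_pos c). split; [lra|]. split; [intros; apply curve_derive|].
split; [intros; apply velocity_cont|]. symmetry; apply param_periodic.
Qed.

(** The difference quotients between two points near s0 are all close to the velocity
    at s0, since they are means of velocities. *)
Lemma strict_derive s0 e : 0 < e -> exists d, 0 < d /\
  (forall s, Rabs (s - s0) < d -> Cmod (v s - v s0) <= e) /\
  forall s s', Rabs (s - s0) < d -> Rabs (s' - s0) < d ->
    Cmod (c s' - c s - (RtoC s' - RtoC s) * v s0) <= e * Rabs (s' - s).
Proof.
intros He.
destruct (proj1 (locally_Rabs _ _) (proj1 (ccont_eps v s0) (velocity_cont s0) e He)) as [d [Hd H]].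
exists d; split; [exact Hd|]. split; [intros; left; auto|].
intros s s' Hs Hs'. rewrite Rmult_comm.
apply is_CInt_bound with (fun t => v t - v s0)%C.
- intros t Ht; left; apply H. exact (Rabs_between_lt _ _ _ _ _ Hs Hs' Ht).
- apply is_CInt_minus; [|apply is_CInt_const].
  apply is_CInt_FTC; [intros; apply curve_derive|intros t _; apply velocity_cont].
Qed.

(** The point at signed distance d |v s| to the left of c s. *)
Definition normal_pt (s d : R) : C := (c s + RtoC d * (Ci * v s))%C.

Lemma Cmod_i_minus (d u : R) : Rabs d <= Cmod (RtoC d * Ci - RtoC u) /\ Rabs u <= Cmod (RtoC d * Ci - RtoC u).
Proof.
split.
- pose proof (snd_le_Cmod (RtoC d * Ci - RtoC u)) as H; simpl in H.
  replace (d * 1 + 0 * 0 + - 0) with d in H by ring. exact H.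
- pose proof (fst_le_Cmod (RtoC d * Ci - RtoC u)) as H; simpl in H.
  replace (d * 0 - 0 * 1 + - u) with (- u) in H by ring. rewrite Rabs_Ropp in H. exact H.
Qed.

(** Near the diagonal u0 = 0 the chord c (s + u) - c s is nearly tangent and cannot be
    nearly normal; away from it the chord is bounded below. *)
Lemma normal_off_local s0 u0 : Rabs u0 < T -> exists e : posreal,
  forall s u d, Rabs (s - s0) < e -> Rabs (u - u0) < e -> 0 < Rabs d < e -> c (s + u) <> normal_pt s d.
Proof.
intros Hu0. pose proof (Cmod_pos _ (velocity_neq0 c s0)) as Hv.
destruct (Req_EM_T u0 0) as [->|Hn].
- destruct (strict_derive s0 (Cmod (v s0) / 8)) as [d0 [Hd0 [Dv Dc]]]; [lra|].
  assert (P : 0 < d0 / 2) by lra. exists (mkposreal _ P); simpl.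
  intros s u d Hs Hu [Hd1 Hd2] E. rewrite Rminus_0_r in Hu.
  assert (B := Dc s (s + u) ltac:(lra)).
  assert (Hsu : Rabs (s + u - s0) < d0).
  { replace (s + u - s0) with ((s - s0) + u) by ring. pose proof (Rabs_triang (s - s0) u). lra. }
  specialize (B Hsu). rewrite E in B. unfold normal_pt in B.
  replace (s + u - s) with u in B by ring.
  pose proof (Dv s ltac:(lra)) as B2.
  assert (B3 : Cmod ((RtoC d * Ci - RtoC u) * v s0) <= Cmod (v s0) / 8 * Rabs u + Rabs d * (Cmod (v s0) / 8)).
  { replace ((RtoC d * Ci - RtoC u) * v s0)%C
      with ((c s + RtoC d * (Ci * v s) - c s - (RtoC (s + u) - RtoC s) * v s0) + - (RtoC d * Ci * (v s - v s0)))%C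
      by (rewrite RtoC_plus; ring).
    eapply Rle_trans; [apply Cmod_triangle|]. apply Rplus_le_compat; [exact B|].
    rewrite Cmod_opp, !Cmod_mult, Cmod_Ci, Cmod_R, Rmult_1_r.
    apply Rmult_le_compat_l; [apply Rabs_pos|exact B2]. }
  rewrite Cmod_mult in B3. destruct (Cmod_i_minus d u) as [M1 M2]. pose proof (Rabs_pos u).
  nra.
- assert (Hne : c (s0 + u0) <> c s0).
  { intros E. apply curve_inj in E; [lra|]. replace (s0 + u0 - s0) with u0 by ring. exact Hu0. }
  pose proof (Cmod_pos _ (Cminus_neq0 _ _ Hne)) as HD. set (D := Cmod (c (s0 + u0) - c s0)) in *.
  assert (HD4 : 0 < D / 4) by lra.
  destruct (proj1 (locally_Rabs _ _) (proj1 (ccont_eps _ _) (curve_cont (s0 + u0)) _ HD4)) as [d1 [Hd1 H1]].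
  destruct (proj1 (locally_Rabs _ _) (proj1 (ccont_eps _ _) (curve_cont s0) _ HD4)) as [d2 [Hd2 H2]].
  destruct (proj1 (locally_Rabs _ _) (proj1 (ccont_eps _ _) (velocity_cont s0) _ Rlt_0_1)) as [d3 [Hd3 H3]].
  set (V := Cmod (v s0) + 1).
  set (e := Rmin (d1 / 2) (Rmin d2 (Rmin d3 (D / (4 * V))))).
  assert (He : 0 < e).
  { unfold e, V. repeat apply Rmin_glb_lt; try lra. apply Rdiv_lt_0_compat; lra. }
  assert (E1 : e <= d1 / 2) by apply Rmin_l.
  assert (E2 : e <= d2) by (unfold e; eapply Rle_trans; [apply Rmin_r|apply Rmin_l]).
  assert (E3 : e <= d3) by (unfold e; eapply Rle_trans; [apply Rmin_r|eapply Rle_trans; [apply Rmin_r|apply Rmin_l]]).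
  assert (E4 : e <= D / (4 * V)) by (unfold e; eapply Rle_trans; [apply Rmin_r|eapply Rle_trans; [apply Rmin_r|apply Rmin_r]]).
  exists (mkposreal e He); simpl. intros s u d Hs Hu [Hd Hd'] E.
  assert (B1 : Cmod (c (s + u) - c (s0 + u0)) < D / 4).
  { apply H1. replace (s + u - (s0 + u0)) with ((s - s0) + (u - u0)) by ring.
    pose proof (Rabs_triang (s - s0) (u - u0)). lra. }
  pose proof (H2 s ltac:(lra)) as B2. pose proof (H3 s ltac:(lra)) as B3.
  assert (B4 : Cmod (RtoC d * (Ci * v s)) <= D / 4).
  { rewrite !Cmod_mult, Cmod_Ci, Cmod_R, Rmult_1_l.
    assert (Cmod (v s) <= V).
    { replace (v s) with (v s - v s0 + v s0)%C by ring. pose proof (Cmod_triangle (v s - v s0) (v s0)). unfold V; lra. }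
    apply Rle_trans with (D / (4 * V) * V).
    - apply Rmult_le_compat; try lra; [apply Cmod_ge_0].
    - right; field. unfold V; lra. }
  assert (B5 : D <= D / 4 + D / 4 + D / 4).
  { unfold D at 1. replace (c (s0 + u0)%R - c s0)%C
      with (- (c (s + u)%R - c (s0 + u0)%R) + ((c s - c s0) + RtoC d * (Ci * v s)))%C
      by (rewrite E; unfold normal_pt; ring).
    eapply Rle_trans; [apply Cmod_triangle|]. rewrite Cmod_opp.
    pose proof (Cmod_triangle (c s - c s0) (RtoC d * (Ci * v s))). lra. }
  lra.
Qed.

Lemma normal_off_uniform : exists d0, 0 < d0 /\
  forall s d, 0 < Rabs d < d0 -> ~ on_curve c (normal_pt s d).
Proof.
pose proof (period_pos c) as HT.
assert (H : forall s0 u0, exists e : posreal, Rabs u0 < T -> forall s u d, Rabs (s - s0) < e ->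
  Rabs (u - u0) < e -> 0 < Rabs d < e -> c (s + u) <> normal_pt s d).
{ intros s0 u0. destruct (Rlt_dec (Rabs u0) T) as [L|L].
  - destruct (normal_off_local s0 u0 L) as [e He]; exists e; auto.
  - exists (mkposreal 1 Rlt_0_1); intros; contradiction. }
pose (delta := fun s u => proj1_sig (constructive_indefinite_description _ (H s u))).
destruct (compactness_value_2d 0 T (- (T / 2)) (T / 2) delta) as [d0 Hd0].
exists d0; split; [apply cond_pos|]. intros s d Hd [t Ht].
destruct (reduce_mod 0 s) as [k Hk]. set (s' := s + IZR k * T) in *.
destruct (reduce_mod (- (T / 2)) (t - s')) as [m Hm].
set (u' := t - s' + IZR m * T) in *.
assert (E : c (s' + u') = normal_pt s' d).
{ unfold u'. replace (s' + (t - s' + IZR m * T)) with (t + IZR m * T) by ring.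
  rewrite curve_Z, Ht. unfold normal_pt, s'. rewrite curve_Z, velocity_Z. reflexivity. }
apply (Hd0 s' u' ltac:(lra) ltac:(lra)). intros (s0 & u0 & Hs0 & Hu0 & B1 & B2 & B3).
refine (proj2_sig (constructive_indefinite_description _ (H s0 u0)) _ s' u' d _ _ _ E).
- apply Rabs_def1; lra.
- exact B1.
- exact B2.
- split; [lra|]. apply Rlt_le_trans with d0; [lra|exact B3].
Qed.

(** At a nearest point the derivative of the squared distance vanishes, and an earlier
    meeting of the segment with the curve would be nearer. *)
Lemma nearest_normal w : ~ on_curve c w -> exists s l, l <> 0 /\ w = normal_pt s l /\
  forall u, 0 < u <= 1 -> ~ on_curve c (normal_pt s (u * l)).
Proof.
intros Hw. pose proof (period_pos c) as HT.
destruct (continuity_ab_min (fun s => Cmod (c s - w)) 0 T) as [s [Hmin Hs]]; [lra| |].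
{ intros x _. apply continuity_pt_filterlim.
  apply (ccont_Cmod (T := RU) (fun s => c s - w)%C).
  apply ccont_minus; [apply curve_cont|apply ccont_const]. }
assert (Hglob : forall t, Cmod (c s - w) <= Cmod (c t - w)).
{ intros t. destruct (reduce_mod 0 t) as [k Hk]. rewrite <- (curve_Z k t). apply Hmin; lra. }
pose proof (velocity_neq0 c s) as Hv. pose proof (Cmod_pos _ Hv) as Hv'.
set (q := ((w - c s) / v s)%C).
assert (Ew : w = (c s + q * v s)%C) by (unfold q; field; exact Hv).
clearbody q.
assert (Hre : fst q = 0).
(* the squared distance phi to w is minimal at s *)
{ set (x := fun t => fst (c t)). set (y := fun t => snd (c t)).
  assert (Dx := Rderiv_fst _ _ _ (curve_derive s)). assert (Dy := Rderiv_snd _ _ _ (curve_derive s)).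
  fold x in Dx. fold y in Dy.
  set (phi := fun t => (x t - fst w) * (x t - fst w) + (y t - snd w) * (y t - snd w)).
  assert (Dphi : is_derive phi s (2 * (x s - fst w) * fst (v s) + 2 * (y s - snd w) * snd (v s))).
  { apply is_derive_dist2; assumption. }
  assert (Ephi : forall t, phi t = Cmod (c t - w) ^ 2).
  { intros t. rewrite Cmod2_alt. unfold phi, x, y, Re, Im; simpl; ring. }
  pose (pr := exist _ _ (proj1 (is_derive_Reals _ _ _) Dphi) : derivable_pt phi s).
  assert (D0 := deriv_minimum phi (s - 1) (s + 1) s pr ltac:(lra) ltac:(lra)).
  simpl in D0. unfold derive_pt in D0; simpl in D0.
  assert (D1 : 2 * (x s - fst w) * fst (v s) + 2 * (y s - snd w) * snd (v s) = 0).
  { apply D0. intros t _ _. rewrite !Ephi. apply pow_incr; split; [apply Cmod_ge_0|apply Hglob]. }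
  assert (E1 : fst w = x s + (fst q * fst (v s) - snd q * snd (v s))) by (rewrite Ew; simpl; unfold x; ring).
  assert (E2 : snd w = y s + (fst q * snd (v s) + snd q * fst (v s))) by (rewrite Ew; simpl; unfold y; ring).
  rewrite E1, E2 in D1.
  assert (N : fst (v s) * fst (v s) + snd (v s) * snd (v s) <> 0).
  { intros N. apply Hv, injective_projections; simpl; nra. }
  assert (D2 : fst q * (fst (v s) * fst (v s) + snd (v s) * snd (v s)) = 0) by lra.
  apply Rmult_integral in D2 as [D2|D2]; [exact D2|contradiction]. }
assert (Eq : q = (RtoC (snd q) * Ci)%C) by (apply injective_projections; simpl; [rewrite Hre|]; ring).
assert (En : forall u, normal_pt s (u * snd q) = (c s + RtoC u * (w - c s))%C).
{ intros u. unfold normal_pt. rewrite Ew at 1.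
  replace (c s + q * v s - c s)%C with (q * v s)%C by ring. rewrite Eq at 2. rewrite RtoC_mult. ring. }
exists s, (snd q). split; [|split].
- intros E0. apply Hw. exists s. rewrite Ew, Eq, E0. ring.
- replace (snd q) with (1 * snd q) by ring. rewrite En. ring.
- intros u Hu [t Ht]. rewrite En in Ht.
  pose proof (Hglob t) as B. rewrite Ht in B.
  replace (c s + RtoC u * (w - c s) - w)%C with ((RtoC 1 - RtoC u) * (c s - w))%C in B by ring.
  rewrite Cmod_mult, RtoC_sub_Cmod, Rabs_right in B by lra.
  assert (P : 0 < Cmod (c s - w)).
  { apply Cmod_pos, Cminus_neq0. intros E; apply Hw; exists s; exact E. }
  nra.
Qed.

Lemma joined_intro z w (p : R -> C) : (forall t, ccontR p t) -> p 0 = z -> p 1 = w ->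
  (forall t, 0 <= t <= 1 -> ~ on_curve c (p t)) -> joined_off c z w.
Proof. intros; exists p; auto. Qed.

Lemma joined_sym z w : joined_off c z w -> joined_off c w z.
Proof.
intros [p (Cp & E0 & E1 & Hp)].
apply (joined_intro _ _ (fun t => p (1 - t))).
- intros t. apply (continuous_comp (V := RU) (fun t => 1 - t) p); [|apply Cp].
  apply (continuous_minus (V := R_NormedModule)); [apply continuous_const|apply continuous_id].
- rewrite Rminus_0_r; exact E1.
- rewrite Rminus_diag; exact E0.
- intros t Ht; apply Hp; lra.
Qed.

Lemma clamp_cont a b (k m t : R) : continuous (T := RU) (U := RU) (fun t => clamp a b (k * t + m)) t.
Proof.
apply (continuous_comp (U := RU) (V := RU) (fun t => k * t + m) (clamp a b)).
- apply (continuous_plus (V := R_NormedModule)); [|apply continuous_const].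
  apply (continuous_mult (K := R_AbsRing)); [apply continuous_const|apply continuous_id].
- apply filterlim_locally; intros e. apply locally_Rabs; exists e; split; [apply cond_pos|].
  intros y Hy. eapply Rle_lt_trans; [apply clamp_lip|exact Hy].
Qed.

Lemma joined_trans x y z : joined_off c x y -> joined_off c y z -> joined_off c x z.
Proof.
intros [p (Cp & P0 & P1 & Hp)] [q (Cq & Q0 & Q1 & Hq)].
(* follow p on [0, 1/2] and then q; the sum makes continuity at 1/2 automatic *)
apply (joined_intro _ _ (fun t => p (clamp 0 1 (2 * t + 0)) + q (clamp 0 1 (2 * t + - 1)) - y)%C).
- intros t. apply ccont_minus; [|apply ccont_const]. apply ccont_plus.
  + apply (continuous_comp (V := RU) (fun t => clamp 0 1 (2 * t + 0)) p); [apply clamp_cont|apply Cp].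
  + apply (continuous_comp (V := RU) (fun t => clamp 0 1 (2 * t + - 1)) q); [apply clamp_cont|apply Cq].
- rewrite !clamp_low, P0, Q0 by lra. ring.
- rewrite !clamp_high, P1, Q1 by lra. ring.
- intros t Ht. destruct (Rle_dec t (1 / 2)) as [L|L].
  + rewrite clamp_id, clamp_low, Q0 by lra.
    replace (p (2 * t + 0)%R + y - y)%C with (p (2 * t + 0)%R) by ring. apply Hp; lra.
  + rewrite clamp_high, clamp_id, P1 by lra.
    replace (y + q (2 * t + - 1)%R - y)%C with (q (2 * t + - 1)%R) by ring. apply Hq; lra.
Qed.

Lemma joined_segment z w : (forall u, 0 <= u <= 1 -> ~ on_curve c (z + RtoC u * (w - z))%C) -> joined_off c z w.
Proof.
intros H. apply (joined_intro _ _ (fun u => z + RtoC u * (w - z))%C).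
- intros t. exact (Rderiv_cont _ _ _ (Rderiv_affine _ _ _)).
- ring.
- ring.
- exact H.
Qed.

Lemma joined_off_curve z w : joined_off c z w -> ~ on_curve c z /\ ~ on_curve c w.
Proof. intros [p (_ & <- & <- & Hp)]. split; apply Hp; lra. Qed.

Lemma interior_joined z w : joined_off c z w -> interior_domain c z -> interior_domain c w.
Proof.
intros J [Hz [M HM]]. split; [apply (joined_off_curve z), J|].
exists M; intros x Hx. apply HM. apply joined_trans with w; assumption.
Qed.

Lemma exterior_joined z w : joined_off c z w -> exterior_domain c z -> exterior_domain c w.
Proof.
intros J [Hz HM]. split; [apply (joined_off_curve z), J|].
intros [M H]. apply HM. exists M; intros x Hx. apply H.
apply joined_trans with z; [apply joined_sym|]; assumption.
Qed.

Lemma interior_exterior z : ~ on_curve c z -> interior_domain c z \/ exterior_domain c z.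
Proof. intros H. destruct (classic (bounded_set (joined_off c z))); [left|right]; split; assumption. Qed.

Definition wind (z : C) : C := winding c v 0 T z.

Lemma curve_closed0 : closed_path c v 0 T.
Proof. pose proof (curve_closed 0) as H. rewrite Rplus_0_l in H. exact H. Qed.

Lemma off_curve_neq z : ~ on_curve c z -> forall s a b, a <= s <= b -> c s <> z.
Proof. intros H s a b _ E; apply H; exists s; exact E. Qed.

Lemma off_curve_all z : (forall s, 0 <= s <= T -> c s <> z) -> ~ on_curve c z.
Proof.
intros H [s E]. destruct (reduce_mod 0 s) as [k Hk]. apply (H (s + IZR k * T)); [lra|].
rewrite curve_Z; exact E.
Qed.

Lemma off_curve_locally z : ~ on_curve c z ->
  locally (T := CU) z (fun w => ~ on_curve c w /\ wind w = wind z).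
Proof.
intros Hz. generalize (winding_locally_constant c v 0 T curve_closed0 z (fun s => off_curve_neq z Hz s 0 T)).
apply filter_imp; intros w [H1 H2]; split; [apply off_curve_all, H1|exact H2].
Qed.

(** Along the path, wind is locally constant, hence has derivative 0. *)
Lemma wind_joined z w : joined_off c z w -> wind z = wind w.
Proof.
intros [p (Cp & <- & <- & Hp)].
assert (H : is_CInt (fun _ => RtoC 0) 0 1 (wind (p 1) - wind (p 0))%C).
{ apply (is_CInt_FTC (fun t => wind (p t))); [|intros s _; apply ccont_const].
  intros t Ht. apply between_le in Ht; [|lra]. apply Rderiv_eps; intros e He.
  assert (L : locally (T := RU) t (fun s => wind (p s) = wind (p t))).
  { apply (Cp t (fun w => wind w = wind (p t))). generalize (off_curve_locally (p t) (Hp t Ht)); apply filter_imp; tauto. }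
  revert L; apply filter_imp; intros s ->.
  replace (wind (p t) - wind (p t) - (RtoC s - RtoC t) * RtoC 0)%C with (RtoC 0) by ring.
  rewrite Cmod_0. apply Rmult_le_pos; [lra|apply Rabs_pos]. }
pose proof (is_CInt_unique _ _ _ _ H) as E. rewrite CInt_zero in E by reflexivity.
symmetry in E |- *. apply Ceq_minus, E.
Qed.

Lemma far_exterior : exists r, 0 < r /\ forall z, r < Cmod z -> exterior_domain c z.
Proof.
pose proof (period_pos c) as HT.
destruct (ccont_bounded c 0 T ltac:(lra) (fun s _ => curve_cont s)) as [N [HN Bg]].
assert (Off : forall z, N < Cmod z -> ~ on_curve c z).
{ intros z Hz. apply off_curve_all; intros s Hs E. pose proof (Bg s Hs). rewrite E in H. lra. }
exists (N + 1); split; [lra|]. intros z Hz. split; [apply Off; lra|].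
intros [M HM].
set (m := 1 + Rabs M).
assert (Hm : 1 <= m) by (unfold m; pose proof (Rabs_pos M); lra).
assert (J : joined_off c z (RtoC m * z)%C).
{ apply joined_segment; intros u Hu. apply Off.
  replace (z + RtoC u * (RtoC m * z - z))%C with (RtoC (1 + u * (m - 1)) * z)%C
    by (rewrite RtoC_plus, RtoC_mult, RtoC_minus; ring).
  assert (1 <= 1 + u * (m - 1)) by nra.
  rewrite Cmod_mult, Cmod_R, Rabs_right by lra. nra. }
specialize (HM _ J). rewrite Cmod_mult, Cmod_R, Rabs_right in HM by lra.
pose proof (Rle_abs M). unfold m in *. nra.
Qed.

(** An exterior point is joined to points arbitrarily far away. *)
Lemma wind_exterior z : exterior_domain c z -> wind z = RtoC 0.
Proof.
intros [_ Hub].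
destruct (winding_far c v 0 T curve_closed0) as [r Hr].
apply NNPP; intros Hn. apply Hub. exists r; intros w J.
apply Rnot_lt_le; intros L. apply Hn. rewrite (wind_joined z w J). apply Hr, L.
Qed.

Lemma joined_normal s d d' : (forall x, Rmin d d' <= x <= Rmax d d' -> ~ on_curve c (normal_pt s x)) ->
  joined_off c (normal_pt s d) (normal_pt s d').
Proof.
intros H. apply joined_segment; intros u Hu.
replace (normal_pt s d + RtoC u * (normal_pt s d' - normal_pt s d))%C
  with (normal_pt s (d + u * (d' - d))) by (unfold normal_pt; rewrite RtoC_plus, RtoC_mult, RtoC_minus; ring).
apply H. unfold Rmin, Rmax; destruct Rle_dec; nra.
Qed.

(** Push the curve off itself along its normal. *)
Lemma joined_slide s s' d : (forall t, ~ on_curve c (normal_pt t d)) ->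
  joined_off c (normal_pt s d) (normal_pt s' d).
Proof.
intros H. apply (joined_intro _ _ (fun u => normal_pt (s + u * (s' - s)) d)).
- intros u. assert (Cu : continuous (T := RU) (U := RU) (fun u => s + u * (s' - s)) u).
  { apply (continuous_plus (V := R_NormedModule)); [apply continuous_const|].
    apply (continuous_mult (K := R_AbsRing)); [apply continuous_id|apply continuous_const]. }
  apply ccont_plus.
  + apply (continuous_comp (V := RU) (fun u => s + u * (s' - s)) c); [exact Cu|apply curve_cont].
  + apply ccont_mult; [apply ccont_const|]. apply ccont_mult; [apply ccont_const|].
    apply (continuous_comp (V := RU) (fun u => s + u * (s' - s)) v); [exact Cu|apply velocity_cont].
- f_equal; ring.
- f_equal; ring.
- intros u _; apply H.
Qed.

Hypothesis Hccw : counterclockwise c.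

(** A far point is exterior, so the segment to its nearest point arrives on the right;
    sliding along the curve, the whole right side is then exterior. An interior point
    therefore arrives on the left. *)
Lemma two_sides : exists d1, 0 < d1 /\
  (forall s d, 0 < d <= d1 -> interior_domain c (normal_pt s d)) /\
  (forall s d, 0 < d <= d1 -> exterior_domain c (normal_pt s (- d))) /\
  (forall w, interior_domain c w -> joined_off c w (normal_pt 0 d1)).
Proof.
destruct normal_off_uniform as [d0 [Hd0 Hoff]].
set (d1 := d0 / 2). assert (Hd1 : 0 < d1 < d0) by (unfold d1; lra).
(* the orientation only speaks of points close to the curve; they are reached along the normal *)
assert (left_int : forall s d, 0 < d -> (forall x, 0 < x <= d -> ~ on_curve c (normal_pt s x)) ->
  interior_domain c (normal_pt s d)).
{ intros s d Hd Hx.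
  destruct (proj1 (locally_Rabs _ _) (Hccw s)) as [e [He H]].
  set (x := Rmin d (e / 2)).
  assert (X : 0 < x /\ x <= d /\ x <= e / 2).
  { unfold x; split; [apply Rmin_glb_lt; lra|split; [apply Rmin_l|apply Rmin_r]]. }
  apply interior_joined with (normal_pt s x).
  - apply joined_normal. intros y Hy. rewrite Rmin_left, Rmax_right in Hy by lra. apply Hx; lra.
  - apply H; [rewrite Rminus_0_r, Rabs_right; lra|lra]. }
destruct far_exterior as [r [Hr Hfar]].
assert (Ew0 : exterior_domain c (RtoC (r + 1))) by (apply Hfar; rewrite Cmod_R, Rabs_right; lra).
(* either side of the curve is reached along the normal at a nearest point *)
assert (reach : forall w, ~ on_curve c w ->
  (interior_domain c w /\ exists s, joined_off c w (normal_pt s d1)) \/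
  (exists s, joined_off c w (normal_pt s (- d1)))).
{ intros w Hw. destruct (nearest_normal w Hw) as (s & l & Hl & Ew & Hs).
  assert (Hs' : forall x, 0 < x * l -> Rabs x <= Rabs l -> ~ on_curve c (normal_pt s x)).
  { intros x Hx Hxl. replace x with (x / l * l) by (field; exact Hl). apply Hs.
    destruct (Rlt_dec 0 l) as [L|L].
    - rewrite (Rabs_right l), Rabs_right in Hxl by nra. split; [apply Rdiv_lt_0_compat; nra|].
      apply Rle_div_l; lra.
    - rewrite (Rabs_left l), Rabs_left in Hxl by nra.
      replace (x / l) with ((- x) / (- l)) by (field; exact Hl).
      split; [apply Rdiv_lt_0_compat; nra|]. apply Rle_div_l; lra. }
  assert (J : forall e, Rabs e = d1 -> 0 < e * l -> joined_off c w (normal_pt s e)).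
  { intros e He Hel. rewrite Ew. apply joined_normal. intros x Hx.
    destruct (Rlt_dec 0 l) as [L|L].
    - assert (e = d1) by (rewrite Rabs_right in He; nra). subst e.
      assert (0 < x) by (revert Hx; unfold Rmin; destruct Rle_dec; lra).
      destruct (Rle_dec x l) as [Lx|Lx].
      + apply Hs'; [nra|]. rewrite !Rabs_right; lra.
      + apply Hoff. rewrite Rabs_right by lra. revert Hx; unfold Rmax; destruct Rle_dec; lra.
    - assert (e = - d1) by (rewrite Rabs_left in He; nra). subst e.
      assert (x < 0) by (revert Hx; unfold Rmax; destruct Rle_dec; lra).
      destruct (Rle_dec l x) as [Lx|Lx].
      + apply Hs'; [nra|]. rewrite !Rabs_left; lra.
      + apply Hoff. rewrite Rabs_left by lra. revert Hx; unfold Rmin; destruct Rle_dec; lra. }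
  destruct (Rlt_dec 0 l) as [L|L].
  - left. split; [|exists s; apply J; [apply Rabs_right; lra|nra]].
    rewrite Ew. apply left_int; [exact L|]. intros x Hx. apply Hs'; [nra|]. rewrite !Rabs_right; lra.
  - right. exists s. apply J; [rewrite Rabs_Ropp; apply Rabs_right; lra|nra]. }
assert (rightext : forall s, exterior_domain c (normal_pt s (- d1))).
{ destruct (reach _ (proj1 Ew0)) as [[[_ B] _]|[s J]]; [destruct (proj2 Ew0 B)|].
  intros s'. apply exterior_joined with (normal_pt s (- d1)).
  - apply joined_slide. intros t. apply Hoff. rewrite Rabs_Ropp, Rabs_right; lra.
  - apply exterior_joined with (RtoC (r + 1)); assumption. }
exists d1; split; [lra|]. split; [|split].
- intros s d Hd. apply left_int; [lra|]. intros x Hx. apply Hoff. rewrite Rabs_right; lra.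
- intros s d Hd. apply exterior_joined with (normal_pt s (- d1)); [|apply rightext].
  apply joined_normal. intros x Hx. rewrite Rmin_left, Rmax_right in Hx by lra.
  apply Hoff. rewrite Rabs_left; lra.
- intros w Hw. destruct (reach w (proj1 Hw)) as [[_ [s J]]|[s J]].
  + apply joined_trans with (1 := J). apply joined_slide. intros t; apply Hoff. rewrite Rabs_right; lra.
  + exfalso. apply (rightext s). apply (interior_joined _ _ J Hw).
Qed.
End Curve.

(** * Principal values at a point of the curve *)

Lemma is_CInt_periodic (f : R -> C) (T a : R) l : (forall s, f (s + T) = f s) -> - T <= a <= 0 ->
  is_CInt f a (a + T) l -> is_CInt f 0 T l.
Proof.
intros Hf Ha H.
assert (Ex : ex_RInt (V := C_R_CompleteNormedModule) f a (a + T)) by (exists l; exact H).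
destruct (ex_RInt_Chasles_1 (V := C_R_CompleteNormedModule) f a 0 (a + T) ltac:(lra) Ex) as [l1 H1].
destruct (ex_RInt_Chasles_2 (V := C_R_CompleteNormedModule) f a 0 (a + T) ltac:(lra) Ex) as [l2 H2].
assert (E : l = (l2 + l1)%C).
{ rewrite <- (is_CInt_unique _ _ _ _ H), Cplus_comm.
  apply is_CInt_unique, is_CInt_Chasles with 0; assumption. }
rewrite E. apply is_CInt_Chasles with (a + T); [exact H2|].
pose proof (is_RInt_comp_lin (V := C_R_NormedModule) f 1 (- T) (a + T) T l1) as L.
replace (1 * (a + T) + - T) with a in L by ring. replace (1 * T + - T) with 0 in L by ring.
eapply is_CInt_ext; [|exact (L H1)]. intros s _. cbv beta.
rewrite <- (Hf (1 * s + - T)). replace (1 * s + - T + T) with s by ring.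
apply (scal_one (V := C_R_NormedModule)).
Qed.

Definition slit (w : C) : Prop := snd w <> 0 \/ 0 < fst w.
(** The argument in (-pi, pi), through the tangent of the half angle: the formula is
    smooth on the whole slit plane. *)
Definition Arg (w : C) : R := 2 * atan (snd w / (Cmod w + fst w)).
Definition Clog (w : C) : C := (ln (Cmod w), Arg w).

Lemma slit_pos w : slit w -> 0 < Cmod w /\ 0 < Cmod w + fst w.
Proof.
intros Hw.
assert (H : 0 < Cmod w).
{ apply Cmod_pos; intros ->. destruct Hw; simpl in *; lra. }
split; [exact H|]. destruct Hw as [Hw|Hw]; [|lra].
assert (E : Cmod w ^ 2 = fst w ^ 2 + snd w ^ 2) by exact (Cmod2_alt w).
assert (0 < snd w ^ 2) by nra. nra.
Qed.

Lemma Clog_derive_real (x y : R -> R) s dx dy : is_derive x s dx -> is_derive y s dy ->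
  let m := sqrt (x s ^ 2 + y s ^ 2) in 0 < m -> 0 < m + x s ->
  is_derive (fun t => ln (sqrt (x t ^ 2 + y t ^ 2))) s ((x s * dx + y s * dy) / (m * m)) /\
  is_derive (fun t => 2 * atan (y t / (sqrt (x t ^ 2 + y t ^ 2) + x t))) s ((x s * dy - y s * dx) / (m * m)).
Proof.
intros Hx Hy m Hm Hmx.
assert (Hp : 0 < x s ^ 2 + y s ^ 2).
{ apply Rnot_le_lt; intros L. unfold m in Hm. rewrite sqrt_neg_0 in Hm by exact L. lra. }
assert (Em : m * m = x s ^ 2 + y s ^ 2) by (apply sqrt_sqrt; lra).
assert (Dx : Derive (fun t => x t) s = dx) by (apply is_derive_unique, Hx).
assert (Dy : Derive (fun t => y t) s = dy) by (apply is_derive_unique, Hy).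
assert (Ex : ex_derive (fun t => x t) s) by (exists dx; exact Hx).
assert (Ey : ex_derive (fun t => y t) s) by (exists dy; exact Hy).
split; auto_derive;
  replace (x s * (x s * 1) + y s * (y s * 1)) with (x s ^ 2 + y s ^ 2) by ring; fold m.
- repeat split; assumption.
- change (Derive (fun t => x t) s) with (Derive x s) in *. change (Derive (fun t => y t) s) with (Derive y s) in *.
  rewrite Dx, Dy. field. lra.
- repeat split; try assumption; lra.
- change (Derive (fun t => x t) s) with (Derive x s) in *. change (Derive (fun t => y t) s) with (Derive y s) in *.
  rewrite Dx, Dy.
  assert (Hd : (m + x s) * (m + x s) + y s * y s = 2 * m * (m + x s)) by nra.
  assert (Hd' : (m + x s) * (m + x s) + y s * y s <> 0) by nra.
  unfold Rsqr.
  assert (N : dy * (m + x s) - y s * ((x s * dx + y s * dy) / m + dx) = (m + x s) * (x s * dy - y s * dx) / m).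
  { transitivity ((dy * (m * m) + dy * x s * m - y s * (x s * dx + y s * dy) - y s * dx * m) / m);
      [field; lra|]. rewrite Em. f_equal; ring. }
  transitivity (2 * (dy * (m + x s) - y s * ((x s * dx + y s * dy) / m + dx)) / ((m + x s) * (m + x s) + y s * y s)).
  + field. repeat split; first [lra | intros E0; apply Hd'; rewrite <- E0; ring].
  + rewrite N, Hd. field. lra.
Qed.

Lemma Rderiv_Clog (w : R -> C) s l : Rderiv w s l -> slit (w s) -> Rderiv (fun t => Clog (w t)) s (l / w s)%C.
Proof.
intros Hw Hs. destruct (slit_pos _ Hs) as [P1 P2].
destruct (Clog_derive_real _ _ s _ _ (Rderiv_fst _ _ _ Hw) (Rderiv_snd _ _ _ Hw) P1 P2) as [D1 D2].
assert (Em : Cmod (w s) * Cmod (w s) = fst (w s) ^ 2 + snd (w s) ^ 2).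
{ transitivity (Cmod (w s) ^ 2); [ring|exact (Cmod2_alt (w s))]. }
change (sqrt (fst (w s) ^ 2 + snd (w s) ^ 2)) with (Cmod (w s)) in D1, D2. rewrite Em in D1, D2.
assert (0 < fst (w s) ^ 2 + snd (w s) ^ 2) by (rewrite <- Em; nra).
assert (E1 : (fst (w s) * fst l + snd (w s) * snd l) / (fst (w s) ^ 2 + snd (w s) ^ 2) = fst (l / w s)%C)
  by (simpl; field; simpl in *; lra).
assert (E2 : (fst (w s) * snd l - snd (w s) * fst l) / (fst (w s) ^ 2 + snd (w s) ^ 2) = snd (l / w s)%C)
  by (simpl; field; simpl in *; lra).
rewrite E1 in D1. rewrite E2 in D2. apply Rderiv_pair; assumption.
Qed.

Lemma Arg_cont {T : UniformSpace} (p : T -> C) x : ccont p x -> slit (p x) ->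
  continuous (fun y => Arg (p y)) x.
Proof.
intros Hp Hs. destruct (slit_pos _ Hs) as [_ P2].
unfold Arg. apply (continuous_mult (K := R_AbsRing)); [apply continuous_const|].
apply (continuous_comp (V := RU) (fun y => snd (p y) / (Cmod (p y) + fst (p y))) atan).
- apply (continuous_mult (K := R_AbsRing)); [apply ccont_snd, Hp|].
  apply (continuous_comp (V := RU) (fun y => Cmod (p y) + fst (p y)) Rinv).
  + apply (continuous_plus (V := R_NormedModule)); [apply ccont_Cmod, Hp|apply ccont_fst, Hp].
  + apply continuous_Rinv. lra.
- apply continuity_pt_filterlim. apply derivable_continuous_pt, derivable_pt_atan.
Qed.

Lemma Arg_scale k w : 0 < k -> slit w -> Arg (RtoC k * w) = Arg w.
Proof.
intros Hk Hs. destruct (slit_pos _ Hs) as [_ P2]. unfold Arg. f_equal; f_equal.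
rewrite Cmod_mult, Cmod_R, Rabs_right by lra. simpl. field. split; nra.
Qed.

Lemma Arg_i e : e * e = 1 -> Arg (0, e) = e * (PI / 2).
Proof.
intros He. unfold Arg, Cmod; simpl. replace (0 * (0 * 1) + e * (e * 1)) with 1 by lra.
rewrite sqrt_1. replace (e / (1 + 0)) with e by field.
pose proof (sign_cases e He) as Ee.
destruct Ee as [->| ->]; [|rewrite atan_opp]; rewrite atan_1; field.
Qed.

(** An identity valid for small positive x passes to x = 0. *)
Lemma ccont_zero_limit (f : R -> C) d : 0 < d -> ccontR f 0 ->
  (forall x, 0 < x <= d -> f x = RtoC 0) -> f 0 = RtoC 0.
Proof.
intros Hd Cf H. apply Cmod_eq_0. destruct (Rle_lt_or_eq_dec 0 _ (Cmod_ge_0 (f 0))) as [Hp|]; [exfalso|auto].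
destruct (proj1 (locally_Rabs _ _) (proj1 (ccont_eps f 0) Cf _ Hp)) as [r [Hr Hf]].
set (x := Rmin d (r / 2)).
assert (X : 0 < x <= d /\ x <= r / 2) by (unfold x; repeat split; [apply Rmin_glb_lt; lra|apply Rmin_l|apply Rmin_r]).
specialize (Hf x). rewrite Rminus_0_r, Rabs_right in Hf by lra. rewrite (H x) in Hf by lra.
replace (RtoC 0 - f 0)%C with (- f 0)%C in Hf by ring. rewrite Cmod_opp in Hf. lra.
Qed.

Section PV.
Variable c : closed_curve.
Notation v := (velocity c).
Notation T := (period c).
Variable sigma : R.
Hypothesis Hsg : - (T / 2) <= sigma <= T / 2.
Notation z := (c sigma).
Notation v0 := (v sigma).

(** The curve in the affine coordinate where it passes through 0 with velocity 1. *)
Definition chord (s : R) : C := ((c s - z) / v0)%C.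

Lemma chord_derive s : Rderiv chord s (v s / v0)%C.
Proof.
unfold chord, Cdiv. replace (v s * / v0)%C with (/ v0 * (v s + RtoC 0))%C by ring.
replace (fun s => ((c s - z) * / v0)%C) with (fun s => (/ v0 * (c s + - z))%C)
  by (apply FunctionalExtensionality.functional_extensionality; intros; ring).
apply Rderiv_scal, Rderiv_plus; [apply curve_derive|apply Rderiv_const].
Qed.

Lemma chord_base : chord sigma = RtoC 0.
Proof. unfold chord. unfold Cdiv. replace (z - z)%C with (RtoC 0) by ring. ring. Qed.

Lemma chord_curve s : (c s - z)%C = (v0 * chord s)%C.
Proof. unfold chord. field. apply velocity_neq0. Qed.

Lemma chord_strict : exists d, 0 < d /\ forall s s', Rabs (s - sigma) < d -> Rabs (s' - sigma) < d ->
  Cmod (chord s' - chord s - (RtoC s' - RtoC s)) <= / 4 * Rabs (s' - s).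
Proof.
pose proof (Cmod_pos _ (velocity_neq0 c sigma)) as Hv.
destruct (strict_derive c sigma (Cmod v0 / 4)) as [d [Hd [_ H]]]; [lra|].
exists d; split; [exact Hd|]. intros s s' Hs Hs'. specialize (H s s' Hs Hs').
apply Rmult_le_reg_r with (1 := Hv). rewrite <- Cmod_mult.
replace ((chord s' - chord s - (RtoC s' - RtoC s)) * v0)%C with (c s' - c s - (RtoC s' - RtoC s) * v0)%C
  by (unfold chord; field; apply velocity_neq0).
lra.
Qed.

(** Both g and D lie in the narrow cone around the real half line of sign e, so that
    their scalar product is nonnegative. *)
Lemma chord_mono_alg (e a d : R) (g D : C) : e * e = 1 -> 0 <= a -> 0 < d ->
  Cmod (g - RtoC (e * a)) <= / 4 * a -> Cmod (D - RtoC (e * d)) <= / 4 * d ->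
  Cmod g < Cmod (g + D).
Proof.
intros He Ha Hd Hg HD.
pose proof (Rle_trans _ _ _ (fst_le_Cmod _) Hg) as G1. pose proof (Rle_trans _ _ _ (snd_le_Cmod _) Hg) as G2.
pose proof (Rle_trans _ _ _ (fst_le_Cmod _) HD) as D1. pose proof (Rle_trans _ _ _ (snd_le_Cmod _) HD) as D2.
simpl in G1, G2, D1, D2. apply Rabs_le_between in G1, G2, D1, D2.
pose proof (sign_cases e He) as Ee.
apply Rsqr_incrst_0; [|apply Cmod_ge_0|apply Cmod_ge_0].
unfold Rsqr.
assert (E1 : Cmod g * Cmod g = fst g ^ 2 + snd g ^ 2)
  by (transitivity (Cmod g ^ 2); [ring|exact (Cmod2_alt g)]).
assert (E2 : Cmod (g + D) * Cmod (g + D) = (fst g + fst D) ^ 2 + (snd g + snd D) ^ 2)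
  by (transitivity (Cmod (g + D) ^ 2); [ring|exact (Cmod2_alt (g + D)%C)]).
rewrite E1, E2.
assert (Y : - (/ 4 * a * (/ 4 * d)) <= snd g * snd D) by nra.
destruct Ee as [-> | ->].
- assert (3 / 4 * a <= fst g) by lra. assert (3 / 4 * d <= fst D) by lra.
  assert (3 / 4 * a * (3 / 4 * d) <= fst g * fst D) by nra. nra.
- assert (fst g <= - (3 / 4 * a)) by lra. assert (fst D <= - (3 / 4 * d)) by lra.
  assert (3 / 4 * a * (3 / 4 * d) <= fst g * fst D) by nra. nra.
Qed.

Lemma side_mono : exists d, 0 < d /\ forall e t t', e * e = 1 -> 0 <= t < t' -> t' < d ->
  Cmod (c (sigma + e * t) - z) < Cmod (c (sigma + e * t') - z).
Proof.
destruct chord_strict as [d [Hd H]]. exists d; split; [exact Hd|].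
intros e t t' He Ht Ht'. rewrite !chord_curve, !Cmod_mult.
pose proof (Rabs_sign e He) as Ae.
assert (A : forall x, 0 <= x < d -> Rabs (sigma + e * x - sigma) < d).
{ intros x Hx. replace (sigma + e * x - sigma) with (e * x) by ring.
  rewrite Rabs_mult, Ae, Rabs_right; lra. }
apply Rmult_lt_compat_l; [apply Cmod_pos, velocity_neq0|].
replace (chord (sigma + e * t')) with (chord (sigma + e * t)%R + (chord (sigma + e * t')%R - chord (sigma + e * t)%R))%C by ring.
apply chord_mono_alg with (e := e) (a := t) (d := t' - t); [exact He|lra|lra| |].
- pose proof (H sigma (sigma + e * t) ltac:(rewrite Rminus_diag, Rabs_R0; exact Hd) (A t ltac:(lra))) as B.
  rewrite chord_base in B. replace (sigma + e * t - sigma) with (e * t) in B by ring.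
  rewrite Rabs_mult, Ae, Rabs_right in B by lra.
  replace (chord (sigma + e * t)%R - RtoC (e * t))%C with (chord (sigma + e * t)%R - RtoC 0 - (RtoC (sigma + e * t) - RtoC sigma))%C
    by (rewrite RtoC_plus; ring). lra.
- pose proof (H (sigma + e * t) (sigma + e * t') (A t ltac:(lra)) (A t' ltac:(lra))) as B.
  replace (sigma + e * t' - (sigma + e * t)) with (e * (t' - t)) in B by ring.
  rewrite Rabs_mult, Ae, (Rabs_right (t' - t)) in B by lra.
  replace (chord (sigma + e * t')%R - chord (sigma + e * t)%R - RtoC (e * (t' - t)))%C
    with (chord (sigma + e * t')%R - chord (sigma + e * t)%R - (RtoC (sigma + e * t') - RtoC (sigma + e * t)))%C
    by (rewrite !RtoC_plus, !RtoC_mult, RtoC_minus; ring). lra.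
Qed.

Lemma side_cont (e t : R) : ccontR (fun t => c (sigma + e * t)%R - z)%C t.
Proof.
apply ccont_minus; [|apply ccont_const].
apply (continuous_comp (V := RU) (fun t => sigma + e * t) c); [|apply curve_cont].
apply (continuous_plus (V := R_NormedModule)); [apply continuous_const|].
apply (continuous_mult (K := R_AbsRing)); [apply continuous_const|apply continuous_id].
Qed.

(** On one side of z (the sign e) the distance to z increases near z and is bounded
    below further away, so it crosses the level eps exactly once. *)
Lemma side_cut e eta : e * e = 1 -> 0 < eta -> exists eps0, 0 < eps0 /\
  forall eps, 0 < eps < eps0 -> exists tau, 0 < tau < eta /\ Cmod (c (sigma + e * tau) - z) = eps /\
    forall t, 0 <= t <= T / 2 ->
      (t < tau -> Cmod (c (sigma + e * t) - z) < eps) /\ (tau < t -> eps <= Cmod (c (sigma + e * t) - z)).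
Proof.
intros He Heta. pose proof (period_pos c) as HT.
destruct side_mono as [d [Hd Hmono]].
set (x1 := Rmin (eta / 2) (Rmin (d / 2) (T / 2))).
assert (X1 : 0 < x1 /\ x1 <= eta / 2 /\ x1 <= d / 2 /\ x1 <= T / 2).
{ unfold x1. split; [repeat apply Rmin_glb_lt; lra|]. split; [apply Rmin_l|].
  split; (eapply Rle_trans; [apply Rmin_r|]); [apply Rmin_l|apply Rmin_r]. }
set (h := fun t => Cmod (c (sigma + e * t) - z)).
pose proof (Rabs_sign e He) as Ae.
assert (Hne : forall t, x1 <= t <= T / 2 -> (c (sigma + e * t)%R - z)%C <> RtoC 0).
{ intros t Ht. apply Cminus_neq0; intros E. apply curve_inj in E.
  - assert (E0 : e * t = 0) by lra. apply (f_equal Rabs) in E0.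
    rewrite Rabs_mult, Ae, Rabs_R0, Rabs_right in E0; lra.
  - replace (sigma + e * t - sigma) with (e * t) by ring. rewrite Rabs_mult, Ae, Rabs_right; lra. }
destruct (ccont_bounded (fun t => / (c (sigma + e * t)%R - z))%C x1 (T / 2)) as [M [HM BM]]; [lra| |].
{ intros t Ht. apply ccont_inv; [apply Hne, Ht|apply side_cont]. }
assert (Far : forall t, x1 <= t <= T / 2 -> / (M + 1) <= h t).
{ intros t Ht. pose proof (BM t Ht) as B. rewrite Cmod_inv in B by (apply Hne, Ht).
  pose proof (Cmod_pos _ (Hne t Ht)) as P. unfold h.
  rewrite <- (Rinv_inv (Cmod (c (sigma + e * t)%R - z))).
  apply Rinv_le_contravar; [apply Rinv_0_lt_compat, P|lra]. }
exists (Rmin (h x1) (/ (M + 1))). split.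
{ apply Rmin_glb_lt; [apply Cmod_pos, Hne; lra|apply Rinv_0_lt_compat; lra]. }
intros eps [Heps Heps'].
assert (L1 : eps < h x1) by (eapply Rlt_le_trans; [exact Heps'|apply Rmin_l]).
assert (L2 : eps < / (M + 1)) by (eapply Rlt_le_trans; [exact Heps'|apply Rmin_r]).
assert (h0 : h 0 = 0).
{ unfold h. replace (sigma + e * 0) with sigma by ring. apply Cmod_sub_diag. }
destruct (IVT_gen h 0 x1 eps) as [tau [Htau Etau]].
{ intros t. apply continuity_pt_filterlim. apply (ccont_Cmod (T := RU)), side_cont. }
{ rewrite h0, Rmin_left, Rmax_right; lra. }
rewrite Rmin_left, Rmax_right in Htau by lra.
assert (0 < tau).
{ destruct (Req_dec tau 0) as [E|]; [|lra]. rewrite E, h0 in Etau. lra. }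
exists tau. split; [lra|]. split; [exact Etau|]. intros t Ht. split; intros Hlt.
- rewrite <- Etau. apply Hmono; try lra.
- destruct (Rle_dec t x1) as [L|L].
  + rewrite <- Etau. left. apply Hmono; lra.
  + left. apply Rlt_le_trans with (1 := L2). apply Far; lra.
Qed.

(** For small eps, the part of the curve removed in the principal value is a single
    arc around z, with both ends at distance eps. *)
Lemma cutoff_arc eta : 0 < eta -> exists eps0, 0 < eps0 /\ forall eps, 0 < eps < eps0 ->
  exists p q, sigma - eta < p < sigma /\ sigma < q < sigma + eta /\
    Cmod (c p - z) = eps /\ Cmod (c q - z) = eps /\ sigma - T / 2 <= p /\ q <= sigma + T / 2 /\
    forall s, sigma - T / 2 <= s <= sigma + T / 2 ->
      (p < s < q -> Cmod (c s - z) < eps) /\ (s < p \/ q < s -> eps <= Cmod (c s - z)).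
Proof.
intros Heta. pose proof (period_pos c) as HT.
set (eta' := Rmin eta (T / 2)).
assert (Heta' : 0 < eta' /\ eta' <= eta /\ eta' <= T / 2).
{ unfold eta'; split; [apply Rmin_glb_lt; lra|split; [apply Rmin_l|apply Rmin_r]]. }
destruct (side_cut 1 eta') as [e1 [He1 H1]]; [lra|lra|].
destruct (side_cut (- (1)) eta') as [e2 [He2 H2]]; [lra|lra|].
exists (Rmin e1 e2); split; [apply Rmin_glb_lt; assumption|].
intros eps [Heps Heps'].
pose proof (Rlt_le_trans _ _ _ Heps' (Rmin_l _ _)). pose proof (Rlt_le_trans _ _ _ Heps' (Rmin_r _ _)).
destruct (H1 eps ltac:(lra)) as (t1 & Ht1 & E1 & C1). destruct (H2 eps ltac:(lra)) as (t2 & Ht2 & E2 & C2).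
exists (sigma + - (1) * t2), (sigma + 1 * t1). repeat split; try lra.
- intros [S1 S2]. destruct (Rle_dec sigma s) as [L|L].
  + replace s with (sigma + 1 * (s - sigma)) by ring. apply C1; lra.
  + replace s with (sigma + - (1) * (sigma - s)) by ring. apply C2; lra.
- intros [S1|S1].
  + replace s with (sigma + - (1) * (sigma - s)) by ring. apply C2; lra.
  + replace s with (sigma + 1 * (s - sigma)) by ring. apply C1; lra.
Qed.

(** The integral of dt/(t - y) over the curve without the arc from p to q. *)
Definition outer_int (p q : R) (y : C) : C :=
  (CInt (fun s => v s / (c s - y))%C (sigma - T / 2) p + CInt (fun s => v s / (c s - y))%C q (sigma + T / 2))%C.

Section Side.
Variables (e d1 : R) (w : C).
Hypothesis (He : e * e = 1).
Hypothesis (Hd1 : 0 < d1).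
Hypothesis (Hoff : forall d, 0 < d <= d1 -> ~ on_curve c (normal_pt c sigma (e * d))).
Hypothesis (Hw : forall d, 0 < d <= d1 -> wind c (normal_pt c sigma (e * d)) = w).

Notation turned s := (RtoC e * Ci * chord s)%C.

Lemma rot_slit : exists d, 0 < d /\ forall s, Rabs (s - sigma) < d ->
  (s <> sigma -> slit (turned s)) /\
  forall x, 0 < x -> slit (turned s + RtoC x)%C.
Proof.
destruct chord_strict as [d [Hd H]]. exists d; split; [exact Hd|].
assert (X : forall s, Rabs (s - sigma) < d -> s <> sigma -> e * fst (chord s) <> 0).
{ intros s Hs Hn E0.
  assert (X0 : fst (chord s) = 0) by (apply Rmult_integral in E0 as [E0|E0]; [rewrite E0 in He; lra|exact E0]).
  pose proof (H sigma s ltac:(rewrite Rminus_diag, Rabs_R0; exact Hd) Hs) as B. rewrite chord_base in B.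
  pose proof (Rle_trans _ _ _ (fst_le_Cmod _) B) as B1.
  change (fst (chord s - RtoC 0 - (RtoC s - RtoC sigma))%C) with (fst (chord s) + - 0 + - (s + - sigma)) in B1.
  rewrite X0 in B1.
  replace (0 + - 0 + - (s + - sigma)) with (- (s - sigma)) in B1 by ring. rewrite Rabs_Ropp in B1.
  assert (0 < Rabs (s - sigma)) by (apply Rabs_pos_lt; lra). lra. }
assert (Rs : forall g, snd (RtoC e * Ci * g)%C = e * fst g) by (intros; simpl; ring).
intros s Hs. split.
- intros Hn. left. rewrite Rs. apply X; assumption.
- intros x Hx. destruct (Req_dec s sigma) as [->|Hn].
  + right. rewrite chord_base. simpl. lra.
  + left. change (snd (turned s) + 0 <> 0). rewrite Rs, Rplus_0_r. apply X; assumption.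
Qed.

(** Seen from the point at distance x on the side e, and turned by a right angle, the
    arc stays in the slit plane, where Clog is a primitive of 1/w. *)
Lemma arc_integral d p q x : (forall s, Rabs (s - sigma) < d -> slit (turned s + RtoC x)%C) ->
  Rabs (p - sigma) < d -> Rabs (q - sigma) < d -> ~ on_curve c (normal_pt c sigma (e * x)) ->
  is_CInt (fun s => v s / (c s - normal_pt c sigma (e * x)))%C p q
    (Clog (turned q + RtoC x) - Clog (turned p + RtoC x))%C.
Proof.
intros Hs Hp Hq Hn.
assert (Ee : (RtoC e * RtoC e)%C = RtoC 1) by (rewrite <- RtoC_mult, He; reflexivity).
assert (Cne : forall s, (c s - normal_pt c sigma (e * x))%C <> RtoC 0).
{ intros s. apply Cminus_neq0; intros E; apply Hn; exists s; exact E. }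
apply (is_CInt_FTC (fun s => Clog (turned s + RtoC x)%C)).
- intros s Hs'.
  assert (S : slit (turned s + RtoC x)%C).
  { apply Hs. exact (Rabs_between_lt _ _ _ _ _ Hp Hq Hs'). }
  assert (E1 : (c s - normal_pt c sigma (e * x))%C = (- (RtoC e * Ci * v0) * (turned s + RtoC x))%C).
  { unfold normal_pt. replace (c s - (z + RtoC (e * x) * (Ci * v0)))%C
      with ((c s - z) - RtoC (e * x) * (Ci * v0))%C by ring. rewrite chord_curve, RtoC_mult.
    assert (Ei : (Ci * Ci)%C = (- RtoC 1)%C) by (apply injective_projections; simpl; ring).
    replace (- (RtoC e * Ci * v0) * (turned s + RtoC x))%C
      with (- ((RtoC e * RtoC e) * (Ci * Ci) * v0 * chord s) - RtoC e * RtoC x * (Ci * v0))%C by ring.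
    rewrite Ee, Ei. ring. }
  assert (Sn : (turned s + RtoC x)%C <> RtoC 0).
  { intros E. apply (Cne s). rewrite E1, E. ring. }
  replace (v s / (c s - normal_pt c sigma (e * x)))%C
    with ((RtoC e * Ci * (v s / v0) + RtoC 0) / (turned s + RtoC x))%C.
  + apply Rderiv_Clog; [|exact S]. apply Rderiv_plus; [|apply Rderiv_const]. apply Rderiv_scal, chord_derive.
  + rewrite E1.
    assert (Hv : v0 <> RtoC 0) by apply velocity_neq0.
    assert (He0 : RtoC e <> RtoC 0) by (intros E; apply RtoC_inj in E; rewrite E in He; lra).
    assert (Ei : (Ci * Ci)%C = (- RtoC 1)%C) by (apply injective_projections; simpl; ring).
    pose proof Ci_nz.
    transitivity ((RtoC e * RtoC e) * (Ci * Ci) * v s / (RtoC e * Ci * v0 * (turned s + RtoC x)))%C;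
      [field; auto|]. rewrite Ee, Ei. field. auto.
- intros s _. apply ccont_div; [apply Cne|apply velocity_cont|].
  apply ccont_minus; [apply curve_cont|apply ccont_const].
Qed.

(** For a point on the normal the identity splits its winding integral into the arc and
    the rest; the point then tends to z along the normal. *)
Lemma outer_eq : exists d, 0 < d /\ forall p q, sigma - d < p < sigma -> sigma < q < sigma + d ->
  sigma - T / 2 <= p -> q <= sigma + T / 2 ->
  outer_int p q z = (w - (Clog (turned q) - Clog (turned p)))%C.
Proof.
pose proof (period_pos c) as HT.
destruct rot_slit as [d [Hd Hs]]. exists d; split; [exact Hd|].
intros p q Hp Hq Hp' Hq'.
assert (Ap : Rabs (p - sigma) < d) by (apply Rabs_def1; lra).
assert (Aq : Rabs (q - sigma) < d) by (apply Rabs_def1; lra).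
(* Xi vanishes for 0 < x <= d1 by splitting the winding integral into three parts, and it is
   continuous at 0 because z lies on the arc but not on the rest of the curve *)
set (Xi := fun x => (outer_int p q (normal_pt c sigma (e * x))
  + (Clog (turned q + RtoC x) - Clog (turned p + RtoC x)) - w)%C).
assert (E0 : Xi 0 = RtoC 0).
{ apply ccont_zero_limit with d1; [exact Hd1| |].
  - assert (Cn : ccontR (fun x => normal_pt c sigma (e * x)) 0).
    { unfold normal_pt. apply ccont_plus; [apply ccont_const|]. apply ccont_mult; [|apply ccont_const].
      apply ccont_RtoC. apply (continuous_mult (K := R_AbsRing)); [apply continuous_const|apply continuous_id]. }
    assert (N0 : normal_pt c sigma (e * 0) = z).
    { unfold normal_pt. rewrite Rmult_0_r. ring. }
    assert (Co : forall a b, a <= b -> (forall s, a <= s <= b -> c s <> z) ->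
      ccontC (fun y => CInt (fun s => v s / (c s - y))%C a b) z).
    { intros a b Hab Hn. eapply Cderiv_cont. apply (cauchy_type_derive c v a b z Hab).
      - intros; apply curve_cont.
      - intros; apply velocity_cont.
      - exact Hn. }
    assert (CL : forall s, Rabs (s - sigma) < d -> s <> sigma ->
      ccontR (fun x => Clog (turned s + RtoC x)%C) 0).
    { intros s As Hn. eapply Rderiv_cont. apply (Rderiv_Clog (fun x => turned s + RtoC x)%C).
      - apply Rderiv_plus; [apply Rderiv_const|]. apply Rderiv_slope. exists (fun _ => RtoC 1); split; [apply ccont_const|].
        split; [reflexivity|intros; ring].
      - replace (turned s + RtoC 0)%C with (turned s) by ring. apply Hs; assumption. }
    apply ccont_minus; [|apply ccont_const]. apply ccont_plus.
    + apply (ccont_comp (T := RU) (outer_int p q) (fun x => normal_pt c sigma (e * x))); [exact Cn|].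
      rewrite N0. apply ccont_plus; apply Co; try lra; intros s Hs' E; apply curve_inj in E; try lra;
      apply Rabs_def1; lra.
    + apply ccont_minus; apply CL; try assumption; lra.
  - intros x Hx.
    assert (Cc : forall a b, is_CInt (fun s => v s / (c s - normal_pt c sigma (e * x)))%C a b
        (CInt (fun s => v s / (c s - normal_pt c sigma (e * x)))%C a b)).
    { intros a b. apply is_CInt_cont; intros s _. apply ccont_div; [|apply velocity_cont|].
      - apply Cminus_neq0; intros E; apply (Hoff x Hx); exists s; exact E.
      - apply ccont_minus; [apply curve_cont|apply ccont_const]. }
    assert (A : is_CInt (fun s => v s / (c s - normal_pt c sigma (e * x)))%C 0 T
      (CInt (fun s => v s / (c s - normal_pt c sigma (e * x)))%C (sigma - T / 2) p
       + ((Clog (turned q + RtoC x) - Clog (turned p + RtoC x))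
       + CInt (fun s => v s / (c s - normal_pt c sigma (e * x)))%C q (sigma + T / 2)))%C).
    { apply is_CInt_periodic with (a := sigma - T / 2); [|lra|].
      - intros s. rewrite param_periodic, velocity_periodic. reflexivity.
      - replace (sigma - T / 2 + T) with (sigma + T / 2) by lra.
        apply is_CInt_Chasles with p; [apply Cc|]. apply is_CInt_Chasles with q; [|apply Cc].
        apply arc_integral with d; try assumption; [|apply Hoff, Hx].
        intros s As. apply Hs; [exact As|lra]. }
    pose proof (is_CInt_unique _ _ _ _ A) as E. fold (winding c v 0 T (normal_pt c sigma (e * x))) in E.
    fold (wind c (normal_pt c sigma (e * x))) in E. rewrite (Hw x Hx) in E.
    unfold Xi, outer_int. rewrite E. ring. }
unfold Xi in E0. rewrite Rmult_0_r in E0.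
replace (normal_pt c sigma 0) with z in E0 by (unfold normal_pt; ring).
rewrite !Cplus_0_r in E0. rewrite <- Ceq_minus in E0. rewrite <- E0. ring.
Qed.

(** The argument is unchanged by positive factors, and chord s / (s - sigma) tends
    to 1, so the two directions tend to e i and - e i. *)
Lemma arg_limit k : 0 < k -> exists d, 0 < d /\ forall p q, sigma - d < p < sigma -> sigma < q < sigma + d ->
  Rabs (Arg (turned q) - Arg (turned p) - e * PI) < k.
Proof.
intros Hk. destruct rot_slit as [d0 [Hd0 Hs]].
assert (R0 : exists r, ccontR r sigma /\ r sigma = RtoC 1 /\
   forall s, chord s = (RtoC (s - sigma) * r s)%C).
{ destruct (proj1 (Rderiv_slope _ _ _) (chord_derive sigma)) as [r [Cr [Er Hr]]]. exists r; split; [exact Cr|]. split.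
  - rewrite Er. field. apply velocity_neq0.
  - intros s. rewrite Hr, chord_base, RtoC_minus. ring. }
destruct R0 as [r [Cr [Er Hr]]].
assert (L : forall a, a * a = 1 -> exists d, 0 < d /\ forall s, Rabs (s - sigma) < d ->
  Rabs (Arg (RtoC a * Ci * r s) - a * (PI / 2)) < k / 2).
{ intros a Ha.
  assert (Ea : (RtoC a * Ci * r sigma)%C = (0, a)) by (rewrite Er; apply injective_projections; simpl; ring).
  assert (Ca : continuous (fun s => Arg (RtoC a * Ci * r s)) sigma).
  { apply (Arg_cont (T := RU) (fun s => RtoC a * Ci * r s)%C).
    - apply ccont_mult; [apply ccont_const|exact Cr].
    - rewrite Ea. left; simpl. intros E; rewrite E in Ha; lra. }
  assert (Hk2 : 0 < k / 2) by lra.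
  destruct (proj1 (locally_Rabs _ _) (proj1 (filterlim_locally _ _) Ca (mkposreal _ Hk2))) as [d [Hd H]].
  exists d; split; [exact Hd|]. intros s Hs'. specialize (H s Hs').
  change (Rabs (Arg (RtoC a * Ci * r s) - Arg (RtoC a * Ci * r sigma)) < k / 2) in H.
  rewrite Ea, (Arg_i a Ha) in H. exact H. }
destruct (L e He) as [da [Hda La]].
destruct (L (- e) ltac:(rewrite Rmult_opp_opp; exact He)) as [db [Hdb Lb]].
exists (Rmin d0 (Rmin da db)). split; [repeat apply Rmin_glb_lt; assumption|].
intros p q Hp Hq.
assert (M1 : Rmin d0 (Rmin da db) <= d0) by apply Rmin_l.
assert (M2 : Rmin d0 (Rmin da db) <= da) by (eapply Rle_trans; [apply Rmin_r|apply Rmin_l]).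
assert (M3 : Rmin d0 (Rmin da db) <= db) by (eapply Rle_trans; [apply Rmin_r|apply Rmin_r]).
assert (Aq : Arg (turned q) = Arg (RtoC e * Ci * r q)).
{ rewrite <- (Arg_scale (/ (q - sigma)) (turned q)).
  - f_equal. rewrite Hr, RtoC_inv by lra. field. intros E; apply RtoC_inj in E; lra.
  - apply Rinv_0_lt_compat; lra.
  - apply Hs; [apply Rabs_def1; lra|lra]. }
assert (Apq : Arg (turned p) = Arg (RtoC (- e) * Ci * r p)).
{ rewrite <- (Arg_scale (/ (sigma - p)) (turned p)).
  - f_equal. rewrite Hr, RtoC_inv by lra. replace (p - sigma) with (- (sigma - p)) by ring. rewrite !RtoC_opp.
    field. intros E; apply RtoC_inj in E; lra.
  - apply Rinv_0_lt_compat; lra.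
  - apply Hs; [apply Rabs_def1; lra|lra]. }
pose proof (La q ltac:(apply Rabs_def1; lra)) as B1. pose proof (Lb p ltac:(apply Rabs_def1; lra)) as B2.
rewrite Aq, Apq. apply Rabs_def2 in B1; apply Rabs_def2 in B2. apply Rabs_def1; lra.
Qed.

(** The logarithms at p and q have the same real part, since |c p - z| = |c q - z|;
    only the difference of the arguments remains. *)
Lemma outer_limit k : 0 < k -> exists d, 0 < d /\ forall p q, sigma - d < p < sigma -> sigma < q < sigma + d ->
  sigma - T / 2 <= p -> q <= sigma + T / 2 -> Cmod (c p - z) = Cmod (c q - z) ->
  Cmod (outer_int p q z - (w - RtoC e * PI * Ci)) < k.
Proof.
intros Hk. destruct outer_eq as [da [Hda Ho]]. destruct (arg_limit k Hk) as [db [Hdb Ha]].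
exists (Rmin da db). split; [apply Rmin_glb_lt; assumption|].
intros p q Hp Hq Hp' Hq' Epq.
pose proof (Rmin_l da db). pose proof (Rmin_r da db).
rewrite Ho by lra. specialize (Ha p q ltac:(lra) ltac:(lra)).
assert (Eg : Cmod (turned p) = Cmod (turned q)).
{ rewrite !Cmod_mult. f_equal. rewrite !chord_curve, !Cmod_mult in Epq.
  apply Rmult_eq_reg_l in Epq; [exact Epq|]. apply Rgt_not_eq, Cmod_pos, velocity_neq0. }
replace (w - (Clog (turned q) - Clog (turned p)) - (w - RtoC e * PI * Ci))%C
  with (- (RtoC (Arg (turned q) - Arg (turned p) - e * PI) * Ci))%C.
- rewrite Cmod_opp, Cmod_mult, Cmod_Ci, Rmult_1_r, Cmod_R. exact Ha.
- unfold Clog. rewrite Eg. apply injective_projections; simpl; ring.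
Qed.
End Side.

(** Compare the two expressions of the same outer integral, from the left and from the
    right. *)
Lemma wind_jump d1 wl wr : 0 < d1 ->
  (forall d, 0 < d <= d1 -> ~ on_curve c (normal_pt c sigma d) /\ wind c (normal_pt c sigma d) = wl) ->
  (forall d, 0 < d <= d1 -> ~ on_curve c (normal_pt c sigma (- d)) /\ wind c (normal_pt c sigma (- d)) = wr) ->
  (wl - wr)%C = (2 * PI * Ci)%C.
Proof.
intros Hd1 HL HR. apply Ceq_minus, Cmod_eq_0.
match goal with |- ?x = 0 => destruct (Rle_lt_or_eq_dec 0 x (Cmod_ge_0 _)) as [Hp|]; [exfalso|auto] end.
match type of Hp with 0 < Cmod ?x => set (X := x) in * end.
assert (Hk : 0 < Cmod X / 2) by lra.
destruct (outer_limit 1 d1 wl ltac:(lra) Hd1) with (k := Cmod X / 2) as [da [Hda La]].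
{ intros d Hd. rewrite Rmult_1_l. apply HL, Hd. }
{ intros d Hd. rewrite Rmult_1_l. apply HL, Hd. }
{ exact Hk. }
destruct (outer_limit (- (1)) d1 wr ltac:(lra) Hd1) with (k := Cmod X / 2) as [db [Hdb Lb]].
{ intros d Hd. replace (- (1) * d) with (- d) by ring. apply HR, Hd. }
{ intros d Hd. replace (- (1) * d) with (- d) by ring. apply HR, Hd. }
{ exact Hk. }
destruct (cutoff_arc (Rmin da db) ltac:(apply Rmin_glb_lt; assumption)) as [e0 [He0 Hc]].
destruct (Hc (e0 / 2) ltac:(lra)) as (p & q & Hp1 & Hq1 & E1 & E2 & Hp2 & Hq2 & _).
pose proof (Rmin_l da db). pose proof (Rmin_r da db).
specialize (La p q ltac:(lra) ltac:(lra) Hp2 Hq2 ltac:(lra)).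
specialize (Lb p q ltac:(lra) ltac:(lra) Hp2 Hq2 ltac:(lra)).
assert (EX : X = ((outer_int p q z - (wr - RtoC (- (1)) * PI * Ci)) + - (outer_int p q z - (wl - RtoC 1 * PI * Ci)))%C).
{ unfold X. rewrite RtoC_opp. ring. }
pose proof (Cmod_triangle (outer_int p q z - (wr - RtoC (- (1)) * PI * Ci)) (- (outer_int p q z - (wl - RtoC 1 * PI * Ci)))) as Tr.
rewrite <- EX, Cmod_opp in Tr. lra.
Qed.

(** Off the arc, g t/(t - z) = slope g t z + g z/(t - z). The first term is bounded, so
    its integral converges to that over the whole curve; the second one is the outer
    integral. *)
Lemma PV_value (U : C -> Prop) (g : C -> C) d1 w : Copen U -> hol U g -> (forall s, U (c s)) -> 0 < d1 ->
  (forall d, 0 < d <= d1 -> ~ on_curve c (normal_pt c sigma d) /\ wind c (normal_pt c sigma d) = w) ->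
  is_PV c (Cauchy_kernel g z) z
    (CInt (fun s => slope g (c s) z * v s)%C 0 T + g z * (w - PI * Ci))%C.
Proof.
intros HU Hg HcU Hd1 HL. pose proof (period_pos c) as HT.
assert (Cq : forall s, ccontR (fun s => slope g (c s) z * v s)%C s).
{ intros s.
  pose proof (slope_integrand_cont2 c v (s - T) (s - T + T) U g (curve_closed c (s - T)) HU Hg (fun s _ => HcU s)
    (T := RU) (fun _ => z) s 0 ltac:(lra) (ccont_const (T := RU) z 0) (HcU sigma)) as Q.
  exact (ccont2_l (T := RU) (fun s _ => slope g (c s) z * v s)%C s 0 Q). }
assert (Iq : forall a b, is_CInt (fun s => slope g (c s) z * v s)%C a b (CInt (fun s => slope g (c s) z * v s)%C a b)).
{ intros; apply is_CInt_cont; intros s _; apply Cq. }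
set (K := CInt (fun s => slope g (c s) z * v s)%C 0 T).
assert (EK : CInt (fun s => slope g (c s) z * v s)%C (sigma - T / 2) (sigma + T / 2) = K).
{ symmetry; apply is_CInt_unique. apply is_CInt_periodic with (a := sigma - T / 2); [|lra|].
  - intros s; rewrite param_periodic, velocity_periodic; reflexivity.
  - replace (sigma - T / 2 + T) with (sigma + T / 2) by lra. apply Iq. }
(* the arc lost in the bounded term costs at most 2 db M, and the outer integral enters with the
   factor g z: each is kept within k / 2 *)
destruct (ccont_bounded _ (sigma - T / 2) (sigma + T / 2) ltac:(lra) (fun s _ => Cq s)) as [M [HM BM]].
intros P HP. apply locally_Cmod in HP as [k [Hk HP]].
set (k1 := k / 2 / (Cmod (g z) + 1)).
assert (Hk1 : 0 < k1).
{ apply Rdiv_lt_0_compat; [lra|]. pose proof (Cmod_ge_0 (g z)); lra. }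
destruct (outer_limit 1 d1 w ltac:(lra) Hd1) with (k := k1) as [da [Hda La]].
{ intros d Hd. rewrite Rmult_1_l. apply HL, Hd. }
{ intros d Hd. rewrite Rmult_1_l. apply HL, Hd. }
{ exact Hk1. }
set (db := k / (4 * (M + 1))).
assert (Hdb : 0 < db) by (apply Rdiv_lt_0_compat; lra).
destruct (cutoff_arc (Rmin da db) ltac:(apply Rmin_glb_lt; assumption)) as [e0 [He0 Hc]].
apply locally_Rabs; exists e0; split; [exact He0|]. intros eps Heps Hpos.
rewrite Rminus_0_r in Heps. pose proof (Rle_abs eps).
destruct (Hc eps ltac:(lra)) as (p & q & Hp1 & Hq1 & E1 & E2 & Hp2 & Hq2 & Hcut).
pose proof (Rmin_l da db). pose proof (Rmin_r da db).
specialize (La p q ltac:(lra) ltac:(lra) Hp2 Hq2 ltac:(lra)).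
set (h := fun s => if Rle_dec eps (Cmod (c s - z)) then (Cauchy_kernel g z (c s) * v s)%C else RtoC 0).
assert (Hout : forall s, sigma - T / 2 <= s <= sigma + T / 2 -> s < p \/ q < s ->
  h s = (slope g (c s) z * v s + g z * (v s / (c s - z)))%C).
{ intros s Hs Hs'. pose proof (proj2 (Hcut s Hs) Hs') as L. unfold h.
  destruct (Rle_dec eps (Cmod (c s - z))); [|contradiction].
  assert (Hn : c s <> z).
  { intros E. rewrite E, Cmod_sub_diag in L. lra. }
  rewrite slope_neq by exact Hn. unfold Cauchy_kernel. field. apply Cminus_neq0, Hn. }
assert (Io : forall a b, a <= b -> (forall s, a <= s <= b -> c s <> z) ->
  is_CInt (fun s => v s / (c s - z))%C a b (CInt (fun s => v s / (c s - z))%C a b)).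
{ intros; apply is_CInt_cauchy_type; auto; intros; [apply curve_cont|apply velocity_cont]. }
assert (nz : forall s, sigma - T / 2 <= s <= sigma + T / 2 -> s <= p \/ q <= s -> c s <> z).
{ intros s Hs Hs' E. apply curve_inj in E; [lra|]. apply Rabs_def1; lra. }
set (I1 := CInt (fun s => slope g (c s) z * v s)%C (sigma - T / 2) p).
set (I2 := CInt (fun s => slope g (c s) z * v s)%C p q).
set (I3 := CInt (fun s => slope g (c s) z * v s)%C q (sigma + T / 2)).
assert (EI : (I1 + (I2 + I3))%C = K).
{ rewrite <- EK. symmetry; apply is_CInt_unique. apply is_CInt_Chasles with p; [apply Iq|].
  apply is_CInt_Chasles with q; apply Iq. }
exists (I1 + I3 + g z * outer_int p q z)%C. split.
- apply is_CInt_periodic with (a := sigma - T / 2); [|lra|].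
  { intros s; rewrite param_periodic, velocity_periodic; reflexivity. }
  replace (sigma - T / 2 + T) with (sigma + T / 2) by lra.
  replace (I1 + I3 + g z * outer_int p q z)%C
    with ((I1 + g z * CInt (fun s => v s / (c s - z))%C (sigma - T / 2) p)
      + (RtoC 0 + (I3 + g z * CInt (fun s => v s / (c s - z))%C q (sigma + T / 2))))%C by (unfold outer_int; ring).
  apply is_CInt_Chasles with p; [|apply is_CInt_Chasles with q].
  + apply is_CInt_ext with (fun s => slope g (c s) z * v s + g z * (v s / (c s - z)))%C.
    * intros s Hs. rewrite Rmin_left, Rmax_right in Hs by lra. symmetry; apply Hout; lra.
    * apply is_CInt_plus; [apply Iq|]. apply is_CInt_scal, Io; [lra|]. intros s Hs; apply nz; lra.
  + apply is_CInt_ext with (fun _ => RtoC 0).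
    * intros s Hs. rewrite Rmin_left, Rmax_right in Hs by lra.
      pose proof (proj1 (Hcut s ltac:(lra)) Hs) as L.
      destruct (Rle_dec eps (Cmod (c s - z))); [lra|reflexivity].
    * pose proof (is_CInt_const (RtoC 0) p q) as I0. rewrite Cmult_0_r in I0. exact I0.
  + apply is_CInt_ext with (fun s => slope g (c s) z * v s + g z * (v s / (c s - z)))%C.
    * intros s Hs. rewrite Rmin_left, Rmax_right in Hs by lra. symmetry; apply Hout; lra.
    * apply is_CInt_plus; [apply Iq|]. apply is_CInt_scal, Io; [lra|]. intros s Hs; apply nz; lra.
- apply HP. rewrite <- EI.
  replace (I1 + I3 + g z * outer_int p q z - (I1 + (I2 + I3) + g z * (w - PI * Ci)))%C
    with (g z * (outer_int p q z - (w - RtoC 1 * PI * Ci)) + - I2)%C by ring.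
  eapply Rle_lt_trans; [apply Cmod_triangle|]. rewrite Cmod_opp, Cmod_mult.
  assert (B2 : Cmod I2 <= Rabs (q - p) * M).
  { eapply is_CInt_bound; [|apply Iq]. intros s Hs; apply between_le in Hs; [|lra]. apply BM; lra. }
  rewrite Rabs_right in B2 by lra.
  assert (B3 : (q - p) * M < k / 2).
  { assert (q - p <= 2 * db) by lra.
    apply Rle_lt_trans with (2 * db * M); [apply Rmult_le_compat_r; lra|].
    apply Rlt_le_trans with (2 * db * (M + 1)); [apply Rmult_lt_compat_l; lra|].
    right; unfold db; field; lra. }
  assert (B4 : Cmod (g z) * Cmod (outer_int p q z - (w - RtoC 1 * PI * Ci)) <= k / 2).
  { pose proof (Cmod_ge_0 (g z)).
    apply Rle_trans with ((Cmod (g z) + 1) * k1).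
    - apply Rmult_le_compat; try lra. apply Cmod_ge_0.
    - right; unfold k1; field; lra. }
  lra.
Qed.
End PV.

(** * The boundary integrals *)

Section Main.
Variable c : closed_curve.
Notation v := (velocity c).
Notation T := (period c).

Lemma joined_locally z : ~ on_curve c z -> locally (T := CU) z (joined_off c z).
Proof.
intros Hz. destruct (proj1 (locally_Cmod _ _) (off_curve_locally c z Hz)) as [d [Hd H]].
apply locally_Cmod; exists d; split; [exact Hd|]. intros w Hw. apply joined_segment. intros u Hu.
apply H. replace (z + RtoC u * (w - z) - z)%C with (RtoC u * (w - z))%C by ring.
rewrite Cmod_mult, Cmod_R, Rabs_right by lra. pose proof (Cmod_ge_0 (w - z)). nra.
Qed.

Lemma interior_open : Copen (interior_domain c).
Proof.
intros z Hz. generalize (joined_locally z (proj1 Hz)); apply filter_imp.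
intros w J; apply (interior_joined c z); assumption.
Qed.

Lemma exterior_open : Copen (exterior_domain c).
Proof.
intros z Hz. generalize (joined_locally z (proj1 Hz)); apply filter_imp.
intros w J; apply (exterior_joined c z); assumption.
Qed.

Lemma reduce_curve z : on_curve c z -> exists s, - (T / 2) <= s <= T / 2 /\ c s = z.
Proof.
intros [t <-]. destruct (reduce_mod c (- (T / 2)) t) as [k Hk].
exists (t + IZR k * T). split; [lra|apply curve_Z].
Qed.

Hypothesis Hccw : counterclockwise c.

(** All interior points are joined to the left side, where wind exceeds by 2 pi i its
    value on the right side, which is 0. *)
Lemma wind_interior z : interior_domain c z -> wind c z = (2 * PI * Ci)%C.
Proof.
intros Hz. pose proof (period_pos c) as HT. destruct (two_sides c Hccw) as (d1 & Hd1 & HL & HR & HJ).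
rewrite (wind_joined c z _ (HJ z Hz)).
assert (J := wind_jump c 0 ltac:(lra) d1 (wind c (normal_pt c 0 d1)) (RtoC 0) Hd1).
rewrite <- J.
- ring.
- intros d Hd. split; [apply (HL 0 d Hd)|]. rewrite (wind_joined c _ _ (HJ _ (HL 0 d Hd))). reflexivity.
- intros d Hd. split; [apply (HR 0 d Hd)|]. apply wind_exterior, HR, Hd.
Qed.

Section Boundary.
Variables (U : C -> Prop) (g : C -> C) (kappa : C).
Hypotheses (HU : Copen U) (Hg : hol U g) (HcU : forall z, on_curve c z -> U z).
Hypothesis (HW : forall z, ~ U z -> wind c z = kappa).
Hypothesis (Hdecay : forall e, 0 < e -> exists r, forall z, U z -> r < Cmod z ->
  Cmod (kappa * (g z * (z - c 0))) <= e).

(** By [dixon] the integral of slope g t z is - kappa g z, and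
    - kappa + (2 pi i - pi i) = pi i - kappa. *)
Lemma boundary_PV z : on_curve c z -> is_PV c (Cauchy_kernel g z) z ((PI * Ci - kappa) * g z)%C.
Proof.
intros Hz. destruct (reduce_curve z Hz) as [s [Hs <-]].
destruct (two_sides c Hccw) as (d1 & Hd1 & HL & _).
assert (Hc : forall s, U (c s)) by (intros t; apply HcU; exists t; reflexivity).
pose proof (PV_value c s Hs U g d1 (2 * PI * Ci)%C HU Hg Hc Hd1) as P.
rewrite (dixon c v 0 T U g kappa (curve_closed0 c) HU Hg (fun s _ => Hc s) HW) in P; [| |apply Hc].
- replace ((PI * Ci - kappa) * g (c s))%C with (- (kappa * g (c s)) + g (c s) * (2 * PI * Ci - PI * Ci))%C by ring.
  apply P. intros d Hd. split; [apply (HL s d Hd)|apply wind_interior, HL, Hd].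
- intros e He. destruct (Hdecay e He) as [r Hr]. exists (Rmax r (Cmod (c 0) + 1)). intros w Uw Hw.
  pose proof (Rmax_l r (Cmod (c 0) + 1)). pose proof (Rmax_r r (Cmod (c 0) + 1)).
  apply Rle_trans with (2 := Hr w Uw ltac:(lra)).
  rewrite Cmult_assoc, (Cmod_mult _ (w - c 0)). 
  assert (1 <= Cmod (w - c 0)).
  { pose proof (Cmod_triangle (w - c 0) (c 0)) as Tr. replace (w - c 0 + c 0)%C with w in Tr by ring. lra. }
  pose proof (Cmod_ge_0 (kappa * g w)). nra.
Qed.

(** The quotient of f z = g z (z - c 0) between t and c 0 is g t, and f (c 0) = 0. *)
Lemma boundary_integral_zero : CInt (fun s => g (c s) * v s)%C 0 T = RtoC 0.
Proof.
assert (Hc : forall s, U (c s)) by (intros t; apply HcU; exists t; reflexivity).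
set (f := fun w => (g w * (w - c 0))%C).
assert (Df : forall w, U w -> Cderiv f w (C_derive g w * (w - c 0) + g w * (RtoC 1 - RtoC 0))%C).
{ intros w Uw. apply (Cderiv_mult g (fun w => w - c 0)%C); [apply (hol_derive U); assumption|].
  apply Cderiv_minus; [apply Cderiv_id|apply Cderiv_const]. }
pose proof (dixon c v 0 T U f kappa (curve_closed0 c) HU (fun w Uw => ex_intro _ _ (Df w Uw))
  (fun s _ => Hc s) HW Hdecay (c 0) (Hc 0)) as E.
replace (f (c 0)) with (RtoC 0) in E by (unfold f; ring).
replace (- (kappa * 0))%C with (RtoC 0) in E by ring. rewrite <- E.
apply CInt_ext; intros s _. f_equal. destruct (Ceq_dec (c s) (c 0)) as [->|Hn].
- rewrite slope_eq. rewrite (is_C_derive_unique _ _ _ (Df _ (Hc 0))). ring.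
- rewrite slope_neq by exact Hn. unfold f. field. apply Cminus_neq0, Hn.
Qed.

(** The factor a normalizes the principal value to g, so K and g agree on the
    curve. *)
Lemma boundary_conclusion (K : C -> C) (a : C) : (a * (PI * Ci - kappa))%C = RtoC 1 ->
  (forall z, K z = (a * PV c (Cauchy_kernel g z) z)%C) ->
  (forall z, on_curve c z -> ex_PV c (Cauchy_kernel g z) z) /\
  ex_contour_int c K /\ ex_contour_int c g /\
  contour_int c K = contour_int c g /\ contour_int c g = RtoC 0.
Proof.
intros Ha HK.
assert (EK : forall s, K (c s) = g (c s)).
{ intros s. rewrite HK, (is_PV_unique _ _ _ _ (boundary_PV (c s) (ex_intro _ s eq_refl))).
  rewrite Cmult_assoc, Ha. ring. }
assert (Ig : ex_CInt (fun s => g (c s) * v s)%C 0 T).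
{ apply ex_CInt_cont; intros s _. apply ccont_mult; [|apply velocity_cont].
  apply (ccont_comp (T := RU)); [apply curve_cont|].
  exact (Cderiv_cont _ _ _ (hol_derive U g Hg _ (HcU _ (ex_intro _ s eq_refl)))). }
split; [|split; [|split; [|split]]].
- intros z Hz. eexists; apply boundary_PV, Hz.
- destruct Ig as [l Hl]. exists l. eapply is_CInt_ext; [|exact Hl].
  intros s _. cbv beta. rewrite EK. reflexivity.
- exact Ig.
- refine (CInt_ext _ _ _ _ _). intros s _. rewrite EK. reflexivity.
- apply boundary_integral_zero.
Qed.
End Boundary.

Lemma order_hol n D f : Copen D -> holomorphic_of_order n c D f ->
  exists U, Copen U /\ hol U f /\ (forall z, D z -> U z) /\ (forall z, on_curve c z -> U z).
Proof.
intros HD (V & [HVo HVc] & Hf & _). exists (fun z => D z \/ V z).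
split; [|split; [exact Hf|split; auto]].
intros z [Hz|Hz].
- generalize (HD z Hz); apply filter_imp; auto.
- generalize (HVo z Hz); apply filter_imp; auto.
Qed.

(** Cauchy estimates on discs of radius 1: on such a disc around z the modulus is at
    least half of that of z. *)
Lemma derivative_decay U F n : Copen U -> hol U F -> (forall z, exterior_domain c z -> U z) ->
  (exists m : nat, (2 <= m)%nat /\ exists M r : R, 0 < r /\
      forall z, r <= Cmod z -> Cmod (F z) <= M / Cmod z ^ m) ->
  exists M r, 0 <= M /\ 1 <= r /\ forall z, r <= Cmod z -> Cmod (C_derive_n F n z) <= M / Cmod z ^ 2.
Proof.
intros HU HF HE (m & Hm & M0 & r0 & Hr0 & H0). induction n as [|n IH].
- exists (Rabs M0), (Rmax 1 r0). split; [apply Rabs_pos|]. split; [apply Rmax_l|]. intros z Hz.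
  pose proof (Rmax_l 1 r0). pose proof (Rmax_r 1 r0).
  eapply Rle_trans; [apply H0; lra|]. unfold Rdiv.
  assert (P2 : 0 < Cmod z ^ 2) by (apply pow_lt; lra).
  assert (Pm : Cmod z ^ 2 <= Cmod z ^ m) by (apply Rle_pow; [lra|exact Hm]).
  apply Rle_trans with (Rabs M0 * / Cmod z ^ m).
  + apply Rmult_le_compat_r; [left; apply Rinv_0_lt_compat; lra|apply Rle_abs].
  + apply Rmult_le_compat_l; [apply Rabs_pos|]. apply Rinv_le_contravar; lra.
- destruct IH as (M & r & HM & Hr & H). destruct (far_exterior c) as [R1 [HR1 Hfar]].
  exists (4 * M), (Rmax (r + 2) (R1 + 5)). split; [lra|].
  pose proof (Rmax_l (r + 2) (R1 + 5)). pose proof (Rmax_r (r + 2) (R1 + 5)).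
  split; [lra|]. intros z Hz.
  pose proof (hol_derive_n U F n HU HF) as Hn.
  replace (4 * M / Cmod z ^ 2) with (4 * M / Cmod z ^ 2 / 1) by apply Rdiv_1_r.
  apply (cauchy_estimate U (C_derive_n F n) z 2 1); [exact HU|exact Hn| |lra|].
  + intros w [W1 W2]. apply HE, Hfar.
    pose proof (Cmod_triangle (z - w) w) as Tr. replace (z - w + w)%C with z in Tr by ring.
    pose proof (Cmod_Rabs_le (w - z)) as B. rewrite Cmod_sub_sym in B. simpl in B. unfold Rminus in *. lra.
  + intros t. pose proof (Cmod_circ z 1 t ltac:(lra)) as Ec.
    set (w := circ z 1 t) in *.
    assert (Lw : Cmod z - 1 <= Cmod w).
    { pose proof (Cmod_triangle (z - w) w) as Tr. replace (z - w + w)%C with z in Tr by ring.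
      rewrite Cmod_sub_sym in Tr. lra. }
    eapply Rle_trans; [apply H; lra|].
    assert (P : 0 < Cmod z ^ 2) by (apply pow_lt; lra).
    assert (Q : Cmod z ^ 2 / 4 <= Cmod w ^ 2) by nra.
    replace (4 * M / Cmod z ^ 2) with (M * / (Cmod z ^ 2 / 4)) by (field; lra).
    apply Rmult_le_compat_l; [exact HM|]. apply Rinv_le_contravar; lra.
Qed.
End Main.

Theorem mainTheorem6 :
  forall (c : closed_curve) (n : nat) (f F : C -> C),
    counterclockwise c ->
    generalized_Cauchy_function n c f ->
    complement_function n c F ->
    ((forall z, on_curve c z -> ex_PV c (Cauchy_kernel (C_derive_n f n) z) z) /\
     ex_contour_int c (K_op n c f) /\
     ex_contour_int c (C_derive_n f n) /\
     contour_int c (K_op n c f) = contour_int c (C_derive_n f n) /\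
     contour_int c (C_derive_n f n) = RtoC 0) /\
    ((forall z, on_curve c z -> ex_PV c (Cauchy_kernel (C_derive_n F n) z) z) /\
     ex_contour_int c (Kminus_op n c F) /\
     ex_contour_int c (C_derive_n F n) /\
     contour_int c (Kminus_op n c F) = contour_int c (C_derive_n F n) /\
     contour_int c (C_derive_n F n) = RtoC 0).
Proof.
intros c n f F Hccw Hf [HF Hdec].
pose proof PI_C_neq0 as Npi.
pose proof Ci_nz as Ni.
split.
- destruct (order_hol c n _ f (interior_open c) Hf) as (U & HU & Hh & HD & Hc).
  apply (boundary_conclusion c Hccw U (C_derive_n f n) (RtoC 0)) with (a := (1 / (PI * Ci))%C).
  + exact HU.
  + apply hol_derive_n; assumption.
  + exact Hc.
  + intros z Hz. apply wind_exterior.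
    destruct (interior_exterior c z (fun H => Hz (Hc z H))) as [H|H]; [destruct (Hz (HD z H))|exact H].
  + intros e He. exists 0. intros z _ _. rewrite Cmult_0_l, Cmod_0. lra.
  + field. auto.
  + reflexivity.
- destruct (order_hol c n _ F (exterior_open c) HF) as (U & HU & Hh & HD & Hc).
  apply (boundary_conclusion c Hccw U (C_derive_n F n) (2 * PI * Ci)%C) with (a := (-1 / (PI * Ci))%C).
  + exact HU.
  + apply hol_derive_n; assumption.
  + exact Hc.
  + intros z Hz. apply (wind_interior c Hccw).
    destruct (interior_exterior c z (fun H => Hz (Hc z H))) as [H|H]; [exact H|destruct (Hz (HD z H))].
  + destruct (derivative_decay c U F n HU Hh HD Hdec) as (M & r & HM & Hr & HB).
    intros e He. pose proof PI_RGT_0 as Hpi.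
    set (N := Cmod (c 0)). assert (HN : 0 <= N) by apply Cmod_ge_0.
    exists (Rmax r (2 * PI * M * (1 + N) / e)). intros z _ Hz.
    pose proof (Rmax_l r (2 * PI * M * (1 + N) / e)). pose proof (Rmax_r r (2 * PI * M * (1 + N) / e)).
    assert (Z1 : 1 <= Cmod z) by lra.
    rewrite !Cmod_mult, Cmod_Ci, !Cmod_R, !Rabs_right by lra. rewrite Rmult_1_r.
    assert (B1 : Cmod (z - c 0) <= (1 + N) * Cmod z).
    { eapply Rle_trans; [apply Cmod_triangle|]. rewrite Cmod_opp. fold N. nra. }
    assert (B2 : Cmod (C_derive_n F n z) * Cmod (z - c 0) <= M / Cmod z ^ 2 * ((1 + N) * Cmod z)).
    { apply Rmult_le_compat; try apply Cmod_ge_0; [apply HB; lra|exact B1]. }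
    replace (M / Cmod z ^ 2 * ((1 + N) * Cmod z)) with (M * (1 + N) / Cmod z) in B2 by (field; lra).
    apply Rle_trans with (2 * PI * (M * (1 + N) / Cmod z)); [apply Rmult_le_compat_l; lra|].
    replace (2 * PI * (M * (1 + N) / Cmod z)) with (2 * PI * M * (1 + N) / Cmod z) by (field; lra).
    apply Rle_div_l; [lra|].
    assert (L : 2 * PI * M * (1 + N) / e <= Cmod z) by lra.
    apply Rle_div_l in L; [lra|exact He].
  + field. auto.
  + reflexivity.
Qed.
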